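(* Let $T>0$, $a\in X$, $\mu_0\in\mathcal P_c(\mathbb R^d)$, and let $K=[0,2R]$ with $R>0$ the support radius described in the context. Let $$M\ \ge\ \|a\|_{L_\infty(K)}+\|a'\|_{L_\infty(K)} .$$ For every $N\in\mathbb N$ let $x^N_{0,1},\dots,x^N_{0,N}$ be i.i.d. with law $\mu_0$ (taking values in $\operatorname{supp}(\mu_0)$), let $\mu_0^N=\frac1N\sum_{i=1}^N\delta_{x^N_{0,i}}$, and let $\mathcal E^{[a],N}$ be the discrete error functional associated with the solution $\mu^N$ of the mean-field equation with initial datum $\mu^N_0$. Let $V_N\subset X_{M,K}$, $N\in\mathbb N$, be a sequence of closed subsets with the uniform approximation property, and let $$\widehat a_N\in\operatorname*{arg\,min}_{\widehat a\in V_N}\mathcal E^{[a],N}(\widehat a)\qquad (N\in\mathbb N).$$ Then, almost surely with respect to the draw of the initial data: (1) The sequence $(\widehat a_N)_{N\in\mathbb N}$ has a subsequence converging uniformly on $K$ to some continuous function $\widehat a\in X_{M,K}$ such that $\mathcal E^{[a]}(\widehat a)=0$. (2) If in addition the coercivity condition holds, then $\widehat a=a$ in $L_2(\mathbb R_+,\rho)$. (3) If the coercivity condition holds and moreover there exist rates $\alpha,\beta>0$, constants $C_1,C_2>0$, and a sequence $(a_N)_{N\in\mathbb N}$ of elements $a_N\in V_N$ such that, for all $N\in\mathbb N$, $$\|a-a_N\|_{L_\infty(K)}\le C_1N^{-\alpha}\qquad\text{and}\qquad \mathcal W_1(\mu_0^N,\mu_0)\le C_2N^{-\beta},$$ then there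 exists a constant $C_3>0$ such that $$\|a-\widehat a_N\|^2_{L_2(\mathbb R_+,\rho)}\le C_3N^{-\min\{\alpha,\beta\}}\qquad\text{for all }N\in\mathbb N;$$ in particular, in this case the entire sequence $(\widehat a_N)_{N\in\mathbb N}$ (and not only a subsequence) converges to $a$ in $L_2(\mathbb R_+,\rho)$.
   Context: $\mathbb R_+=[0,\infty)$. $\mathcal P_1(\mathbb R^d)$ is the set of probability measures with finite first moment, $\mathcal P_c(\mathbb R^d)$ the set of compactly supported ones, $\mathcal W_1$ the $1$-Wasserstein distance, $B(0,R)$ the closed ball of radius $R$ in $\mathbb R^d$. Admissible kernels: $X=\{b:\mathbb R_+\to\mathbb R \mid b\in L_\infty(\mathbb R_+)\cap W^1_{\infty,\mathrm{loc}}(\mathbb R_+)\}$ (bounded functions that are Lipschitz on compact subsets of $\mathbb R_+$). For a kernel $b$, $F^{[b]}(z)=-b(|z|)z$ for $z\in\mathbb R^d$, and $(f*\mu)(x)=\int_{\mathbb R^d}f(x-y)\,d\mu(y)$. Mean-field equation: $\partial_t\mu(t)=-\nabla\cdot((F^{[a]}*\mu(t))\mu(t))$ on $(0,T]$, $\mu(0)=\mu_0$. A solution is a map $\mu:[0,T]\to\mathcal P_1(\mathbb R^d)$ that is $\mathcal W_1$-continuous, has support in a fixed ball for all $t\in[0,T]$, satisfies $\mu(0)=\mu_0$, and satisfies $\frac{d}{dt}\int\phi\,d\mu(t)=\int\nabla\phi\cdot(F^{[a]}*\mu(t))\,d\mu(t)$ for every $\phi\in C_c^\infty(\mathbb R^d;\mathbb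 R)$. For $a\in X$ and compactly supported initial datum the solution exists and is unique. Let $\mu$ denote the solution with datum $\mu_0$ and $\mu^N$ the solution with datum $\mu_0^N=\frac1N\sum_i\delta_{x^N_{0,i}}$; then $\mu^N(t)=\frac1N\sum_{i=1}^N\delta_{x_i^N(t)}$, where $\dot x_i^N=\frac1N\sum_{j=1}^NF^{[a]}(x^N_i-x^N_j)$, $x_i^N(0)=x^N_{0,i}$. Support radius: $R>0$ is a constant depending only on $T$, $a$, $\operatorname{supp}(\mu_0)$ such that $\operatorname{supp}(\mu^N(t))\cup\operatorname{supp}(\mu(t))\subseteq B(0,R)$ for all $N\in\mathbb N$, $t\in[0,T]$, whenever all $x^N_{0,i}\in\operatorname{supp}(\mu_0)$ (one may take $R=C_0e^{2\|a\|_{L_\infty(\mathbb R_+)}T}$ with $\operatorname{supp}(\mu_0)\subseteq B(0,C_0)$). $X_{M,K}=\{b\in W^1_\infty(K):\|b\|_{L_\infty(K)}+\|b'\|_{L_\infty(K)}\le M\}$. A family of closed (with respect to uniform convergence on $K$) subsets $V_N\subset X_{M,K}$ has the uniform approximation property in $L_\infty(K)$ if for every $b\in X_{M,K}$ there is a sequence $(b_N)_{N}$ with $b_N\in V_N$ for every $N$ converging uniformly to $b$ on $K$. Error functionals: $$\mathcal E^{[a],N}(\widehat a)=\frac1T\int_0^T\int_{\mathbb R^d}\bigl|\bigl((F^{[\widehat a]}-F^{[a]})*\mu^N(t)\bigr)(x)\bigr|^2d\mu^N(t)(x)\,dt,$$ $$\mathcal E^{[a]}(\widehat a)=\frac1T\int_0^T\int_{\mathbb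 R^d}\bigl|\bigl((F^{[\widehat a]}-F^{[a]})*\mu(t)\bigr)(x)\bigr|^2d\mu(t)(x)\,dt.$$ These depend only on the values of $\widehat a$ on $K$, so they are defined for $\widehat a\in X_{M,K}$. Measures: $\varrho(t)$ is the push-forward of $\mu(t)\otimes\mu(t)$ under $(x,y)\mapsto|x-y|$; $\overline\rho(A)=\frac1T\int_0^T\varrho(t)(A)\,dt$ and $\rho(A)=\int_As^2\,d\overline\rho(s)$ for Borel $A\subseteq\mathbb R_+$. The measure $\rho$ is supported in $K$. Coercivity condition: there exists $c_T>0$ such that $c_T\|b-a\|^2_{L_2(\mathbb R_+,\rho)}\le\mathcal E^{[a]}(b)$ for all $b\in X\cap L_2(\mathbb R_+,\rho)$ (both sides depend only on $b|_K$, so it applies to $b\in X_{M,K}$, extended arbitrarily to an element of $X$). *)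

(* Defs.v *)
From HB Require Import structures.
From mathcomp Require Import all_boot all_order all_algebra.
From mathcomp Require Import all_classical all_reals all_analysis.
Set Implicit Arguments.
Unset Strict Implicit.
Unset Printing Implicit Defensive.
Import Order.TTheory GRing.Theory Num.Theory.
Import numFieldNormedType.Exports.
Local Open Scope classical_set_scope.
Local Open Scope ring_scope.

(* R^d with its Borel sigma-algebra; convertible to 'rV[R]_d, which carries
   the vector space structure and the topology. *)
Definition Rd (R : realType) (d : nat) :=
  g_sigma_algebraType (@open 'rV[R]_d).

Section Euclidean.
Context {R : realType} {d : nat}.

(* The library norm on 'rV[R]_d is the sup norm (same topology). *)
Definition enorm (x : 'rV[R]_d) : R := Num.sqrt (\sum_i (x 0 i) ^+ 2).

Definition eball (r : R) : set 'rV[R]_d := [set x | enorm x <= r].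

Definition partial (i : 'I_d) (phi : 'rV[R]_d -> R) : 'rV[R]_d -> R :=
  fun x => 'D_(delta_mx 0 i) (phi : 'rV[R]_d -> R^o) x.

Definition smooth (phi : 'rV[R]_d -> R) : Prop :=
  forall s : seq 'I_d,
    continuous (foldr partial phi s : 'rV[R]_d -> R^o) /\
    forall (i : 'I_d) (x : 'rV[R]_d),
      derivable (foldr partial phi s : 'rV[R]_d -> R^o) x (delta_mx 0 i).

Definition test_function (phi : 'rV[R]_d -> R) : Prop :=
  smooth phi /\ compact (closure [set x | phi x != 0]).

Definition msupp (m : set (Rd R d) -> \bar R) : set 'rV[R]_d :=
  [set x | forall U : set 'rV[R]_d, open_nbhs x U -> (0 < m U)%E].

Definition coupling (m n : set (Rd R d) -> \bar R)
    (p : probability (Rd R d * Rd R d)%type R) : Prop :=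
  forall A : set (Rd R d), measurable A ->
    p (A `*` setT) = m A /\ p (setT `*` A) = n A.

Definition W1 (m n : set (Rd R d) -> \bar R) : \bar R :=
  ereal_inf [set (\int[p]_z (enorm (z.1 - z.2))%:E)%E
            | p in [set p | coupling m n p]].

Definition empirical (N : nat) (x : 'I_N -> 'rV[R]_d) :
    set (Rd R d) -> \bar R :=
  fun A => ((N%:R^-1)%:E * \sum_(i < N) \d_(x i : Rd R d) A)%E.

End Euclidean.

Section Kernels.
Context {R : realType}.

Definition Rplus : set R := `[0, +oo[.

Definition Kint (r : R) : set R := `[0, 2 * r].

Definition admissible (b : R -> R) : Prop :=
  [bounded (b s : R^o) | s in Rplus] /\
  forall S : set R, compact S -> S `<=` Rplus ->
    [lipschitz (b s : R^o) | s in (S : set R^o)].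

(* Norm of L_infty(K): essential supremum with respect to Lebesgue measure. *)
Definition Linfty (K : set R) (f : R -> R) : \bar R :=
  ('N[@lebesgue_measure R]_+oo [EFin \o (f \_ K)])%E.

(* ||b||_{L_infty(K)} + ||b'||_{L_infty(K)}.  For b Lipschitz on the interval K
   the pointwise derivative exists a.e. on K (Rademacher) and is the weak
   derivative; the value of derive1 elsewhere does not matter. *)
Definition W1infty_norm (K : set R) (b : R -> R) : \bar R :=
  (Linfty K b + Linfty K (derive1 (b : R -> R^o)))%E.

(* W^1_infty(K), K a compact interval, consists of the Lipschitz functions on
   K.  An element is represented by a function on R, of which only the values
   on K matter. *)
Definition XMK (M : R) (K : set R) : set (R -> R) :=
  [set b | [lipschitz (b s : R^o) | s in (K : set R^o)] /\
           (W1infty_norm K b <= M%:E)%E].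

(* A set closed in {uniform` K -> R^o} is in particular stable under changing
   the values of its elements outside K. *)
Definition closed_unif (K : set R) (V : set (R -> R)) : Prop :=
  closed (V : set {uniform` K -> R^o}).

Definition unif_cvg (K : set R) (b_ : nat -> R -> R) (b : R -> R) : Prop :=
  {uniform K, (b_ : nat -> (R -> R^o)) @ \oo --> (b : R -> R^o)}.

Definition unif_approx (M : R) (K : set R) (V : nat -> set (R -> R)) : Prop :=
  forall b, XMK M K b ->
    exists2 b_ : nat -> R -> R,
      (forall N, (0 < N)%N -> V N (b_ N)) & unif_cvg K b_ b.

(* Extension of b|_[0, r] to R_+ by constants; it maps functions that are
   Lipschitz on [0, r] to admissible kernels. *)
Definition extend (r : R) (b : R -> R) : R -> R :=
  fun s => b (Num.min (Num.max s 0) r).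

Definition L2sq (rho : set R -> \bar R) (f : R -> R) : \bar R :=
  (\int[rho]_(s in Rplus) ((f s) ^+ 2)%:E)%E.

Definition in_L2 (rho : set R -> \bar R) (f : R -> R) : Prop :=
  measurable_fun Rplus f /\ (L2sq rho f < +oo)%E.

Definition ae_equal (rho : set R -> \bar R) (f g : R -> R) : Prop :=
  \forall s \ae rho, Rplus s -> f s = g s.

End Kernels.

Section MeanField.
Context {R : realType} {d : nat}.

Definition Fker (b : R -> R) (z : 'rV[R]_d) : 'rV[R]_d := - b (enorm z) *: z.

Definition convolve (f : 'rV[R]_d -> 'rV[R]_d) (m : probability (Rd R d) R)
    (x : 'rV[R]_d) : 'rV[R]_d :=
  \row_i \int[m]_y (f (x - y) 0 i).

(* The measures mu t for t outside [0, T] are irrelevant.  The time derivative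
   at t in (0, T] is taken within [0, T], so it is one-sided at T. *)
Definition mf_solution (T : R) (a : R -> R) (mu0 : set (Rd R d) -> \bar R)
    (mu : R -> probability (Rd R d) R) : Prop :=
  [/\ forall t, t \in `[0, T] -> (\int[mu t]_x (enorm x)%:E < +oo)%E,
      forall t, t \in `[0, T] ->
        W1 (mu s) (mu t) @[s --> within `[0, T] (nbhs t)] --> 0%E,
      exists r : R, forall t, t \in `[0, T] -> msupp (mu t) `<=` eball r,
      forall A : set (Rd R d), measurable A -> mu 0 A = mu0 A
    & forall phi : 'rV[R]_d -> R, test_function phi ->
      forall t, t \in `]0, T] ->
        (s - t)^-1 * (\int[mu s]_x phi x - \int[mu t]_x phi x)
          @[s --> within `[0, T] t^'] -->
        \int[mu t]_x (\sum_i partial i phi x * convolve (Fker a) (mu t) x 0 i) ].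

Definition support_radius (T : R) (a : R -> R)
    (mu0 : set (Rd R d) -> \bar R) (r : R) : Prop :=
  [/\ 0 < r,
      forall mu, mf_solution T a mu0 mu ->
        forall t, t \in `[0, T] -> msupp (mu t) `<=` eball r
    & forall (N : nat) (x : 'I_N -> 'rV[R]_d) mu, (0 < N)%N ->
        (forall i, msupp mu0 (x i)) ->
        mf_solution T a (empirical x) mu ->
        forall t, t \in `[0, T] -> msupp (mu t) `<=` eball r ].

Definition error (T : R) (a : R -> R) (mu : R -> probability (Rd R d) R)
    (b : R -> R) : \bar R :=
  ((T^-1)%:E * \int[@lebesgue_measure R]_(t in `[0%R, T])
    \int[mu t]_x
      ((enorm (convolve (fun z => Fker b z - Fker a z)%R (mu t) x)) ^+ 2)%:E)%E.

Definition varrho (m : probability (Rd R d) R) : set R -> \bar R :=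
  pushforward (m \x m)%E
    (fun z : Rd R d * Rd R d => enorm ((z.1 : 'rV[R]_d) - z.2)).

Definition rhobar (T : R) (mu : R -> probability (Rd R d) R) : set R -> \bar R :=
  fun A => ((T^-1)%:E *
    \int[@lebesgue_measure R]_(t in `[0%R, T]) varrho (mu t) A)%E.

Definition rho (T : R) (mu : R -> probability (Rd R d) R) : set R -> \bar R :=
  fun A => (\int[rhobar T mu]_(s in A) (s ^+ 2)%:E)%E.

Definition coercive (T : R) (a : R -> R) (mu : R -> probability (Rd R d) R) :
    Prop :=
  exists2 cT : R, 0 < cT &
    forall b, admissible b -> in_L2 (rho T mu) b ->
      (cT%:E * L2sq (rho T mu) (fun s => b s - a s)%R <= error T a mu b)%E.

Definition iid (d' : measure_display) (Omega : measurableType d')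
    (P : probability Omega R) (mu0 : set (Rd R d) -> \bar R) (N : nat)
    (x : 'I_N -> Omega -> 'rV[R]_d) : Prop :=
  [/\ forall i, measurable_fun setT (x i : Omega -> Rd R d),
      forall i (A : set (Rd R d)), measurable A -> P (x i @^-1` A) = mu0 A
    & forall (J : {set 'I_N}) (A : 'I_N -> set (Rd R d)),
        (forall i, measurable (A i)) ->
        P (\bigcap_(i in [set` J]) x i @^-1` A i) =
        (\prod_(i in J) P (x i @^-1` A i))%E ].

End MeanField.

Definition argmin (S : Type) (R : realType) (V : set S) (f : S -> \bar R) :
    set S :=
  [set b | V b /\ forall b', V b' -> (f b <= f b')%E].

(* Main.v *)
(* Probabilities on the ball are compared through integrals of Lipschitz
   functions.  In this dual distance the mean-field equation is stable: smooth
   test functions are pushed along explicit Euler steps of the velocity field,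
   which keeps their Lipschitz constants and those of their gradients under
   control, and a discrete Gronwall argument gives
   dist(mu t, nu t) <= C dist(mu 0, nu 0).  No flow of the characteristic ODE is
   needed.  Arbitrary Lipschitz functions are reached by a log-sum-exp version
   of the McShane extension.  The error functional is Lipschitz in the measure
   for this distance, uniformly on X_{M,K}.  Hence, for b in V_N close to a,
   E(ahat_N) <= E_N(ahat_N) + C dist <= E_N(b) + C dist <= C |b - a|^2 + C dist,
   which gives the rates in (3) with coercivity.  For (1) it suffices to work
   along N = 2^k, where the variances of the empirical frequencies of the cells
   of a fine finite partition are summable, so dist(mu_0^N, mu_0) -> 0 almost
   surely; Arzela-Ascoli then yields the subsequence.  The bound
   |b| + |b'| <= M makes b Lipschitz by Rademacher's theorem on the line,
   obtained from the Stieltjes measure of L x + b(x) and Radon-Nikodym. *)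
Require Import Defs.
From HB Require Import structures.
From mathcomp Require Import all_boot all_order all_algebra.
From mathcomp Require Import all_classical all_reals all_analysis.
From mathcomp Require Import measurable_realfun ess_sup_inf ring lra.
Import Order.TTheory GRing.Theory Num.Theory.
Import numFieldNormedType.Exports.
Local Open Scope classical_set_scope.
Local Open Scope ring_scope.
Set Implicit Arguments.
Unset Strict Implicit.
Unset Printing Implicit Defensive.

(** * Smooth functions *)

Section Smooth.
Context {R : realType} {d : nat}.
Implicit Types (f g : 'rV[R]_d -> R) (x v : 'rV[R]_d) (n : nat) (i j : 'I_d).

(** The stability proof has to close within one class of test functions. Pulling [phi] back along
    [x + h *: u x] keeps its gradient [H]-Lipschitz up to a factor 1 + O(h) only if the gradient of
    [u] is [H]-Lipschitz too, while the true velocity is merely Lipschitz. So the velocity is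
    replaced by a smooth field at uniform distance [delta]. [H] grows as [delta] shrinks, but it
    enters only errors of second order in the step length; the step length tends to 0 first and
    [delta] afterwards. One field, built from the first solution, pushes both measures; its distance
    to the second velocity is again controlled by the test class. Test functions and the dual
    distance use the sup norm, kernels and balls the Euclidean one; factors [d] come from passing
    between the two and from summing partial derivatives. Nothing is assumed on the joint law of the
    samples for different [N], so a strong law for a single i.i.d. sequence does not apply; summable
    variances do not see the joint law. *)

Lemma deriveEpartial f x v : differentiable f x ->
  'D_v f x = \sum_i v 0 i * partial i f x.
Proof.
move=> df; rewrite deriveE// [in LHS](row_sum_delta v) linear_sum /=.
by apply: eq_bigr => i _; rewrite linearZ /partial /= deriveE.
Qed.

(** Frechet differentiability is asked at every order, the last one included: unlike the directional
    derivatives in [smooth] it is stable under composition, and [smooth] follows from it. *)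
Fixpoint Ck n f : Prop := (forall x, differentiable f x) /\
  if n is n'.+1 then forall i, Ck n' (partial i f) else True.

Definition Cinf f := forall n, Ck n f.

Lemma Ck_diff n f x : Ck n f -> differentiable f x.
Proof. by case: n => [|n] [+ _]; exact. Qed.

Lemma Cinf_diff f x : Cinf f -> differentiable f x.
Proof. by move=> /(_ 0); exact: Ck_diff. Qed.

Lemma Cinf_continuous f : Cinf f -> continuous f.
Proof. by move=> sf x; apply/differentiable_continuous/Cinf_diff. Qed.

Lemma Ck_partial n f i : Ck n.+1 f -> Ck n (partial i f).
Proof. by case=> _; exact. Qed.

Lemma Cinf_partial f i : Cinf f -> Cinf (partial i f).
Proof. by move=> sf n; apply/Ck_partial/sf. Qed.

Lemma Cinf_smooth f : Cinf f -> smooth f.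
Proof.
move=> sf s; have {}sf : Cinf (foldr partial f s).
  by elim: s => [//|i s IH]; exact: Cinf_partial.
split; first exact: Cinf_continuous.
by move=> i x; exact/diff_derivable/Cinf_diff.
Qed.

Lemma Ck_pred n f : Ck n.+1 f -> Ck n f.
Proof.
elim: n f => [|n IH] f [df pf]; split => // i.
by apply: IH; exact: pf.
Qed.

Lemma partial_cst (c : R) i : partial i (fun _ : 'rV[R]_d => c) = fun=> 0.
Proof. by apply/funext => x; rewrite /partial derive_cst. Qed.

Lemma Ck_cst n (c : R) : Ck n (fun _ : 'rV[R]_d => c).
Proof.
elim: n c => [|n IH] c; split => //.
by move=> i; rewrite partial_cst.
Qed.

Lemma differential_coord x i :
  'd (fun y : 'rV[R]_d => y 0 i) x = (fun y : 'rV[R]_d => y 0 i) :> (_ -> _).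
Proof.
have lin : linear (fun y : 'rV[R]_d => y 0 i : R) by move=> k y z; rewrite !mxE.
pose cM := GRing.isLinear.Build _ _ _ _ _ lin.
pose cL : {linear _ -> _} := HB.pack (fun y : 'rV[R]_d => y 0 i : R) cM.
rewrite -[LHS]/('d cL x : _ -> _) diff_lin //.
exact: coord_continuous.
Qed.

Lemma partial_coord j i : partial i (fun x : 'rV[R]_d => x 0 j) = fun=> (i == j)%:R.
Proof.
apply/funext => x; rewrite /partial deriveE; last exact: differentiable_coord.
by rewrite differential_coord mxE eqxx eq_sym.
Qed.

Lemma Ck_coord n j : Ck n (fun x : 'rV[R]_d => x 0 j).
Proof.
case: n => [|n]; (split => [x|//]; first exact: differentiable_coord).
by move=> i; rewrite partial_coord; exact: Ck_cst.
Qed.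

Lemma CkD n f g : Ck n f -> Ck n g -> Ck n (fun x => f x + g x).
Proof.
elim: n f g => [|n IH] f g cf cg; (split => [x|//]).
- by apply: differentiableD; [exact: Ck_diff cf|exact: Ck_diff cg].
- by apply: differentiableD; [exact: Ck_diff cf|exact: Ck_diff cg].
move=> i; have -> : partial i (fun x => f x + g x) = fun x => partial i f x + partial i g x.
  apply/funext => x; rewrite /partial [LHS]deriveD //; apply: diff_derivable;
    [exact: Ck_diff cf|exact: Ck_diff cg].
by apply: IH; exact: Ck_partial.
Qed.

Lemma CkM n f g : Ck n f -> Ck n g -> Ck n (fun x => f x * g x).
Proof.
elim: n f g => [|n IH] f g cf cg; (split => [x|//]).
- by apply: differentiableM; [exact: Ck_diff cf|exact: Ck_diff cg].
- by apply: differentiableM; [exact: Ck_diff cf|exact: Ck_diff cg].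
move=> i; have -> : partial i (fun x => f x * g x) =
    fun x => f x * partial i g x + g x * partial i f x.
  apply/funext => x; rewrite /partial [LHS]deriveM //; apply: diff_derivable;
    [exact: Ck_diff cf|exact: Ck_diff cg].
by apply: CkD; apply: IH; by [exact: Ck_partial|exact: Ck_pred].
Qed.

Lemma Ck_sum n (I : Type) (r : seq I) (F : I -> 'rV[R]_d -> R) :
  (forall k, Ck n (F k)) -> Ck n (fun x => \sum_(k <- r) F k x).
Proof.
move=> cF; elim: r => [|k r IH].
  by under eq_fun do rewrite big_nil; exact: Ck_cst.
by under eq_fun do rewrite big_cons; exact: CkD.
Qed.

Lemma differentiable_chain f (g g' : R -> R) x :
  differentiable f x -> is_derive (f x) (1 : R) g (g' (f x)) ->
  differentiable (g \o f) x.
Proof.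
move=> df dg; apply: differentiable_comp => //.
by apply/derivable1_diffP; exact: ex_derive.
Qed.

Lemma derive_chain f (g g' : R -> R) x v :
  differentiable f x -> is_derive (f x) (1 : R) g (g' (f x)) ->
  'D_v (g \o f) x = g' (f x) * 'D_v f x.
Proof.
move=> df dg; have dg' : differentiable g (f x).
  by apply/derivable1_diffP; exact: ex_derive.
rewrite !deriveE //; last exact: differentiable_comp.
rewrite diff_comp //= deriv1E; last exact: ex_derive.
by rewrite derive1E derive_val mulrC.
Qed.

(** Reduces [g \o f] to one order less of [g' \o f]. For a family closed under differentiation, such
    as [expR], the inverse or [flat], an induction on [n] then closes. *)
Lemma Ck_chain n f (g g' : R -> R) :
  (forall x, is_derive (f x) (1 : R) g (g' (f x))) ->
  Ck n.+1 f -> Ck n (g' \o f) -> Ck n.+1 (g \o f).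
Proof.
move=> dg cf cg; split => [x|i].
  by apply: differentiable_chain (dg x); exact: Ck_diff cf.
have -> : partial i (g \o f) = fun x => (g' \o f) x * partial i f x.
  apply/funext => x; rewrite /partial; apply: derive_chain => //.
  exact: Ck_diff cf.
by apply: CkM => //; exact: Ck_partial.
Qed.

Lemma Ck_exp n f : Ck n f -> Ck n (expR \o f).
Proof.
elim: n f => [|n IH] f cf.
  by split=> // x; apply: (differentiable_chain (g' := expR)); exact: Ck_diff cf.
by apply: (Ck_chain (g' := expR)) => //; apply: IH; exact: Ck_pred.
Qed.

Let is_derive_inv (y : R) : y != 0 -> is_derive y 1 GRing.inv (- (y^-1 * y^-1)).
Proof.
move=> y0; have := @is_deriveV R id y 1 1 y0 _.
by rewrite /= scaler1 -exprVn expr2; apply; exact: is_derive_id.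
Qed.

Lemma Ck_inv n f : (forall x, f x != 0) -> Ck n f -> Ck n (GRing.inv \o f).
Proof.
move=> f0; elim: n f f0 => [|n IH] f f0 cf.
  split=> // x; apply: (differentiable_chain (g' := fun y => - (y^-1 * y^-1))).
    exact: Ck_diff cf.
  exact: is_derive_inv.
apply: (Ck_chain (g' := fun y => - (y^-1 * y^-1))) => //.
  by move=> x; exact: is_derive_inv.
have cfi : Ck n (GRing.inv \o f) by apply: IH => //; exact: Ck_pred.
have := CkM (Ck_cst n (-1)) (CkM cfi cfi).
by congr Ck; apply/funext => x /=; rewrite mulN1r.
Qed.

Lemma Ck_ln n f : (forall x, 0 < f x) -> Ck n f -> Ck n (@ln R \o f).
Proof.
move=> f0; case: n f f0 => [|n] f f0 cf.
  split=> // x; apply: (differentiable_chain (g' := GRing.inv)).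
    exact: Ck_diff cf.
  exact: is_derive1_ln.
apply: (Ck_chain (g' := GRing.inv)) => //.
  by move=> x; exact: is_derive1_ln.
by apply: Ck_inv; [move=> x; rewrite gt_eqF|exact: Ck_pred].
Qed.

Lemma differentiable_row (Phi : 'rV[R]_d -> 'rV[R]_d) x :
  (forall i, differentiable (fun y => Phi y 0 i) x) -> differentiable Phi x.
Proof.
move=> dP; have -> : Phi = \sum_i (fun y => Phi y 0 i *: delta_mx 0 i).
  by apply/funext => y; rewrite fct_sumE; exact: row_sum_delta.
by apply: differentiable_sum => i; exact: differentiableZl.
Qed.

Lemma derive_coord (Phi : 'rV[R]_d -> 'rV[R]_d) x v i :
  differentiable Phi x -> 'D_v (fun y => Phi y 0 i) x = 'D_v Phi x 0 i.
Proof.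
move=> dP; have dc : differentiable (fun y : 'rV[R]_d => y 0 i) (Phi x).
  exact: differentiable_coord.
rewrite (deriveE _ (f := Phi)) // (deriveE _ (differentiable_comp dP dc)).
by rewrite (diff_comp dP dc) /= differential_coord.
Qed.

Lemma derive_comp_row (Phi : 'rV[R]_d -> 'rV[R]_d) f x v :
  differentiable Phi x -> differentiable f (Phi x) ->
  'D_v (f \o Phi) x = \sum_i 'D_v (fun y => Phi y 0 i) x * partial i f (Phi x).
Proof.
move=> dP df; rewrite (deriveE _ (differentiable_comp dP df)) (diff_comp dP df) /=.
rewrite -deriveE // deriveEpartial //; apply: eq_bigr => i _.
by rewrite derive_coord // -deriveE.
Qed.

Lemma Ck_comp n f (Phi : 'rV[R]_d -> 'rV[R]_d) :
  (forall i, Ck n (fun y => Phi y 0 i)) -> Ck n f -> Ck n (f \o Phi).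
Proof.
elim: n f => [|n IH] f cP cf.
  split=> // x; apply: differentiable_comp; last exact: Ck_diff cf.
  by apply: differentiable_row => i; exact: Ck_diff (cP i).
have dP x : differentiable Phi x.
  by apply: differentiable_row => i; exact: Ck_diff (cP i).
split=> [x|i].
  by apply: differentiable_comp; [exact: dP|exact: Ck_diff cf].
have -> : partial i (f \o Phi) = fun x => \sum_(j < d)
    partial i (fun y => Phi y 0 j) x * (partial j f \o Phi) x.
  by apply/funext => x; apply: derive_comp_row; [exact: dP|exact: Ck_diff cf].
apply: Ck_sum => j; apply: CkM; first exact: Ck_partial.
apply: IH; last exact: Ck_partial.
by move=> k; exact: Ck_pred.
Qed.

End Smooth.

(** * A smooth cutoff built from exp(-1/x) *)

Section Cutoff.
Context {R : realType}.
Implicit Types (x y : R) (k n : nat).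

(** The factor x^-k closes the family under differentiation: the derivative of member [k] combines
    the members [k.+1] and [k.+2]. *)
Definition flat k x : R := if 0 < x then x^-1 ^+ k * expR (- x^-1) else 0.

Lemma flat_ge0 k x : 0 <= flat k x.
Proof.
rewrite /flat; case: ifP => // x0.
by rewrite mulr_ge0 ?expR_ge0 // exprn_ge0 // invr_ge0 ltW.
Qed.

Lemma flat0_gt0 x : 0 < x -> 0 < flat 0 x.
Proof. by move=> x0; rewrite /flat x0 expr0 mul1r expR_gt0. Qed.

Lemma flat_le0 k x : x <= 0 -> flat k x = 0.
Proof. by rewrite /flat ltNge => ->. Qed.

(** With u = 1/x and m = k + 2, exp u = (exp (u/m))^m is at least (u/m)^m, so u^k exp(-u) is at most
    m^m u^-2. Vanishing to order two is what gives the derivative 0 at the origin. *)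
Lemma flat_le_sqr k x : flat k x <= (k.+2)%:R ^+ k.+2 * x ^+ 2.
Proof.
rewrite /flat; case: ifP => x0; last by apply: mulr_ge0; [exact: exprn_ge0|exact: sqr_ge0].
set m := (k.+2)%:R; set u := x^-1; have u0 : 0 < u by rewrite invr_gt0.
have m0 : 0 < m :> R by rewrite ltr0n.
have le_exp : (u / m) ^+ k.+2 <= expR u.
  have -> : expR u = expR (u / m) ^+ k.+2.
    by rewrite -expRM_natl; congr expR; rewrite -/m mulrC mulfVK // gt_eqF.
  rewrite lerXn2r ?nnegrE ?expR_ge0 //; first by rewrite divr_ge0 // ltW.
  by rewrite (le_trans _ (expR_ge1Dx _)) // lerDr.
have -> : x = u^-1 by rewrite invrK.
rewrite expRN -[leLHS]/(u ^+ k / expR u) ler_pdivrMr ?expR_gt0 //.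
have -> : u ^+ k = m ^+ k.+2 * u^-1 ^+ 2 * (u / m) ^+ k.+2.
  by rewrite expr_div_n -[k.+2]addn2 !exprD; field; rewrite !gt_eqF // exprn_gt0.
by rewrite ler_wpM2l // mulr_ge0 ?exprn_ge0 // ?invr_ge0 ltW.
Qed.

Lemma is_derive_flat k x :
  is_derive x (1 : R) (flat k) (- k%:R * flat k.+1 x + flat k.+2 x).
Proof.
have [x0|x0|->] := ltgtP x 0.
- rewrite !flat_le0 ?ltW // mulr0 addr0.
  apply: (@near_eq_is_derive _ _ _ (cst 0)).
  near=> y; rewrite /= flat_le0 //; near: y.
  by apply: filterS (lt_nbhsl x0) => y /ltW.
- apply: (@near_eq_is_derive _ _ _ ((fun u => u ^+ k * expR (- u)) \o GRing.inv)).
    near=> y; rewrite /= /flat ifT //; near: y.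
    exact: lt_nbhsr.
  have dexp : is_derive x^-1 (1 : R) (fun u => u ^+ k * expR (- u))
     (x^-1 ^+ k * - expR (- x^-1) + expR (- x^-1) * (k%:R * x^-1 ^+ k.-1)).
    apply: is_deriveM.
      split; first exact: exprn_derivable.
      by rewrite exp_derive /GRing.scale /= mulr1 mulr_natl.
    have := is_derive1_comp (is_derive_expR (- x^-1)) (is_deriveN (is_derive_id x^-1 1)).
    by rewrite mulrN1.
  have dinv : is_derive x (1 : R) GRing.inv (- x^-1 ^+ 2).
    have x0' : x != 0 by rewrite gt_eqF.
    have := @is_deriveV R id x 1 1 x0' _.
    by rewrite /= scaler1 exprVn; apply; exact: is_derive_id.
  apply: is_derive_eq (is_derive1_comp dexp dinv) _.
  rewrite /flat x0; case: k {dexp} => [|k] /=.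
    by rewrite !mulr0n !(mul0r, mulr0, oppr0, add0r, addr0) expr0; ring.
  by rewrite !exprS; ring.
rewrite !(flat_le0 _ (lexx 0)) mulr0 addr0.
(* At the origin the difference quotient is at most a constant times [|h|], by [flat_le_sqr]. *)
have lim0 : h^-1 *: ((flat k \o shift 0) (h *: (1 : R)) - flat k 0) @[h --> 0^'] --> (0 : R).
  apply/cvgr0Pnorm_le => e e0.
  set C : R := (k.+2)%:R ^+ k.+2; have C0 : 0 < C by rewrite exprn_gt0 // ltr0n.
  near=> h; rewrite /= addr0 (flat_le0 _ (lexx 0)) subr0 /GRing.scale /= mulr1 normrM normfV.
  have h0 : 0 < `|h| by rewrite normr_gt0; near: h; exact: nbhs_dnbhs_neq.
  rewrite ler_pdivrMl // ger0_norm ?flat_ge0 // (le_trans (flat_le_sqr _ _)) //.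
  rewrite -/C -real_normK ?num_real // expr2 mulrA mulrC ler_wpM2l //.
  rewrite mulrC -ler_pdivlMr //; near: h.
  by apply: dnbhs0_le; rewrite divr_gt0.
split; last exact: cvg_lim lim0.
by apply/cvg_ex; exists 0.
Unshelve. all: by end_near. Qed.

Definition step x := flat 0 x / (flat 0 x + flat 0 (1 - x)).

Lemma step_den x : 0 < flat 0 x + flat 0 (1 - x).
Proof.
have [x0|x0] := ltP 0 x; first by rewrite ltr_wpDr ?flat_ge0 ?flat0_gt0.
by rewrite ltr_wpDl ?flat_ge0 // flat0_gt0 // subr_gt0 (le_lt_trans x0).
Qed.

Lemma step_ge1 x : 1 <= x -> step x = 1.
Proof.
by move=> x1; rewrite /step [flat 0 (1 - x)]flat_le0 ?subr_le0 // addr0 divff //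
  gt_eqF // flat0_gt0 // (lt_le_trans ltr01).
Qed.

Lemma step_le0 x : x <= 0 -> step x = 0.
Proof. by move=> x0; rewrite /step flat_le0 // mul0r. Qed.

Context {d : nat}.
Implicit Types (f : 'rV[R]_d -> R).

Lemma Ck_flat n k f : Ck n f -> Ck n (flat k \o f).
Proof.
elim: n k f => [|n IH] k f cf.
  split=> // x; apply: (differentiable_chain
    (g' := fun y => - k%:R * flat k.+1 y + flat k.+2 y)); last exact: is_derive_flat.
  exact: Ck_diff cf.
apply: (Ck_chain (g' := fun y => - k%:R * flat k.+1 y + flat k.+2 y)) => //.
  by move=> x; exact: is_derive_flat.
have {}cf := Ck_pred cf.
by apply: CkD; [apply: CkM; [exact: Ck_cst|exact: IH]|exact: IH].
Qed.

Lemma Ck_step n f : Ck n f -> Ck n (step \o f).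
Proof.
move=> cf; apply: (@CkM _ _ _ (flat 0 \o f)); first exact: Ck_flat.
have den0 (x : 'rV[R]_d) : flat 0 (f x) + flat 0 (1 - f x) != 0 by rewrite gt_eqF // step_den.
apply: (Ck_inv den0); apply: CkD; first exact: Ck_flat.
apply: (@Ck_flat _ _ (fun x : 'rV[R]_d => 1 - f x)); apply: CkD; first exact: Ck_cst.
have := CkM (Ck_cst n (-1)) cf.
by congr Ck; apply/funext => x; rewrite mulN1r.
Qed.

End Cutoff.

(** * Euclidean norm, balls and compactly supported test functions *)

Section EuclideanNorm.
Context {R : realType} {d : nat}.
Implicit Types (x y z v : 'rV[R]_d) (i : 'I_d) (f : 'rV[R]_d -> R).

Lemma le_coord_norm x i : `|x 0 i| <= `|x|.
Proof.
by rewrite [leRHS]mx_normrE; exact: (le_bigmax _ (fun ij => `|x ij.1 ij.2|) (0, i)).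
Qed.

Lemma norm_row_le x (c : R) : 0 <= c -> (forall i, `|x 0 i| <= c) -> `|x| <= c.
Proof.
move=> c0 xc; rewrite [leLHS]mx_normrE; apply/bigmax_leP; split=> //= -[i j] _ /=.
by rewrite ord1.
Qed.

Lemma sumsq_ge0 x : 0 <= \sum_i x 0 i ^+ 2.
Proof. by apply: sumr_ge0 => i _; exact: sqr_ge0. Qed.

Lemma enorm_ge0 x : 0 <= enorm x.
Proof. exact: sqrtr_ge0. Qed.

Lemma enorm_sqr x : enorm x ^+ 2 = \sum_i x 0 i ^+ 2.
Proof. by rewrite sqr_sqrtr // sumsq_ge0. Qed.

Lemma le_coord_enorm x i : `|x 0 i| <= enorm x.
Proof.
rewrite -sqrtr_sqr ler_wsqrtr // (bigD1 i) //= lerDl.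
by apply: sumr_ge0 => j _; exact: sqr_ge0.
Qed.

Lemma le_norm_enorm x : `|x| <= enorm x.
Proof. by apply: norm_row_le; [exact: enorm_ge0|exact: le_coord_enorm]. Qed.

Lemma sumsq_le x : \sum_i x 0 i ^+ 2 <= d%:R * `|x| ^+ 2.
Proof.
have -> : d%:R * `|x| ^+ 2 = \sum_(i < d) `|x| ^+ 2.
  by rewrite sumr_const card_ord mulr_natl.
apply: ler_sum => i _; rewrite -real_normK ?num_real // lerXn2r ?nnegrE //.
exact: le_coord_norm.
Qed.

Lemma enorm_le_norm x : enorm x <= d%:R * `|x|.
Proof.
have h0 : 0 <= d%:R * `|x| by rewrite mulr_ge0.
rewrite -(ger0_norm h0) -[leRHS]sqrtr_sqr ler_wsqrtr // (le_trans (sumsq_le x)) //.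
rewrite exprMn ler_wpM2r ?sqr_ge0 // -natrX ler_nat; by case: (d) => [//|m]; rewrite leq_pmulr.
Qed.

(** After multiplication by [enorm x + enorm y] the left side is a difference of sums of squares,
    which factors coordinatewise; each coordinate is bounded by the Euclidean norm. *)
Lemma enorm_dist x y : `|enorm x - enorm y| <= d%:R * `|x - y|.
Proof.
have [s0|s0] := eqVneq (enorm x + enorm y) 0.
  have /eqP := s0; rewrite paddr_eq0 ?enorm_ge0 // => /andP[/eqP -> /eqP ->].
  by rewrite subrr normr0 mulr_ge0.
have {}s0 : 0 < enorm x + enorm y by rewrite lt_def s0 addr_ge0 // enorm_ge0.
rewrite -(ler_pM2r s0) -{1}(ger0_norm (ltW s0)) -normrM.
have -> : (enorm x - enorm y) * (enorm x + enorm y) =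
    \sum_i (x - y) 0 i * (x 0 i + y 0 i).
  rewrite -subr_sqr !enorm_sqr -sumrB; apply: eq_bigr => i _.
  by rewrite !mxE subr_sqr.
rewrite (le_trans (ler_norm_sum _ _ _)) //.
have -> : d%:R * `|x - y| * (enorm x + enorm y) =
    \sum_(i < d) `|x - y| * (enorm x + enorm y).
  by rewrite sumr_const card_ord -mulrA mulr_natl.
apply: ler_sum => i _; rewrite normrM ler_pM ?le_coord_norm //.
by rewrite (le_trans (ler_normD _ _)) // lerD // le_coord_enorm.
Qed.

Lemma enorm0 : enorm (0 : 'rV[R]_d) = 0.
Proof. by rewrite /enorm big1 ?sqrtr0 // => i _; rewrite mxE expr0n. Qed.

Lemma lipschitz_continuous f (C : R) :
  (forall x y, `|f x - f y| <= C * `|x - y|) -> continuous f.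
Proof.
move=> lip x; apply/(@cvgrPdist_le _ _ _ (nbhs x)) => e e0.
have C0 : 0 < `|C| + 1 by rewrite ltr_wpDl.
near=> y; have : `|x - y| <= e / (`|C| + 1).
  near: y; apply: cvgr_dist_le; [exact: cvg_id|by rewrite divr_gt0].
rewrite ler_pdivlMr // mulrC; apply: le_trans; rewrite (le_trans (lip _ _)) //.
by rewrite ler_wpM2r // (le_trans (ler_norm C)) // lerDl.
Unshelve. all: by end_near. Qed.

Lemma continuous_enorm : continuous (enorm : 'rV[R]_d -> R).
Proof. exact: lipschitz_continuous enorm_dist. Qed.

Lemma eball_closed (r : R) : closed (eball r : set 'rV[R]_d).
Proof.
have -> : eball r = enorm @^-1` [set s | s <= r] :> set 'rV[R]_d by [].
by apply: closed_comp; [move=> x _; exact: continuous_enorm|exact: closed_le].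
Qed.

Lemma eball_compact (r : R) : compact (eball r : set 'rV[R]_d).
Proof.
apply: bounded_closed_compact; last exact: eball_closed.
exists r; split; first exact: num_real.
move=> s rs x xr /=; rewrite (le_trans (le_norm_enorm x)) //.
by rewrite (le_trans xr) // ltW.
Qed.

(** The argument of [step] is a polynomial, hence smooth at the origin too. Here [r] is a squared
    radius: the cutoff is 1 for |x|^2 <= r and 0 for |x|^2 >= r + 1. *)
Lemma Cinf_cutoff f (r : R) : Cinf f ->
  Cinf (fun x => f x * step (r + 1 - \sum_i x 0 i ^+ 2)).
Proof.
move=> sf n; apply: CkM => //.
apply: (@Ck_step _ _ _ (fun x => r + 1 - \sum_i x 0 i ^+ 2)).
apply: CkD; first exact: Ck_cst.
have : Ck n (fun x : 'rV[R]_d => (-1) * \sum_i x 0 i * x 0 i).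
  apply: CkM; first exact: Ck_cst.
  by apply: Ck_sum => i; apply: CkM; exact: Ck_coord.
by congr Ck; apply/funext => x; rewrite mulN1r.
Qed.

Lemma test_function_cutoff f (r : R) : 0 <= r -> Cinf f ->
  test_function (fun x => f x * step (r + 1 - \sum_i x 0 i ^+ 2)).
Proof.
move=> r0 sf; split; first by apply: Cinf_smooth; exact: Cinf_cutoff.
apply: (@subclosed_compact _ _ (eball (Num.sqrt (r + 1)))).
- exact: closed_closure.
- exact: eball_compact.
rewrite [X in _ `<=` X]((closure_id _).1 (@eball_closed _)).
apply: closureS => x /=; apply: contra_neqP; rewrite /eball /= => /negP.
rewrite -ltNge => h; rewrite step_le0 ?mulr0 // subr_le0 -enorm_sqr.
have r1 : 0 <= r + 1 by rewrite addr_ge0.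
by rewrite -(sqr_sqrtr r1) lerXn2r ?nnegrE ?sqrtr_ge0 ?enorm_ge0 // ltW.
Qed.

Lemma segment_MVT f x v : (forall y, differentiable f y) ->
  exists2 c : R, 0 < c < 1 & f (x + v) - f x = 'D_v f (x + c *: v).
Proof.
move=> df; pose g (t : R) := f (x + t *: v).
have dg (t : R) : is_derive t (1 : R) g ('D_v f (x + t *: v)).
  have E : (fun h : R => h^-1 *: ((g \o shift t) (h *: (1 : R)) - g t)) =
           (fun h : R => h^-1 *: ((f \o shift (x + t *: v)) (h *: v) - f (x + t *: v))).
    apply/funext => h; have -> : h *: (1 : R) = h by exact: mulr1.
    by rewrite /g /shift /=; congr (_ *: (f _ - _)); rewrite scalerDl addrCA.
  have /diff_derivable dv := df (x + t *: v).
  by split; rewrite /derivable /derive E //; exact: dv.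
have cg : {within `[0, 1], continuous g}.
  apply: continuous_subspaceT => t; apply/differentiable_continuous.
  by apply/derivable1_diffP; case: (dg t).
have [c c01] := MVT ltr01 (fun t _ => dg t) cg.
rewrite /g scale1r scale0r addr0 subr0 mulr1 => E.
by exists c => //; move: c01; rewrite in_itv.
Qed.

Lemma derive_le f x v (C : R) : differentiable f x ->
  (forall y z, `|f y - f z| <= C * `|y - z|) -> `|'D_v f x| <= C * `|v|.
Proof.
move=> /diff_derivable dv lip.
have := dv v; rewrite /derivable => /cvg_norm cv.
have -> : `|'D_v f x| = lim (`|h^-1 *: ((f \o shift x) (h *: v) - f x)| @[h --> (0:R)^']).
  by apply/esym/cvg_lim.
apply: limr_le; first by apply/cvg_ex; eexists; exact: cv.
near=> h; have h0 : h != 0 by near: h; exact: nbhs_dnbhs_neq.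
rewrite normrZ normfV ler_pdivrMl ?normr_gt0 //= (le_trans (lip _ _)) //.
by rewrite addrK normrZ mulrCA.
Unshelve. all: by end_near. Qed.

End EuclideanNorm.

(** * Smooth approximation of Lipschitz functions with controlled gradients *)

Section SmoothApprox.
Context {R : realType} {d : nat}.
Implicit Types (x y z v : 'rV[R]_d) (i j : 'I_d) (f g : 'rV[R]_d -> R).

Lemma compact_net (S : set 'rV[R]_d) (eta : R) : compact S -> 0 < eta ->
  exists2 ys : seq 'rV[R]_d, (forall y, y \in ys -> S y) &
    forall x, S x -> exists2 y, y \in ys & `|x - y| <= eta.
Proof.
rewrite compact_cover => cS eta0.
have [] := cS 'rV[R]_d S (fun y => ball y eta).
- by move=> y _; exact: ball_open.
- by move=> x Sx; exists x => //; exact: ballxx.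
move=> D DS cov; exists (finmap.enum_fset D) => [y yD|x /cov [y yD xy]].
  by have := DS y yD; rewrite inE.
exists y; first exact: yD.
by move: xy; rewrite -ball_normE /= distrC => /ltW.
Qed.

Lemma partialD f g i x : Cinf f -> Cinf g ->
  partial i (fun y => f y + g y) x = partial i f x + partial i g x.
Proof.
by move=> cf cg; rewrite /partial [LHS]deriveD //; apply/diff_derivable/Cinf_diff.
Qed.

Lemma partialM f g i x : Cinf f -> Cinf g ->
  partial i (fun y => f y * g y) x = f x * partial i g x + g x * partial i f x.
Proof.
by move=> cf cg; rewrite /partial [LHS]deriveM //; apply/diff_derivable/Cinf_diff.
Qed.

Lemma partialV f i x : (forall y, f y != 0) -> Cinf f ->
  partial i (fun y => (f y)^-1) x = - ((f x)^-1 * (f x)^-1) * partial i f x.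
Proof.
move=> f0 cf.
have dinv : is_derive (f x) 1 GRing.inv (- ((f x)^-1 * (f x)^-1)).
  have := @is_deriveV R id (f x) 1 1 (f0 x) _.
  by rewrite /= scaler1 -exprVn expr2; apply; exact: is_derive_id.
pose g' (y : R) : R := - (y^-1 * y^-1).
have := @derive_chain _ _ f (fun y : R => y^-1) g' x (delta_mx 0 i) (Cinf_diff x cf) dinv.
rewrite /g' => <-.
by [].
Qed.

Lemma partial_ln f i x : (forall y, 0 < f y) -> Cinf f ->
  partial i (fun y => ln (f y)) x = (f x)^-1 * partial i f x.
Proof.
move=> f0 cf; apply: (derive_chain (g := @ln R) (g' := GRing.inv)).
  exact: Cinf_diff.
exact: is_derive1_ln.
Qed.

Lemma partial_exp f i x : Cinf f ->
  partial i (fun y => expR (f y)) x = expR (f x) * partial i f x.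
Proof.
by move=> cf; apply: (derive_chain (g := expR) (g' := expR)); first exact: Cinf_diff.
Qed.

Lemma CinfV f : (forall y, f y != 0) -> Cinf f -> Cinf (fun y => (f y)^-1).
Proof. by move=> f0 cf n; exact: Ck_inv. Qed.

Lemma CinfD f g : Cinf f -> Cinf g -> Cinf (fun y => f y + g y).
Proof. by move=> cf cg n; exact: CkD. Qed.

Lemma CinfM f g : Cinf f -> Cinf g -> Cinf (fun y => f y * g y).
Proof. by move=> cf cg n; exact: CkM. Qed.

Lemma Cinf_cst (c : R) : Cinf (fun _ : 'rV[R]_d => c).
Proof. by move=> n; exact: Ck_cst. Qed.

Lemma Cinf_coord i : Cinf (fun y : 'rV[R]_d => y 0 i).
Proof. by move=> n; exact: Ck_coord. Qed.

(** Bounds relative to [g] itself survive sums of any number of terms with the same [l] and [c], and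
    they bound the first two derivatives of [ln g]. *)
Definition logder2 (l c : R) g := [/\ Cinf g, forall x, 0 <= g x,
  forall i x, `|partial i g x| <= l * g x &
  forall i j x, `|partial j (partial i g) x| <= c * l ^+ 2 * g x].

Lemma logder2_exp (l k b : R) i : `|k| <= l ->
  logder2 l 1 (fun x => expR (k * x 0 i + b)).
Proof.
move=> kl; have l0 : 0 <= l by rewrite (le_trans (normr_ge0 _) kl).
have cl : Cinf (fun x : 'rV[R]_d => k * x 0 i + b).
  apply: CinfD; last exact: Cinf_cst.
  by apply: CinfM; [exact: Cinf_cst|exact: Cinf_coord].
have ce : Cinf (fun x : 'rV[R]_d => expR (k * x 0 i + b)) by move=> n; exact: Ck_exp.
have pe j : partial j (fun x : 'rV[R]_d => expR (k * x 0 i + b)) =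
    fun x => (k * (j == i)%:R) * expR (k * x 0 i + b).
  apply/funext => x; rewrite partial_exp // partialD //; last 2 first.
  - by apply: CinfM; [exact: Cinf_cst|exact: Cinf_coord].
  - exact: Cinf_cst.
  rewrite partialM; [|exact: Cinf_cst|exact: Cinf_coord].
  by rewrite !partial_cst partial_coord mulr0 !addr0 mulrC.
have kd j : `|k * (j == i)%:R| <= l.
  by case: (j == i); rewrite ?mulr1 // mulr0 normr0.
split=> // [j x|j j' x].
  by rewrite pe normrM (ger0_norm (expR_ge0 _)) ler_wpM2r ?expR_ge0.
rewrite pe partialM //; last exact: Cinf_cst.
rewrite partial_cst mulr0 addr0 pe mulrA normrM (ger0_norm (expR_ge0 _)).
by rewrite ler_wpM2r ?expR_ge0 // mul1r normrM expr2 ler_pM.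
Qed.

Lemma logder2_cst (l c b : R) : 0 <= l -> 0 <= c -> 0 <= b ->
  logder2 l c (fun=> b).
Proof.
move=> l0 c0 b0; split=> // [|i x|i j x]; first exact: Cinf_cst.
  by rewrite partial_cst normr0 mulr_ge0.
by rewrite !partial_cst normr0 !mulr_ge0 // sqr_ge0.
Qed.

Lemma logder2D (l c : R) f g : logder2 l c f -> logder2 l c g ->
  logder2 l c (fun x => f x + g x).
Proof.
move=> [cf f0 f1 f2] [cg g0 g1 g2].
have pD i : partial i (fun x => f x + g x) = fun x => partial i f x + partial i g x.
  by apply/funext => x; exact: partialD.
split=> [|x|i x|i j x]; [exact: CinfD|exact: addr_ge0| |].
  by rewrite pD mulrDr (le_trans (ler_normD _ _)) // lerD.
rewrite pD partialD; [|exact: Cinf_partial..].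
by rewrite mulrDr (le_trans (ler_normD _ _)) // lerD.
Qed.

Lemma logder2_sum (l c : R) (I : Type) (r : seq I) (F : I -> 'rV[R]_d -> R) :
  0 <= l -> 0 <= c -> (forall k, logder2 l c (F k)) ->
  logder2 l c (fun x => \sum_(k <- r) F k x).
Proof.
move=> l0 c0 cF; elim: r => [|k r IH].
  by under eq_fun do rewrite big_nil; exact: logder2_cst.
by under eq_fun do rewrite big_cons; exact: logder2D.
Qed.

(** In the second derivative of 1/g the term with the second derivative of [g] contributes 1 and the
    product of first derivatives contributes 2, hence the constant 3. *)
Lemma logder2V (l : R) g : 0 <= l -> (forall x, 0 < g x) -> logder2 l 1 g ->
  logder2 l 3 (fun x => (g x)^-1).
Proof.
move=> l0 gp [cg g0 g1 g2]; have gn0 x : g x != 0 by rewrite gt_eqF.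
have gi0 x : 0 <= (g x)^-1 by rewrite invr_ge0.
have cgi : Cinf (fun x => (g x)^-1) by exact: CinfV.
have pV i : partial i (fun x => (g x)^-1) =
    fun x => (-1) * (((g x)^-1 * (g x)^-1) * partial i g x).
  by apply/funext => x; rewrite partialV // mulN1r mulNr.
split=> // [i x|i j x].
  rewrite pV mulN1r normrN !normrM (ger0_norm (gi0 x)) -mulrA.
  by rewrite [leRHS]mulrC ler_wpM2l // ler_pdivrMl // mulrC.
have cpi := Cinf_partial i cg.
rewrite pV partialM; [|exact: Cinf_cst|apply: CinfM => //; exact: CinfM].
rewrite partial_cst mulr0 addr0 mulN1r normrN partialM //; last exact: CinfM.
rewrite partialM // partialV //.
have -> : (g x)^-1 * (g x)^-1 * partial j (partial i g) x + partial i g x *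
    ((g x)^-1 * (- ((g x)^-1 * (g x)^-1) * partial j g x) +
     (g x)^-1 * (- ((g x)^-1 * (g x)^-1) * partial j g x)) =
    (g x)^-1 * ((g x)^-1 * partial j (partial i g) x -
     2 * (((g x)^-1 * partial i g x) * ((g x)^-1 * partial j g x))) by ring.
have b1 k : `|(g x)^-1 * partial k g x| <= l.
  by rewrite normrM (ger0_norm (gi0 x)) ler_pdivrMl // mulrC.
have b2 : `|(g x)^-1 * partial j (partial i g) x| <= l ^+ 2.
  by rewrite normrM (ger0_norm (gi0 x)) ler_pdivrMl // mulrC -[l ^+ 2]mul1r.
rewrite normrM (ger0_norm (gi0 x)) mulrC ler_wpM2r // (le_trans (ler_normB _ _)) //.
have -> : 3 * l ^+ 2 = l ^+ 2 + 2 * (l * l) by ring.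
rewrite lerD // normrM (ger0_norm (ler0n _ 2)) ler_wpM2l // normrM.
by rewrite ler_pM.
Qed.

Lemma lipschitz_of_partial f (C : R) : 0 <= C -> Cinf f ->
  (forall i x, `|partial i f x| <= C) ->
  forall x y, `|f x - f y| <= d%:R * C * `|x - y|.
Proof.
move=> C0 cf fC x y; have [c _] := segment_MVT y (x - y) (fun z => Cinf_diff z cf).
rewrite [y + _]addrC subrK => ->; rewrite deriveEpartial; last exact: Cinf_diff.
rewrite (le_trans (ler_norm_sum _ _ _)) //.
have -> : d%:R * C * `|x - y| = \sum_(i < d) `|x - y| * C.
  by rewrite sumr_const card_ord -mulrA mulr_natl mulrC.
by apply: ler_sum => i _; rewrite normrM ler_pM // le_coord_norm.
Qed.

(** Sum of the exponentials of the 2d + 1 affine functions b and b + l (x_i - y_i), b - l (x_i -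
    y_i), whose maximum is [b + l * |x - y|] in the sup norm. The logarithm is this maximum up to
    [ln (2d + 1)]. *)
Let bump (l b : R) y x :=
  expR b + \sum_(i < d) (expR (l * x 0 i + (b - l * y 0 i)) +
                          expR (- l * x 0 i + (b + l * y 0 i))).

Let bump_gt0 l b y x : 0 < bump l b y x.
Proof.
rewrite ltr_wpDr ?expR_gt0 //; apply: sumr_ge0 => i _.
by rewrite addr_ge0 // expR_ge0.
Qed.

Let logder2_bump l b y : 0 <= l -> logder2 l 1 (bump l b y).
Proof.
move=> l0; apply: logder2D; first by apply: logder2_cst => //; exact: expR_ge0.
apply: logder2_sum => // i; apply: logder2D; apply: logder2_exp.
  by rewrite ger0_norm.
by rewrite normrN ger0_norm.
Qed.

Let bump_ge l b y x : 0 <= l -> expR (b + l * `|x - y|) <= bump l b y x.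
Proof.
move=> l0.
have [->|/mx_norm_neq0[[i0 i] /=]] := eqVneq (`|x - y|) 0.
  rewrite mulr0 addr0 lerDl; apply: sumr_ge0 => i _.
  by rewrite addr_ge0 // expR_ge0.
rewrite ord1 => nE; rewrite [`|x - y|]nE !mxE /bump (bigD1 i) //=.
set rest := \sum_(j < d | _) _; have rest0 : 0 <= rest.
  by apply: sumr_ge0 => j _; rewrite addr_ge0 // expR_ge0.
have [xy|xy] := ger0P (x 0 i - y 0 i).
  have -> : b + l * (x 0 i - y 0 i) = l * x 0 i + (b - l * y 0 i) by ring.
  set A := expR (l * _ + _); set B := expR (- _ * _ + _).
  have -> : expR b + (A + B + rest) = A + (expR b + B + rest) by ring.
  by rewrite lerDl !addr_ge0 ?expR_ge0.
have -> : b + l * - (x 0 i - y 0 i) = - l * x 0 i + (b + l * y 0 i) by ring.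
set A := expR (l * _ + _); set B := expR _.
have -> : expR b + (A + B + rest) = B + (expR b + A + rest) by ring.
by rewrite lerDl !addr_ge0 ?expR_ge0.
Qed.

Let bump_le l b y x : 0 <= l ->
  bump l b y x <= (2 * d + 1)%:R * expR (b + l * `|x - y|).
Proof.
move=> l0.
have -> : (2 * d + 1)%:R * expR (b + l * `|x - y|) = expR (b + l * `|x - y|) +
    \sum_(i < d) (expR (b + l * `|x - y|) + expR (b + l * `|x - y|)).
  by rewrite sumr_const card_ord -mulr_natl natrD natrM; ring.
have le i : `|x 0 i - y 0 i| <= `|x - y| by have := le_coord_norm (x - y) i; rewrite !mxE.
rewrite lerD //; first by rewrite ler_expR lerDl mulr_ge0.
apply: ler_sum => i _; rewrite lerD // ler_expR.
  have -> : l * x 0 i + (b - l * y 0 i) = b + l * (x 0 i - y 0 i) by ring.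
  by rewrite lerD2l ler_wpM2l // (le_trans (ler_norm _)).
have -> : - l * x 0 i + (b + l * y 0 i) = b + l * - (x 0 i - y 0 i) by ring.
by rewrite lerD2l ler_wpM2l // (le_trans (ler_norm _)) // normrN.
Qed.

(* The McShane extension [min_y (f y + L |x - y|)], with the minimum over a
   finite net and the sup norm both replaced by log-sum-exp. *)
Lemma smooth_approx (S : set 'rV[R]_d) (L delta : R) : compact S -> 0 <= L -> 0 < delta ->
  exists2 H : R, 0 <= H & forall f,
    (forall x y, S x -> S y -> `|f x - f y| <= L * `|x - y|) ->
    exists P, [/\ Cinf P, forall x y, `|P x - P y| <= d%:R * L * `|x - y|,
      forall i x y, `|partial i P x - partial i P y| <= H * `|x - y| &
      forall x, S x -> `|P x - f x| <= delta].
Proof.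
move=> cS L0 delta0.
pose eta := delta / (4 * (L + 1)).
have eta0 : 0 < eta by rewrite divr_gt0 // mulr_gt0 // ltr_wpDl.
have [ys ysS net] := compact_net cS eta0.
pose n : R := (size ys).+1%:R; pose m : R := (2 * d + 1)%:R.
have n1 : 1 <= n by rewrite ler1n.
have m1 : 1 <= m by rewrite ler1n addn1.
(* A log-sum-exp exceeds the maximum by at most the logarithm of the number of terms: [ln n] for the
   net and [ln m] for a bump. Scaled by [eps] both together cost at most [delta / 2]. Everything up
   to here depends on [S], [L] and [delta] only, so that [H] is uniform in [f]. *)
pose eps := delta / (2 * (ln n + ln m + 1)).
have lnp : 0 < ln n + ln m + 1 by rewrite ltr_wpDl // addr_ge0 // ln_ge0.
have eps0 : 0 < eps by rewrite divr_gt0 // mulr_gt0.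
pose l := L / eps; have l0 : 0 <= l by rewrite divr_ge0 // ltW.
have H0 : 0 <= eps * (4 * l ^+ 2).
  by apply: mulr_ge0; [exact: ltW|apply: mulr_ge0 => //; exact: sqr_ge0].
exists (d%:R * (eps * (4 * l ^+ 2))); first exact: mulr_ge0.
(* An empty net forces [S] to be empty; otherwise the sum [s] below is positive and has a
   logarithm. *)
move=> f lipf; have [ys0|ys0] := eqVneq ys [::].
  exists (fun=> 0); split=> [|x y|i x y|x Sx]; first exact: Cinf_cst.
  - by rewrite subrr normr0 !mulr_ge0.
  - by rewrite partial_cst subrr normr0; apply: mulr_ge0 => //; exact: mulr_ge0.
  - by have [y] := net x Sx; rewrite ys0.
(* The reciprocal of a bump is about exp(-(f y + L |x - y|)/eps), so that [- eps * ln s] is a soft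
   minimum over the net. *)
pose s x := \sum_(y <- ys) (bump l (f y / eps) y x)^-1.
have s0 x : 0 < s x.
  rewrite /s; case: (ys) ys0 => // y r _; rewrite big_cons ltr_wpDr ?invr_gt0 //.
  by apply: sumr_ge0 => z _; rewrite invr_ge0 ltW.
have sn0 x : s x != 0 by rewrite gt_eqF.
have [cs _ s1 s2] : logder2 l 3 s.
  apply: logder2_sum => // y; apply: logder2V => //; exact: logder2_bump.
have csi : Cinf (fun x => (s x)^-1) by exact: CinfV.
have cln : Cinf (fun x => ln (s x)) by move=> k; exact: Ck_ln.
pose P x := - eps * ln (s x).
have cP : Cinf P by apply: CinfM => //; exact: Cinf_cst.
have pP i : partial i P = fun x => - eps * ((s x)^-1 * partial i s x).
  apply/funext => x; rewrite partialM //; last exact: Cinf_cst.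
  by rewrite partial_cst mulr0 addr0 partial_ln.
have b1 k x : `|(s x)^-1 * partial k s x| <= l.
  by rewrite normrM gtr0_norm ?invr_gt0 // ler_pdivrMl // mulrC.
exists P; split=> // [|i|x Sx].
- apply: lipschitz_of_partial => // i x; rewrite pP normrM normrN (gtr0_norm eps0).
  by rewrite -ler_pdivlMl // [_^-1 * L]mulrC.
- apply: lipschitz_of_partial; first exact: H0.
    exact: Cinf_partial.
  move=> j x; rewrite pP.
  have cpi := Cinf_partial i cs.
  rewrite partialM; [|exact: Cinf_cst|exact: CinfM].
  rewrite partial_cst mulr0 addr0 normrM normrN (gtr0_norm eps0).
  rewrite ler_wpM2l ?(ltW eps0) //.
  rewrite partialM // partialV //.
  have alg (a b c e : R) : a * b + c * (- (a * a) * e) = a * b - (a * c) * (a * e) by ring.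
  rewrite alg.
  rewrite (le_trans (ler_normB _ _)) //.
  have -> : 4 * l ^+ 2 = 3 * l ^+ 2 + l * l by ring.
  rewrite lerD //; last by rewrite normrM ler_pM.
  by rewrite normrM gtr0_norm ?invr_gt0 // ler_pdivrMl // mulrC.
have epsE : eps * (ln n + ln m) <= delta / 2.
  have -> : eps * (ln n + ln m) = delta / 2 * ((ln n + ln m) / (ln n + ln m + 1)).
    by rewrite /eps; field; rewrite gt_eqF.
  by rewrite ler_piMr ?divr_ge0 // ?(ltW delta0) // ler_pdivrMr // mul1r lerDl.
have etaE : 2 * L * eta <= delta / 2.
  have L1 : 0 < L + 1 by rewrite ltr_wpDl.
  have -> : 2 * L * eta = delta / 2 * (L / (L + 1)) by rewrite /eta; field; rewrite gt_eqF.
  by rewrite ler_piMr ?divr_ge0 ?ltW // ltr_pdivrMr // mul1r ltrDl.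
have elE (z : R) : eps * (l * z) = L * z by rewrite /l mulrA mulrCA mulfV ?gt_eqF // mulr1.
have efE (z : R) : eps * (z / eps) = z by rewrite mulrCA mulfV ?gt_eqF // mulr1.
(* Lower bound: by the Lipschitz property each competitor f y + L |x - y| is at least f x. Upper
   bound: the net point within [eta] of [x] is itself a competitor. *)
rewrite ler_distl; apply/andP; split.
  have sle : s x <= n * expR (- (f x / eps)).
    have -> : n * expR (- (f x / eps)) =
        expR (- (f x / eps)) + \sum_(y <- ys) expR (- (f x / eps)).
      by rewrite big_const_seq count_predT iter_addr_0 -mulr_natl /n -natr1; ring.
    rewrite ler_wpDl ?expR_ge0 // /s big_seq [leRHS]big_seq; apply: ler_sum => y yin.
    rewrite expRN lef_pV2 ?posrE ?expR_gt0 ?bump_gt0 //.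
    apply: le_trans (bump_ge _ _ _ l0); rewrite ler_expR.
    rewrite -(ler_pM2l eps0) mulrDr !efE elE -lerBlDl.
    exact: (le_trans (ler_norm _) (lipf _ _ Sx (ysS _ yin))).
  have : ln (s x) <= ln n - f x / eps.
    rewrite -[X in _ <= _ + X]expRK -lnM ?posrE ?expR_gt0 //.
    by rewrite ler_ln ?posrE // mulr_gt0 ?expR_gt0.
  rewrite -(ler_pM2l eps0) mulrBr efE /P mulNr => h.
  have : eps * ln n <= delta / 2.
    by apply: le_trans epsE; rewrite ler_wpM2l ?(ltW eps0) // lerDl ln_ge0.
  by move=> h2; lra.
have [y yin xy] := net x Sx.
have sge : (bump l (f y / eps) y x)^-1 <= s x.
  rewrite /s (big_rem y yin) /= lerDl.
  by apply: sumr_ge0 => z _; rewrite invr_ge0 ltW.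
have : - ln (s x) <= ln m + (f y / eps + l * `|x - y|).
  rewrite -[X in _ <= _ + X]expRK -lnM ?posrE ?expR_gt0 ?(lt_le_trans ltr01) //.
  apply: (@le_trans _ _ (ln (bump l (f y / eps) y x))); last first.
    rewrite ler_ln ?posrE ?bump_le ?bump_gt0 // mulr_gt0 ?expR_gt0 //.
    exact: lt_le_trans m1.
  rewrite lerNl -lnV ?posrE // ler_ln ?posrE ?invr_gt0 //.
rewrite -(ler_pM2l eps0) mulrN -mulNr -/(P x) 2!mulrDr efE elE => h.
have h1 : eps * ln m <= delta / 2.
  by apply: le_trans epsE; rewrite ler_wpM2l ?(ltW eps0) // lerDr ln_ge0.
have h2 : L * `|x - y| <= L * eta by rewrite ler_wpM2l.
have h3 : f y - f x <= L * `|x - y|.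
  by rewrite distrC (le_trans (ler_norm _)) // lipf //; exact: ysS.
lra.
Qed.

End SmoothApprox.

(** * Measures concentrated on a ball *)

Section ConcentratedMeasures.
Context {R : realType} {d : nat}.
Implicit Types (m n : probability (Rd R d) R) (r c : R).
Implicit Types (f g : 'rV[R]_d -> R) (x y : 'rV[R]_d).

Lemma open_measurable_Rd (A : set 'rV[R]_d) : open A -> measurable (A : set (Rd R d)).
Proof. exact: sub_sigma_algebra. Qed.

Lemma closed_measurable_Rd (A : set 'rV[R]_d) : closed A -> measurable (A : set (Rd R d)).
Proof.
move=> cA; rewrite -(setCK A); apply: measurableC.
by apply: open_measurable_Rd; exact: closed_openC.
Qed.

Lemma continuous_measurable_Rd f : continuous f ->
  measurable_fun setT (f : Rd R d -> R).
Proof.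
move=> /continuousP cf; apply: (measurability _ (RGenOpens.measurableE R)).
move=> _ [_ [a [b ->] <-]]; rewrite setTI.
by apply: open_measurable_Rd; apply: cf; exact: itv_open.
Qed.

Definition concentrated r m := m (~` eball r : set (Rd R d)) = 0%E.

Lemma measurable_eball r : measurable (eball r : set (Rd R d)).
Proof. by apply: closed_measurable_Rd; exact: eball_closed. Qed.

(** Each point off the ball has a null open neighbourhood, and the complement of the ball is a
    countable union of compact shells, each covered by finitely many of them. *)
Lemma msupp_concentrated r m : msupp m `<=` eball r -> concentrated r m.
Proof.
move=> supp; apply/negligibleP; first by apply: measurableC; exact: measurable_eball.
have /choice [U Unull] x : exists U : set 'rV[R]_d,
    ~ eball r x -> open_nbhs x U /\ m U = 0%E.
  have [|nx] := pselect (eball r x); first by move=> ?; exists set0.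
  have /existsNP[U /not_implyP[xU /negP mU]] : ~ msupp m x by move=> /supp.
  exists U => _; split=> //; apply/eqP; move: mU.
  by rewrite -leNgt measure_le0.
pose K k : set 'rV[R]_d := [set x | r + k.+1%:R^-1 <= enorm x <= k%:R].
have -> : ~` eball r = \bigcup_k K k :> set 'rV[R]_d.
  apply/seteqP; split=> [x /negP|x [k _ /andP[rx _]]].
    rewrite /eball /= -ltNge => rx.
    pose e := enorm x - r; have e0 : 0 < e by rewrite subr_gt0.
    exists (maxn (Num.truncn e^-1) (Num.truncn (enorm x)).+1) => //.
    rewrite /K /=; set k := maxn _ _; apply/andP; split.
      rewrite -lerBrDl -/e -[leRHS]invrK lef_pV2 ?posrE ?invr_gt0 ?ltr0n //.
      rewrite (le_trans (ltW (truncnS_gt _))) // ler_nat ltnS leq_maxl //.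
    by rewrite (le_trans (ltW (truncnS_gt _))) // ler_nat leq_maxr.
  by apply/negP; rewrite /eball /= -ltNge (lt_le_trans _ rx) // ltrDl invr_gt0 ltr0n.
apply: negligible_bigcup => k.
have cK : compact (K k).
  apply: (@subclosed_compact _ _ (eball k%:R)); last 2 first.
  - exact: eball_compact.
  - by move=> x /andP[].
  have -> : K k = (enorm @^-1` [set s | r + k.+1%:R^-1 <= s]) `&` eball k%:R.
    by apply/seteqP; split=> [x /andP[]|x [/= h1 h2]]; [|apply/andP].
  apply: closedI; last exact: eball_closed.
  by apply: closed_comp; [move=> x _; exact: continuous_enorm|exact: closed_ge].
have Kr x : K k x -> ~ eball r x.
  move=> /andP[h _]; apply/negP; rewrite /eball /= -ltNge (lt_le_trans _ h) //.
  by rewrite ltrDl invr_gt0 ltr0n.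
move: cK; rewrite compact_cover => /(_ 'rV[R]_d (K k) U) [].
- by move=> x /Kr/Unull [[]].
- by move=> x Kx; exists x => //; have [[]] := Unull _ (Kr _ Kx).
move=> D DK cov; pose s := finmap.enum_fset D.
pose W i := if (i < size s)%N then U (nth 0 s i) else set0.
have KW : K k `<=` \bigcup_i W i.
  move=> x /cov [y yD Uy]; exists (index y s) => //.
  by rewrite /W index_mem yD nth_index.
apply: (@negligibleS _ (Rd R d) R m _ _ KW).
apply: negligible_bigcup => i; rewrite /W; case: ifPn => [si|_]; last exact: negligible_set0.
have /Unull[[oU _] mU] : ~ eball r (nth 0 s i).
  by apply: Kr; have := DK _ (mem_nth 0 si); rewrite inE.
by apply/negligibleP => //; exact: open_measurable_Rd.
Qed.

Lemma concentrated_ge0 r m : concentrated r m -> 0 <= r.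
Proof.
move=> cm; rewrite leNgt; apply/negP => r0.
have : eball r = set0 :> set 'rV[R]_d.
  by apply/seteqP; split=> // x /=; rewrite /eball /= leNgt (lt_le_trans r0) ?enorm_ge0.
move=> E; move: cm; rewrite /concentrated E setC0 probability_setT => /eqP.
by rewrite onee_eq0.
Qed.

Lemma concentrated_ae r m (Q : 'rV[R]_d -> Prop) : concentrated r m ->
  (forall x, eball r x -> Q x) -> \forall x \ae m, Q x.
Proof.
move=> cm h; exists (~` eball r); split=> //.
  by apply: measurableC; exact: measurable_eball.
by apply: subsetC; exact: h.
Qed.

Lemma continuous_bounded_eball f r : continuous f ->
  exists2 c, 0 <= c & forall x, eball r x -> `|f x| <= c.
Proof.
move=> cf; have cfr : compact (f @` eball r).
  by apply: continuous_compact; [exact: continuous_subspaceT|exact: eball_compact].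
have [c [_ hc]] := compact_bounded cfr.
exists (`|c| + 1); first by rewrite addr_ge0.
by move=> x xr; apply: hc; [rewrite ltr_pwDr // ler_norm|exists x].
Qed.

Lemma integral_norm_le f r c m : concentrated r m -> 0 <= c ->
  measurable_fun setT (f : Rd R d -> R) -> (forall x, eball r x -> `|f x| <= c) ->
  (\int[m]_x `|(f x)%:E| <= c%:E)%E.
Proof.
move=> cm c0 mf fc; rewrite -[leRHS]mule1 -(@probability_setT _ _ _ m).
rewrite -(@integral_cst _ _ _ m _ measurableT c%:E).
apply: ae_ge0_le_integral => //.
- by apply: (measurableT_comp (@abse_measurable R setT)); apply/measurable_EFinP.
- by apply: (concentrated_ae cm) => x /fc h _; rewrite lee_fin.
Qed.

Lemma concentrated_integrable f r m : concentrated r m -> continuous f ->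
  m.-integrable setT (EFin \o f).
Proof.
move=> cm cf; have [c c0 fc] := continuous_bounded_eball r cf.
have mf := continuous_measurable_Rd cf.
apply/integrableP; split; first by apply/measurable_EFinP.
by rewrite (le_lt_trans (integral_norm_le cm c0 mf fc)) ?ltry.
Qed.

Lemma Rintegral_norm_le f r c m : concentrated r m -> 0 <= c ->
  continuous f -> (forall x, eball r x -> `|f x| <= c) -> `|\int[m]_x f x| <= c.
Proof.
move=> cm c0 cf fc; have fi := concentrated_integrable cm cf.
rewrite (le_trans (le_normr_Rintegral measurableT fi)) // /Rintegral.
rewrite -[leRHS]/(fine c%:E) fine_le //.
  rewrite ge0_fin_numE ?integral_ge0 //.
  by rewrite (le_lt_trans (integral_norm_le cm c0 (continuous_measurable_Rd cf) fc)) ?ltry.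
exact: integral_norm_le (continuous_measurable_Rd cf) fc.
Qed.

Section Linear.
Variables (r : R) (m : probability (Rd R d) R).
Hypothesis cm : concentrated r m.

Lemma cRintegralD f g : continuous f -> continuous g ->
  \int[m]_x (f x + g x) = \int[m]_x f x + \int[m]_x g x.
Proof. by move=> cf cg; apply: RintegralD => //; exact: concentrated_integrable cm _. Qed.

Lemma cRintegralB f g : continuous f -> continuous g ->
  \int[m]_x (f x - g x) = \int[m]_x f x - \int[m]_x g x.
Proof. by move=> cf cg; apply: RintegralB => //; exact: concentrated_integrable cm _. Qed.

Lemma cRintegralZ f c : continuous f -> \int[m]_x (c * f x) = c * \int[m]_x f x.
Proof. by move=> cf; apply: RintegralZl => //; exact: concentrated_integrable cm _. Qed.

Lemma cRintegral_cst c : \int[m]_x (fun=> c) x = c.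
Proof. by rewrite (Rintegral_cst _ measurableT) [X in fine X]probability_setT /= mulr1. Qed.

Lemma cRintegral_dist f g c : continuous f -> continuous g -> 0 <= c ->
  (forall x, eball r x -> `|f x - g x| <= c) ->
  `|\int[m]_x f x - \int[m]_x g x| <= c.
Proof.
move=> cf cg c0 h; rewrite -cRintegralB //; apply: Rintegral_norm_le (cm) _ _ _ => //.
by move=> x; apply: continuousB; [exact: cf|exact: cg].
Qed.

Lemma eq_cRintegral f g : continuous f -> continuous g ->
  (forall x, eball r x -> f x = g x) -> \int[m]_x f x = \int[m]_x g x.
Proof.
move=> cf cg h; apply/eqP; rewrite -subr_eq0 -normr_le0.
by apply: cRintegral_dist => // x /h ->; rewrite subrr normr0.
Qed.

End Linear.
End ConcentratedMeasures.

(** * Locally Lipschitz functions and their convolutions *)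

Section LocallyLipschitz.
Context {R : realType} {d : nat}.
Implicit Types (f g K : 'rV[R]_d -> R) (x y z : 'rV[R]_d) (r c L : R).

(** Coordinatewise (s - t)^2 <= 2 s^2 + 2 t^2, which sums to 4 r^2. *)
Lemma eballB r x y : eball r x -> eball r y -> eball (2 * r) (x - y).
Proof.
rewrite /eball /= => xr yr; have r0 := le_trans (enorm_ge0 x) xr.
have r2 : 0 <= 2 * r by rewrite mulr_ge0.
rewrite -ler_sqr ?nnegrE ?enorm_ge0 // enorm_sqr.
have le2 i : (x - y) 0 i ^+ 2 <= 2 * x 0 i ^+ 2 + 2 * y 0 i ^+ 2.
  have := sqr_ge0 (x 0 i + y 0 i); rewrite !mxE; nra.
rewrite (le_trans (ler_sum _ (fun i _ => le2 i))) // big_split /= -!mulr_sumr -!enorm_sqr.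
have sx : enorm x ^+ 2 <= r ^+ 2 by rewrite lerXn2r ?nnegrE ?enorm_ge0.
have sy : enorm y ^+ 2 <= r ^+ 2 by rewrite lerXn2r ?nnegrE ?enorm_ge0.
lra.
Qed.

Lemma eballS r c : r <= c -> (eball r : set 'rV[R]_d) `<=` eball c.
Proof. by move=> rc x /le_trans; apply. Qed.

Definition lip_on r L f :=
  forall x y, eball r x -> eball r y -> `|f x - f y| <= L * `|x - y|.

(** A common home for the smooth test functions and the merely Lipschitz kernels: the class is
    closed under sums, products and convolution with a concentrated measure, and its members are
    integrable against such a measure. *)
Definition loclip f := forall r, exists2 L, 0 <= L & lip_on r L f.

Lemma loclip_continuous f : loclip f -> continuous f.
Proof.
(* By [enorm_dist] this Euclidean ball contains the sup-norm ball of radius 1 about [x]. *)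
move=> lf x; have [L L0 fL] := lf (enorm x + d%:R).
apply/(@cvgrPdist_le _ _ _ (nbhs x)) => e e0.
have L1 : 0 < L + 1 by rewrite ltr_wpDl.
near=> y; have : `|x - y| <= e / (L + 1).
  near: y; apply: cvgr_dist_le; [exact: cvg_id|by rewrite divr_gt0].
have : `|x - y| <= 1 by near: y; apply: cvgr_dist_le; [exact: cvg_id|].
move=> xy1; rewrite ler_pdivlMr // mulrC; apply: le_trans.
rewrite (le_trans (fL _ _ _ _)) //; last by rewrite ler_wpM2r // lerDl.
  by rewrite /eball /= lerDl.
rewrite /eball /= -lerBlDl (le_trans (ler_norm _)) // distrC.
by rewrite (le_trans (enorm_dist _ _)) // ler_piMr.
Unshelve. all: by end_near. Qed.

Lemma loclip_bounded f r : loclip f -> exists2 c, 0 <= c & forall x, eball r x -> `|f x| <= c.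
Proof. by move=> /loclip_continuous; exact: continuous_bounded_eball. Qed.

Lemma loclipD f g : loclip f -> loclip g -> loclip (fun x => f x + g x).
Proof.
move=> lf lg r; have [L L0 fL] := lf r; have [M M0 gM] := lg r.
exists (L + M); first exact: addr_ge0.
move=> x y xr yr; rewrite opprD addrACA (le_trans (ler_normD _ _)) // mulrDl.
by rewrite lerD // ?fL ?gM.
Qed.

Lemma lip_onM r L M cf cg f g : lip_on r L f -> lip_on r M g ->
  (forall x, eball r x -> `|f x| <= cf) -> (forall x, eball r x -> `|g x| <= cg) ->
  lip_on r (cf * M + cg * L) (fun x => f x * g x).
Proof.
move=> fL gM fb gb x y xr yr.
have -> : f x * g x - f y * g y = f x * (g x - g y) + g y * (f x - f y) by ring.
rewrite (le_trans (ler_normD _ _)) // mulrDl !normrM -!mulrA.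
by rewrite lerD // ler_pM ?fb ?gb ?fL ?gM.
Qed.

Lemma loclipM f g : loclip f -> loclip g -> loclip (fun x => f x * g x).
Proof.
move=> lf lg r; have [L L0 fL] := lf r; have [M M0 gM] := lg r.
have [cf cf0 fb] := loclip_bounded r lf; have [cg cg0 gb] := loclip_bounded r lg.
exists (cf * M + cg * L); first by rewrite addr_ge0 // mulr_ge0.
exact: lip_onM.
Qed.

Lemma loclip_cst c : loclip (fun=> c).
Proof. by move=> r; exists 0 => // x y _ _; rewrite subrr normr0 mul0r. Qed.

Lemma loclipB f g : loclip f -> loclip g -> loclip (fun x => f x - g x).
Proof.
move=> lf lg; have := loclipD lf (loclipM (loclip_cst (-1)) lg).
by congr loclip; apply/funext => x; rewrite mulN1r.
Qed.

Lemma loclip_sum (I : Type) (s : seq I) (F : I -> 'rV[R]_d -> R) :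
  (forall i, loclip (F i)) -> loclip (fun x => \sum_(i <- s) F i x).
Proof.
move=> lF; elim: s => [|i s IH].
  by under eq_fun do rewrite big_nil; exact: loclip_cst.
by under eq_fun do rewrite big_cons; exact: loclipD.
Qed.

Lemma Cinf_loclip f : Cinf f -> loclip f.
Proof.
move=> cf r.
(* Segments between points of the Euclidean ball stay in the sup-norm ball of radius [r], which lies
   in the Euclidean ball of radius [d * r]. *)
have bnd (i : 'I_d) : exists2 c, 0 <= c & forall x, eball (d%:R * r) x -> `|partial i f x| <= c.
  by apply: continuous_bounded_eball; apply: Cinf_continuous; exact: Cinf_partial.
have /choice [C hC] (i : 'I_d) : exists c, 0 <= c /\ forall x, eball (d%:R * r) x -> `|partial i f x| <= c.
  by have [c c0 hc] := bnd i; exists c.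
exists (\sum_i C i); first by apply: sumr_ge0 => i _; exact: (hC i).1.
move=> x y xr yr; have [c /andP[c0 c1]] := segment_MVT y (x - y) (fun z => Cinf_diff z cf).
rewrite [y + _]addrC subrK => ->; rewrite deriveEpartial; last exact: Cinf_diff.
rewrite (le_trans (ler_norm_sum _ _ _)) // mulr_suml; apply: ler_sum => i _.
rewrite normrM mulrC ler_pM ?le_coord_norm // (hC i).2 // /eball /=.
rewrite (le_trans (enorm_le_norm _)) // ler_wpM2l //.
have -> : y + c *: (x - y) = c *: x + (1 - c) *: y.
  by rewrite scalerBr scalerBl scale1r addrCA.
have c1' : 0 <= 1 - c by rewrite subr_ge0 ltW.
rewrite (le_trans (ler_normD _ _)) // !normrZ (ger0_norm c1') (gtr0_norm c0).
have xr' : `|x| <= r by rewrite (le_trans (le_norm_enorm x)).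
have yr' : `|y| <= r by rewrite (le_trans (le_norm_enorm y)).
have -> : r = c * r + (1 - c) * r by ring.
by rewrite lerD // ler_wpM2l // ltW.
Qed.

Definition conv K (m : probability (Rd R d) R) x := \int[m]_y K (x - y).

Section Convolution.
Variables (r : R) (m : probability (Rd R d) R).
Hypothesis cm : concentrated r m.

Lemma loclip_shift K x : loclip K -> loclip (fun y => K (x - y)).
Proof.
move=> lK c; set q := Num.max (enorm x) c; have [L L0 KL] := lK (2 * q).
exists L => // y z yc zc; rewrite (le_trans (KL _ _ _ _)) //.
- by apply: eballB; [rewrite /eball /= le_max lexx|apply: eballS yc; rewrite le_max lexx orbT].
- by apply: eballB; [rewrite /eball /= le_max lexx|apply: eballS zc; rewrite le_max lexx orbT].
- by rewrite opprB addrC addrA subrK -normrN opprB.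
Qed.

Lemma conv_lip K L : 0 <= L -> loclip K -> lip_on (2 * r) L K -> lip_on r L (conv K m).
Proof.
move=> L0 lK KL x y xr yr; rewrite /conv.
have cK z : continuous (fun w : 'rV[R]_d => K (z - w)).
  by apply: loclip_continuous; exact: loclip_shift.
apply: (cRintegral_dist cm (cK x) (cK y)); first exact: mulr_ge0.
move=> z zr; rewrite (le_trans (KL _ _ _ _)) //; [exact: eballB|exact: eballB|].
by rewrite opprB addrA subrK.
Qed.

Lemma conv_bound K c : 0 <= c -> loclip K ->
  (forall z, eball (2 * r) z -> `|K z| <= c) -> forall x, eball r x -> `|conv K m x| <= c.
Proof.
move=> c0 lK Kc x xr; apply: Rintegral_norm_le (cm) c0 _ _.
  exact/loclip_continuous/loclip_shift.
by move=> y yr; apply: Kc; exact: eballB.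
Qed.

End Convolution.

Lemma loclip_conv r m K : concentrated r m -> loclip K -> loclip (conv K m).
Proof.
move=> cm lK c; set q := Num.max r c.
have cq : concentrated q m.
  apply: (@subset_measure0 _ _ _ m _ (~` eball r)).
  - by apply: measurableC; exact: measurable_eball.
  - by apply: measurableC; exact: measurable_eball.
  - by apply: subsetC; apply: eballS; rewrite le_max lexx.
  - exact: cm.
have [L L0 KL] := lK (2 * q); exists L => // x y xc yc.
by apply: (conv_lip cq L0 lK KL); [apply: eballS xc|apply: eballS yc]; rewrite le_max lexx orbT.
Qed.

Lemma lip_on_shift r K L x : lip_on (2 * r) L K -> eball r x ->
  lip_on r L (fun y => K (x - y)).
Proof.
move=> KL xr y z yr zr; rewrite (le_trans (KL _ _ _ _)) //; [exact: eballB|exact: eballB|].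
by rewrite opprB addrC addrA subrK -normrN opprB.
Qed.

Lemma conv_dist r m n K c : concentrated r m -> concentrated r n ->
  loclip K -> 0 <= c -> (forall f, loclip f -> forall L, 0 <= L -> lip_on r L f ->
     `|\int[m]_y f y - \int[n]_y f y| <= L * c) ->
  forall L, 0 <= L -> lip_on (2 * r) L K ->
  forall x, eball r x -> `|conv K m x - conv K n x| <= L * c.
Proof.
move=> cm cn lK c0 mn L L0 KL x xr.
by apply: mn => //; [exact: loclip_shift|exact: lip_on_shift].
Qed.

End LocallyLipschitz.

(** * Interaction kernels and their Lipschitz constants *)

Section Kernels.
Context {R : realType} {d : nat}.
Implicit Types (b : R -> R) (r B L s t : R) (z : 'rV[R]_d).

Definition kernel_on r B L b := (forall s, 0 <= s <= r -> `|b s| <= B) /\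
  (forall s t, 0 <= s <= r -> 0 <= t <= r -> `|b s - b t| <= L * `|s - t|).

Definition kernel b := forall r, 0 <= r -> exists B L, [/\ 0 <= B, 0 <= L & kernel_on r B L b].

Definition Fcoord b (i : 'I_d) z := Fker b z 0 i.

Lemma FcoordE b i z : Fcoord b i z = - (b (enorm z) * z 0 i).
Proof. by rewrite /Fcoord /Fker mxE mulNr. Qed.

Lemma Fcoord_bound r B L b i : 0 <= B -> kernel_on r B L b ->
  forall z, eball r z -> `|Fcoord b i z| <= B * r.
Proof.
move=> B0 [bB _] z zr; rewrite FcoordE normrN normrM ler_pM ?bB ?enorm_ge0 //.
by rewrite (le_trans (le_coord_enorm _ _)).
Qed.

(** Product rule: [B] comes from varying the coordinate, [L * d * r] from varying the radial factor,
    since |z_i| <= r and the Euclidean norm is [d]-Lipschitz for the sup norm. *)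
Lemma Fcoord_lip r B L b i : 0 <= B -> 0 <= L -> kernel_on r B L b ->
  lip_on r (B + L * d%:R * r) (Fcoord b i).
Proof.
move=> B0 L0 [bB bL] x y xr yr; rewrite !FcoordE.
have -> : - (b (enorm x) * x 0 i) - - (b (enorm y) * y 0 i) =
  - (b (enorm x) * (x - y) 0 i + (b (enorm x) - b (enorm y)) * y 0 i) by rewrite !mxE; ring.
rewrite normrN [leRHS]mulrDl (le_trans (ler_normD _ _)) // !normrM lerD //.
  by rewrite ler_pM ?le_coord_norm // bB // enorm_ge0.
rewrite -mulrA [r * _]mulrC mulrA ler_pM //.
  rewrite (le_trans (bL _ _ _ _)) ?enorm_ge0 // -mulrA ler_wpM2l //; exact: enorm_dist.
by rewrite (le_trans (le_coord_enorm _ _)).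
Qed.

Lemma loclip_Fcoord b i : kernel b -> loclip (Fcoord b i).
Proof.
move=> kb r; have [r0|r0] := leP 0 r.
  have [B [L [B0 L0 bk]]] := kb r r0.
  exists (B + L * d%:R * r); first by rewrite addr_ge0 // !mulr_ge0.
  exact: Fcoord_lip.
exists 0 => // x y; rewrite /eball /= => xr.
by have := lt_le_trans r0 (enorm_ge0 x); rewrite ltNge xr.
Qed.

Lemma admissible_kernel b : admissible b -> kernel b.
Proof.
move=> [[B [_ bB]] bL] r r0.
have B0 : 0 <= `|B| + 1 by rewrite addr_ge0.
have sub : `[0, r] `<=` @Rplus R by move=> s /=; rewrite /Rplus /= !in_itv /= => /andP[-> _].
have [L [_ hL]] := bL _ (@segment_compact _ 0 r) sub.
have L0 : 0 <= `|L| + 1 by rewrite addr_ge0.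
exists (`|B| + 1), (`|L| + 1); split=> //; split=> [s /andP[s0 sr]|s t sr tr].
  by apply: bB; [rewrite ltr_pwDr // ler_norm|rewrite /Rplus /= in_itv /= s0].
have := hL (`|L| + 1) _ (s, t); apply; first by rewrite ltr_pwDr // ler_norm.
by split; rewrite /= in_itv.
Qed.

End Kernels.

(** * From couplings to integrals of Lipschitz functions *)

Section Wasserstein.
Context {R : realType} {d : nat}.
Implicit Types (m n : probability (Rd R d) R) (f : 'rV[R]_d -> R) (L : R).

(** The product carries the product of the two Borel structures, so the distance is assembled from
    coordinates and projections instead of being read off from continuity. *)
Lemma measurable_dist :
  measurable_fun setT (fun z : Rd R d * Rd R d => enorm ((z.1 : 'rV[R]_d) - z.2)).
Proof.
have mcoord (i : 'I_d) : measurable_fun setT (fun x : Rd R d => (x : 'rV[R]_d) 0 i).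
  by apply: continuous_measurable_Rd; exact: coord_continuous.
apply: (measurableT_comp (f := @Num.sqrt R)).
  by apply: continuous_measurable_fun; exact: sqrt_continuous.
apply: measurable_sum => i.
under eq_fun do rewrite !mxE.
apply: measurable_funX; apply: measurable_funB.
  by apply: (measurableT_comp (mcoord i)); exact: measurable_fst.
by apply: (measurableT_comp (mcoord i)); exact: measurable_snd.
Qed.

Lemma coupling_integral m n p f r : concentrated r m -> concentrated r n ->
  coupling m n p -> loclip f ->
  [/\ p.-integrable setT (fun z => (f z.1)%:E), p.-integrable setT (fun z => (f z.2)%:E),
      (\int[m]_x (f x)%:E = \int[p]_z (f z.1)%:E)%E &
      (\int[n]_x (f x)%:E = \int[p]_z (f z.2)%:E)%E].
Proof.
move=> cm cn cp lf; have cf := loclip_continuous lf.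
have mf : measurable_fun setT (EFin \o (f : Rd R d -> R)).
  by apply/measurable_EFinP; exact: continuous_measurable_Rd.
have mabs : measurable_fun setT (fun x : Rd R d => `|(f x)%:E|%E).
  exact: (measurableT_comp (@abse_measurable R setT)).
have key (g : Rd R d * Rd R d -> Rd R d) (q : probability (Rd R d) R) :
    measurable_fun setT g -> concentrated r q ->
    (forall A, measurable A -> pushforward p g A = q A) ->
    p.-integrable setT (fun z => (f (g z))%:E) /\
    (\int[q]_x (f x)%:E = \int[p]_z (f (g z))%:E)%E.
  move=> mg cq pq.
  have intp : p.-integrable setT ((EFin \o f) \o g).
    apply/integrableP; split; first exact: measurableT_comp.
    have := integrableP _ _ _ (concentrated_integrable cq cf) => -[_].
    rewrite (eq_measure_integral (pushforward p g)) => [|A mA _]; last exact/esym/pq.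
    by rewrite ge0_integral_pushforward // preimage_setT.
  split=> //.
  rewrite (eq_measure_integral (pushforward p g)) => [|A mA _]; last exact/esym/pq.
  by rewrite integral_pushforward // preimage_setT.
have [] := key fst m measurable_fst cm.
  by move=> A /cp [<- _]; congr (p _); apply/seteqP; split=> -[x y] //= -[].
have [] := key snd n measurable_snd cn.
  by move=> A /cp [_ <-]; congr (p _); apply/seteqP; split=> -[x y] //= -[].
by [].
Qed.

Lemma coupling_dist m n p f r L : concentrated r m -> concentrated r n ->
  coupling m n p -> loclip f -> 0 <= L -> lip_on r L f ->
  (`|\int[m]_x f x - \int[n]_x f x|%:E <= L%:E * \int[p]_z (enorm (z.1 - z.2))%:E)%E.
Proof.
move=> cm cn cp lf L0 fL.
have [i1 i2 e1 e2] := coupling_integral cm cn cp lf.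
have mE : measurable_fun setT (fun z : Rd R d * Rd R d => (enorm ((z.1 : 'rV[R]_d) - z.2))%:E).
  by apply/measurable_EFinP; exact: measurable_dist.
rewrite /Rintegral e1 e2 -fineB; [|exact: integrable_fin_num..].
rewrite -integralB //.
have iB : p.-integrable setT (fun z => ((f z.1)%:E - (f z.2)%:E)%E) by exact: integrableB.
have abs_fine (u : \bar R) : u \is a fin_num -> (`|fine u|%:E = `|u|)%E by case: u.
rewrite abs_fine; last exact: integrable_fin_num.
have mB := measurable_int _ iB.
rewrite (le_trans (le_abse_integral _ measurableT mB)) // -ge0_integralZl //; last first.
  by move=> z _; rewrite lee_fin enorm_ge0.
apply: ae_ge0_le_integral => //.
- exact: (measurableT_comp (@abse_measurable R setT)).
- by move=> z _; rewrite mule_ge0 // lee_fin // enorm_ge0.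
- exact: measurable_funeM.
pose B : set (Rd R d) := ~` eball r.
have mB' : measurable B by apply: measurableC; exact: measurable_eball.
(* [f] is Lipschitz on the ball only, but [p]-almost every pair has both points there because both
   marginals are concentrated. *)
exists (B `*` [set: Rd R d] `|` [set: Rd R d] `*` B); split.
- by apply: measurableU; exact: measurableX.
- have [h1 h2] := cp _ mB'.
  apply/eqP; rewrite -measure_le0 (le_trans (measureU2 _ _ _)) //; try exact: measurableX.
  have -> : (p (B `*` [set: Rd R d]) + p ([set: Rd R d] `*` B) = m B + n B)%E.
    by rewrite -h1 -h2.
  by rewrite [m _]cm [n _]cn adde0.
move=> [x y] /= xy; apply: contrapT => /not_orP[h1 h2]; apply: xy => _.
have {}h1 : eball r x by apply: contrapT => h; apply: h1.
have {}h2 : eball r y by apply: contrapT => h; apply: h2.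
rewrite lee_fin (le_trans (fL _ _ h1 h2)) // ler_wpM2l //; exact: le_norm_enorm.
Qed.

(** Positivity of [L] allows the division that turns the estimate for each coupling into a lower
    bound of the infimum. *)
Lemma W1_dist m n f r L : concentrated r m -> concentrated r n ->
  loclip f -> 0 < L -> lip_on r L f ->
  (`|\int[m]_x f x - \int[n]_x f x|%:E <= L%:E * W1 m n)%E.
Proof.
move=> cm cn lf L0 fL; rewrite -lee_pdivrMl //.
apply: le_ereal_inf_tmp => _ [p cp <-]; rewrite lee_pdivrMl //.
by apply: coupling_dist (cm) (cn) _ _ _ _ => //; exact: ltW.
Qed.

Lemma eq_W1 (m m' n n' : set (Rd R d) -> \bar R) :
  (forall A, measurable A -> m A = m' A) -> (forall A, measurable A -> n A = n' A) ->
  W1 m n = W1 m' n'.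
Proof.
move=> mm nn; rewrite /W1; congr (ereal_inf (image _ _)); apply/seteqP.
by split=> p cp A mA; have [-> ->] := cp A mA; rewrite mm // nn.
Qed.

End Wasserstein.

(** * Weak solutions and stability in the initial datum *)

Section Solutions.
Context {R : realType} {d : nat}.
Variables (T : R) (a : R -> R) (r : R) (mu : R -> probability (Rd R d) R).
Hypothesis ka : kernel a.
Implicit Types (f phi : 'rV[R]_d -> R) (s t : R).

Definition transport t phi x := \sum_i partial i phi x * conv (Fcoord a i) (mu t) x.

Definition weak_solution :=
  [/\ forall t, t \in `[0, T] -> concentrated r (mu t),
      forall f, loclip f -> {within `[0, T], continuous (fun t => \int[mu t]_x f x)} &
      forall phi t, Cinf phi -> t \in `]0, T[ ->
        is_derive t (1 : R) (fun s => \int[mu s]_x phi x) (\int[mu t]_x transport t phi x)].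

Lemma loclip_transport t phi : concentrated r (mu t) -> Cinf phi -> loclip (transport t phi).
Proof.
move=> ct cphi; apply: loclip_sum => i; apply: loclipM.
  by apply: Cinf_loclip; exact: Cinf_partial.
by apply: (loclip_conv ct); exact: loclip_Fcoord.
Qed.

Lemma mf_solution_weak (mu0 : set (Rd R d) -> \bar R) : mf_solution T a mu0 mu ->
  (forall t, t \in `[0, T] -> msupp (mu t) `<=` eball r) -> weak_solution.
Proof.
move=> [_ contW _ _ weak] supp.
have cm t : t \in `[0, T] -> concentrated r (mu t).
  by move=> tT; exact: msupp_concentrated (supp t tT).
split=> // [f lf|phi t cphi tT].
  apply/subspace_continuousP => t tT; have [L L0 fL] := lf r.
  have /fine_cvgP[Wfin Wlim] := contW t tT.
  apply/cvgrPdist_le => e e0; have L1 : 0 < L + 1 by rewrite ltr_wpDl.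
  have fL1 : lip_on r (L + 1) f.
    by move=> x y xr yr; rewrite (le_trans (fL _ _ xr yr)) // ler_wpM2r // lerDl.
  have Wsmall : \forall s \near within `[0, T] (nbhs t), `|0 - fine (W1 (mu s) (mu t))| <= e / (L + 1).
    by move/cvgrPdist_le : Wlim; apply; rewrite divr_gt0.
  near=> s; have sT : s \in `[0, T] by near: s; exact: withinT.
  have Wf : W1 (mu s) (mu t) \is a fin_num by near: s.
  have : `|0 - fine (W1 (mu s) (mu t))| <= e / (L + 1) by near: s.
  rewrite sub0r normrN ler_pdivlMr // mulrC => h; rewrite distrC -lee_fin.
  rewrite (le_trans (W1_dist (cm _ sT) (cm _ tT) lf L1 fL1)) //.
  rewrite -(fineK Wf) -EFinM lee_fin; apply: le_trans h.
  by rewrite ler_wpM2l ?(ltW L1) // ler_norm.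
have t0T : t \in `]0, T] by move: tT; rewrite !in_itv /= => /andP[-> /ltW].
have tT' : t \in `[0, T] by move: tT; rewrite !in_itv /= => /andP[/ltW -> /ltW].
(* The cutoff equals 1 where |x|^2 <= r^2 + 1, so [psi] and [phi] agree on a neighbourhood of the
   ball and have the same partial derivatives on it. *)
pose rho := r ^+ 2 + 1; have rho0 : 0 <= rho by rewrite addr_ge0 // sqr_ge0.
have r0 := concentrated_ge0 (cm _ tT').
pose psi x := phi x * step (rho + 1 - \sum_i x 0 i ^+ 2).
have cpsi : Cinf psi by exact: Cinf_cutoff.
have tpsi : test_function psi by exact: test_function_cutoff.
have psiE (x : 'rV[R]_d) : \sum_i x 0 i ^+ 2 <= rho -> psi x = phi x.
  by move=> h; rewrite /psi step_ge1 ?mulr1 // lerBrDl lerD2r.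
have ballE (x : 'rV[R]_d) : eball r x -> \sum_i x 0 i ^+ 2 < rho.
  move=> xr; rewrite -enorm_sqr (@le_lt_trans _ _ (r ^+ 2)) ?ltrDl //.
  by rewrite lerXn2r ?nnegrE ?enorm_ge0.
have int_psi s : s \in `[0, T] -> \int[mu s]_x psi x = \int[mu s]_x phi x.
  move=> sT; apply: (eq_cRintegral (cm _ sT)); [exact: Cinf_continuous..|].
  by move=> x /ballE/ltW; exact: psiE.
have partial_psi i x : eball r x -> partial i psi x = partial i phi x.
  move=> xr; apply: near_eq_derive.
  have cs : continuous (fun y : 'rV[R]_d => \sum_i y 0 i ^+ 2).
    apply: Cinf_continuous => n; have : Ck n (fun y : 'rV[R]_d => \sum_i y 0 i * y 0 i).
      by apply: Ck_sum => j; apply: CkM; exact: Ck_coord.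
    by [].
  have lt_rho : nbhs x [set y : 'rV[R]_d | \sum_i y 0 i ^+ 2 < rho].
    exact: (cs x _ (lt_nbhsl (ballE x xr))).
  by apply: filterS lt_rho => y /ltW; exact: psiE.
have lim := weak psi tpsi t t0T.
have limE : \int[mu t]_x (\sum_i partial i psi x * convolve (Fker a) (mu t) x 0 i) =
    \int[mu t]_x transport t phi x.
  have -> : (fun x => \sum_i partial i psi x * convolve (Fker a) (mu t) x 0 i) = transport t psi.
    by apply/funext => x; apply: eq_bigr => i _; rewrite /convolve mxE.
  apply: (eq_cRintegral (cm _ tT')); [exact/loclip_continuous/loclip_transport/cpsi/cm| |].
    exact/loclip_continuous/loclip_transport/cphi/cm.
  by move=> x xr; apply: eq_bigr => i _; rewrite partial_psi.
rewrite limE in lim.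
have lim' : h^-1 *: (((fun s => \int[mu s]_x phi x) \o shift t) (h *: (1 : R)) -
    \int[mu t]_x phi x) @[h --> (0 : R)^'] --> \int[mu t]_x transport t phi x.
  apply/cvgrPdist_le => e e0; move/cvgrPdist_le : lim => /(_ e e0).
  rewrite near_withinE near_withinE => /nbhs_ballP[eta /= eta0 H].
  have [_ /andP[t0 tT1]] : True /\ 0 < t < T by move: tT; rewrite in_itv.
  near=> h; have h0 : h != 0 by near: h; exact: nbhs_dnbhs_neq.
  have hE : h *: (1 : R) = h by exact: mulr1.
  (* [t] is interior: for small [h] the time [h + t] stays in [[0, T]], and the quotient within the
     interval becomes the ordinary one. *)
  have hs : `|h| <= Num.min (eta / 2) (Num.min t (T - t)).
    by near: h; apply: dnbhs0_le; rewrite !lt_min divr_gt0 // t0 subr_gt0.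
  move: hs; rewrite !le_min => /and3P[h1 h2 h3].
  have thT : h + t \in `[0, T].
    by move: h2 h3; rewrite in_itv /= !ler_norml => /andP[? ?] /andP[? ?]; apply/andP; split; lra.
  have := H (h + t) _ _ thT; rewrite /= hE addrK !int_psi //; apply.
    rewrite /ball /= opprD addrCA subrr addr0 normrN (le_lt_trans h1) //.
    by rewrite ltr_pdivrMr // ltr_pMr // ltr1n.
  by rewrite -subr_eq0 addrK.
split; last exact: cvg_lim lim'.
by apply/cvg_ex; eexists; exact: lim'.
Unshelve. all: by end_near. Qed.

(** The derivative is known inside the interval and continuity up to its ends, which is what the
    mean value theorem asks; thus steps may start at time 0 and end at [T]. *)
Lemma weak_MVT phi s t : weak_solution -> Cinf phi -> 0 <= s -> s < t -> t <= T ->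
  exists2 x, s < x < t & \int[mu t]_x phi x - \int[mu s]_x phi x =
    (t - s) * \int[mu x]_y transport x phi y.
Proof.
move=> [cm cont der] cphi s0 st tT.
pose m u := \int[mu u]_x phi x; pose dm u := \int[mu u]_y transport u phi y.
have dmE u : u \in `]s, t[ -> is_derive u (1 : R) m (dm u).
  rewrite in_itv /= => /andP[su ut]; apply: der => //.
  by rewrite in_itv /= (le_lt_trans s0 su) (lt_le_trans ut tT).
have cm' : {within `[s, t], continuous m}.
  apply: continuous_subspaceW (cont phi (Cinf_loclip cphi)).
  by apply: subset_itv; rewrite bnd_simp.
have [x xst E] := MVT st dmE cm'.
by exists x; [move: xst; rewrite in_itv|rewrite -/(m t) -/(m s) E mulrC].
Qed.

End Solutions.

(** * Test functions with Lipschitz gradient, pulled back along a step *)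

Section TestClass.
Context {R : realType} {d : nat}.
Implicit Types (f g phi : 'rV[R]_d -> R) (x y w : 'rV[R]_d) (H h L : R).

(** [H] is kept apart from the normalized Lipschitz constant because it enters only errors of second
    order in the step length. *)
Definition test_class H phi := [/\ Cinf phi, forall x y, `|phi x - phi y| <= `|x - y| &
  forall i x y, `|partial i phi x - partial i phi y| <= H * `|x - y|].

Lemma deriveB_dir phi x w w' : Cinf phi ->
  'D_w phi x - 'D_w' phi x = 'D_(w - w') phi x.
Proof.
move=> cphi; rewrite !deriveEpartial; try exact: Cinf_diff.
by rewrite -sumrB; apply: eq_bigr => i _; rewrite !mxE mulrBl.
Qed.

Lemma test_class_derive_le H phi x w : test_class H phi -> `|'D_w phi x| <= `|w|.
Proof.
move=> [cphi lip _]; rewrite -[leRHS]mul1r; apply: derive_le; first exact: Cinf_diff.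
by move=> y z; rewrite mul1r.
Qed.

Lemma test_class_derive_dist H phi x y w : 0 <= H -> test_class H phi ->
  `|'D_w phi x - 'D_w phi y| <= (\sum_i `|w 0 i|) * (H * `|x - y|).
Proof.
move=> H0 [cphi _ pH]; rewrite !deriveEpartial; try exact: Cinf_diff.
rewrite -sumrB mulr_suml (le_trans (ler_norm_sum _ _ _)) //; apply: ler_sum => i _.
by rewrite -mulrBr normrM ler_wpM2l.
Qed.

Lemma sum_coord_le w : \sum_i `|w 0 i| <= d%:R * `|w|.
Proof.
have -> : d%:R * `|w| = \sum_(i < d) `|w| by rewrite sumr_const card_ord mulr_natl.
by apply: ler_sum => i _; exact: le_coord_norm.
Qed.

Lemma test_class_taylor H phi x w : 0 <= H -> test_class H phi ->
  `|phi (x + w) - phi x - 'D_w phi x| <= d%:R * H * `|w| ^+ 2.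
Proof.
move=> H0 tphi; have [cphi _ _] := tphi.
have [c /andP[c0 c1] ->] := segment_MVT x w (fun z => Cinf_diff z cphi).
rewrite (le_trans (test_class_derive_dist _ _ _ H0 tphi)) //.
have -> : d%:R * H * `|w| ^+ 2 = (d%:R * `|w|) * (H * `|w|) by ring.
rewrite ler_pM ?sum_coord_le //; first by apply: sumr_ge0.
  by rewrite mulr_ge0.
rewrite ler_wpM2l // [x + _]addrC addrK normrZ gtr0_norm //.
by rewrite ler_piMl // ltW.
Qed.

Lemma CinfZ (c : R) f : Cinf f -> Cinf (fun x => c * f x).
Proof. by move=> cf; apply: CinfM => //; exact: Cinf_cst. Qed.

Lemma partialZ (c : R) f i x : Cinf f -> partial i (fun y => c * f y) x = c * partial i f x.
Proof.
by move=> cf; rewrite partialM //; [rewrite partial_cst mulr0 addr0|exact: Cinf_cst].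
Qed.

Lemma test_class_scale H l f : 0 < l -> Cinf f ->
  (forall x y, `|f x - f y| <= l * `|x - y|) ->
  (forall i x y, `|partial i f x - partial i f y| <= l * (H * `|x - y|)) ->
  test_class H (fun x => l^-1 * f x).
Proof.
move=> l0 cf lip pH; split=> [|x y|i x y]; first exact: CinfZ.
- by rewrite -mulrBr normrM gtr0_norm ?invr_gt0 // ler_pdivrMl.
- by rewrite !partialZ // -mulrBr normrM gtr0_norm ?invr_gt0 // ler_pdivrMl.
Qed.

Lemma norm_delta_le (i : 'I_d) : `|delta_mx 0 i : 'rV[R]_d| <= 1.
Proof.
by apply: norm_row_le => // j; rewrite mxE; case: (_ && _); rewrite ?normr1 ?normr0.
Qed.

(** By the chain rule each partial derivative of the pullback is a derivative of [phi] along a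
    column of 1 + h Du. Its Lipschitz constant is at most h H + (1 + h d L)(1 + h L) H: the first
    term uses that the gradient of [u] is [H]-Lipschitz, and [h * L <= 1] absorbs the h^2 term.
    Dividing by the resulting factor restores the class with the same [H]. *)
Lemma test_class_flow H h L phi (u : 'rV[R]_d -> 'rV[R]_d) : 0 <= H -> 0 <= h -> 0 <= L ->
  h * L <= 1 -> test_class H phi -> (forall i, Cinf (fun x => u x 0 i)) ->
  (forall i x y, `|u x 0 i - u y 0 i| <= L * `|x - y|) ->
  (forall i j x y, `|partial j (fun z => u z 0 i) x - partial j (fun z => u z 0 i) y|
      <= H * `|x - y|) ->
  test_class H (fun x => (1 + h * (1 + L + 2 * d%:R * L))^-1 * phi (x + h *: u x)).
Proof.
move=> H0 h0 L0 hL tphi cu lipu pu; have [cphi lip pH] := tphi.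
set k := 1 + L + _; have k0 : 0 <= k by rewrite !addr_ge0 // !mulr_ge0.
pose Phi x := x + h *: u x.
have cPhi i : Cinf (fun x => Phi x 0 i).
  have -> : (fun x => Phi x 0 i) = (fun x => x 0 i + h * u x 0 i).
    by apply/funext => x; rewrite !mxE.
  by apply: CinfD; [exact: Cinf_coord|exact: CinfZ].
have pPhi i j x : partial j (fun z => Phi z 0 i) x =
    (j == i)%:R + h * partial j (fun z => u z 0 i) x.
  have -> : (fun x => Phi x 0 i) = (fun x => x 0 i + h * u x 0 i).
    by apply/funext => z; rewrite !mxE.
  by rewrite partialD ?partialZ ?partial_coord //; [exact: Cinf_coord|exact: CinfZ].
have lipPhi x y : `|Phi x - Phi y| <= (1 + h * L) * `|x - y|.
  have -> : Phi x - Phi y = (x - y) + h *: (u x - u y).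
    by rewrite /Phi scalerBr opprD addrACA.
  rewrite (le_trans (ler_normD _ _)) // mulrDl mul1r lerD2l normrZ ger0_norm // -mulrA.
  rewrite ler_wpM2l //; apply: norm_row_le; first by rewrite mulr_ge0.
  by move=> i; rewrite !mxE.
have cpsi : Cinf (fun x => phi (Phi x)) 
  by move=> n; apply: (@Ck_comp _ _ n phi Phi) => // i; exact: cPhi.
have dPhi x : differentiable Phi x by apply: differentiable_row => i; exact: Cinf_diff.
pose w j x : 'rV[R]_d := \row_i partial j (fun z => Phi z 0 i) x.
have ppsi j x : partial j (fun y => phi (Phi y)) x = 'D_(w j x) phi (Phi x).
  rewrite deriveEpartial; last exact: Cinf_diff.
  rewrite [LHS](derive_comp_row (f := phi) _ (dPhi x)); last exact: Cinf_diff.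
  by apply: eq_bigr => i _; rewrite mxE.
apply: test_class_scale => //; first by rewrite ltr_pwDl // mulr_ge0.
  move=> x y; rewrite (le_trans (lip _ _)) // (le_trans (lipPhi _ _)) //.
  rewrite ler_wpM2r // lerD2l ler_wpM2l // /k -addrA addrCA lerDl.
  by rewrite addr_ge0 // !mulr_ge0.
move=> j x y; rewrite !ppsi.
have -> : 'D_(w j x) phi (Phi x) - 'D_(w j y) phi (Phi y) =
  ('D_(w j x) phi (Phi x) - 'D_(w j y) phi (Phi x)) +
  ('D_(w j y) phi (Phi x) - 'D_(w j y) phi (Phi y)) by rewrite addrA subrK.
have b1 : `|'D_(w j x) phi (Phi x) - 'D_(w j y) phi (Phi x)| <= h * (H * `|x - y|).
  rewrite (deriveB_dir (Phi x) (w j x) (w j y) cphi) (le_trans (test_class_derive_le _ _ tphi)) //; apply: norm_row_le.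
    by rewrite !mulr_ge0.
  move=> i; rewrite !mxE !pPhi opprD addrACA subrr add0r -mulrBr normrM ger0_norm //.
  by rewrite ler_wpM2l.
have b2 : \sum_i `|w j y 0 i| <= 1 + h * (d%:R * L).
  have hd i : `|w j y 0 i| <= (i == j)%:R + h * L.
    rewrite mxE pPhi eq_sym (le_trans (ler_normD _ _)) // normr_nat lerD2l.
    rewrite normrM ger0_norm // ler_wpM2l //.
    rewrite (@le_trans _ _ (L * `|delta_mx 0 j : 'rV[R]_d|)) //.
      by apply: derive_le => //; exact: Cinf_diff.
    by rewrite ler_piMr // norm_delta_le.
  rewrite (le_trans (ler_sum _ (fun i _ => hd i))) // big_split /=.
  rewrite lerD //.
    rewrite (bigD1 j) //= eqxx big1 ?addr0 // => i /negPf ->; by [].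
  by rewrite sumr_const card_ord -[_ *+ d]mulr_natl mulrCA.
have b3 : `|'D_(w j y) phi (Phi x) - 'D_(w j y) phi (Phi y)| <=
    (1 + h * (d%:R * L)) * (H * ((1 + h * L) * `|x - y|)).
  rewrite (le_trans (test_class_derive_dist _ _ _ H0 tphi)) // ler_pM //.
  - exact: sumr_ge0.
  - by rewrite mulr_ge0.
  - by rewrite ler_wpM2l.
apply: le_trans (ler_normD _ _) _; apply: le_trans (lerD b1 b3) _.
have -> : h * (H * `|x - y|) + (1 + h * (d%:R * L)) * (H * ((1 + h * L) * `|x - y|)) =
  (h + (1 + h * (d%:R * L)) * (1 + h * L)) * (H * `|x - y|) by ring.
rewrite ler_wpM2r ?mulr_ge0 //.
have : h * (d%:R * L) * (h * L) <= h * (d%:R * L) * 1 by rewrite ler_wpM2l // !mulr_ge0.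
rewrite /k; set dL := d%:R * L; have -> : 2 * d%:R * L = 2 * dL by rewrite /dL mulrA.
lra.
Qed.

(* The dual form of [W1 m n <= c], for the sup norm and test functions that are
   Lipschitz on the ball only.  It follows from [W1 m n <= c]; the converse
   (Kantorovich-Rubinstein duality) is never needed. *)
Definition dual_le r (c : R) (m n : probability (Rd R d) R) := forall f, loclip f ->
  forall L, 0 <= L -> lip_on r L f -> `|\int[m]_y f y - \int[n]_y f y| <= L * c.

End TestClass.

Lemma dist_trans3 (R : realDomainType) (x y x' y' e1 e2 e3 : R) :
  `|x - y| <= e1 -> `|x' - y'| <= e2 -> `|x - x'| <= e3 -> `|y - y'| <= e3 + e1 + e2.
Proof.
by rewrite !ler_norml => /andP[? ?] /andP[? ?] /andP[? ?]; apply/andP; split; lra.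
Qed.

Lemma le_eps (R : realFieldType) (A B : R) : (forall e, 0 < e -> A <= B + e) -> A <= B.
Proof. by move=> h; apply/ler_addgt0Pr. Qed.

(** * Stability by Euler steps and discrete Gronwall *)

Section Stability.
Context {R : realType} {d : nat}.
Variables (T : R) (a : R -> R) (r V L : R).
Hypothesis (ka : kernel a) (V0 : 0 <= V) (L0 : 0 <= L).
Hypothesis Fbound : forall (i : 'I_d) z, eball (2 * r) z -> `|Fcoord a i z| <= V.
Hypothesis Flip : forall i : 'I_d, lip_on (2 * r) L (Fcoord a i).
Implicit Types (mu nu : R -> probability (Rd R d) R) (f phi : 'rV[R]_d -> R).
Implicit Types (x y : 'rV[R]_d) (s t h H : R).

Definition velocity mu t x : 'rV[R]_d := \row_i conv (Fcoord a i) (mu t) x.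

Lemma transportE mu t phi x : Cinf phi -> transport a mu t phi x = 'D_(velocity mu t x) phi x.
Proof.
move=> cphi; rewrite deriveEpartial; last exact: Cinf_diff.
by apply: eq_bigr => i _; rewrite mxE mulrC.
Qed.

Section OneSolution.
Variable mu : R -> probability (Rd R d) R.
Hypothesis sol : weak_solution T a r mu.

Let cmu t : t \in `[0, T] -> concentrated r (mu t).
Proof. by have [h _ _] := sol; exact: h. Qed.

Lemma velocity_bound t x : t \in `[0, T] -> eball r x -> `|velocity mu t x| <= V.
Proof.
move=> /cmu ct xr; apply: norm_row_le => // i; rewrite mxE.
by apply: (conv_bound ct) => //; [exact: loclip_Fcoord|exact: Fbound].
Qed.

Lemma velocity_lip t x y : t \in `[0, T] -> eball r x -> eball r y ->
  `|velocity mu t x - velocity mu t y| <= L * `|x - y|.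
Proof.
move=> /cmu ct xr yr; apply: norm_row_le => [|i]; first exact: mulr_ge0.
rewrite !mxE; exact: (conv_lip ct L0 (loclip_Fcoord i ka) (Flip i)).
Qed.

Lemma weak_time_lip_smooth phi (C : R) s t : 0 <= C -> Cinf phi ->
  (forall x y, `|phi x - phi y| <= C * `|x - y|) ->
  0 <= s -> s <= t -> t <= T ->
  `|\int[mu t]_x phi x - \int[mu s]_x phi x| <= C * V * (t - s).
Proof.
move=> C0 cphi lip s0 st tT; move: st; rewrite le_eqVlt => /predU1P[->|st].
  by rewrite !subrr normr0 mulr0.
have [u /andP[su ut] ->] := weak_MVT sol cphi s0 st tT.
have uT : u \in `[0, T].
  by rewrite in_itv /= (le_trans s0 (ltW su)) (le_trans (ltW ut) tT).
rewrite normrM gtr0_norm ?subr_gt0 // mulrC ler_wpM2r ?subr_ge0 ?(ltW st) //.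
apply: (Rintegral_norm_le (cmu uT)); first exact: mulr_ge0.
  by apply: loclip_continuous; apply: loclip_transport => //; exact: cmu.
move=> x xr; rewrite transportE //.
have := derive_le (velocity mu u x) (Cinf_diff x cphi) lip; move/le_trans; apply.
by rewrite ler_wpM2l // velocity_bound.
Qed.

(** The smooth approximation on the ball multiplies the Lipschitz constant by [d], hence [d%:R * V]
    in place of [V]. *)
Lemma weak_time_lip s t : 0 <= s -> s <= t -> t <= T ->
  dual_le r (d%:R * V * (t - s)) (mu t) (mu s).
Proof.
move=> s0 st tT f lf C C0 fC; apply: le_eps => e e0.
have tI : t \in `[0, T] by rewrite in_itv /= (le_trans s0 st).
have sI : s \in `[0, T] by rewrite in_itv /= s0 (le_trans st).
have e2 : 0 < e / 2 by rewrite divr_gt0.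
have [H H0 /(_ f fC) [P [cP lipP _ Pf]]] := smooth_approx (@eball_compact R d r) C0 e2.
have cf := loclip_continuous lf; have cP' := Cinf_continuous cP.
have h1 := cRintegral_dist (cmu tI) cP' cf (ltW e2) Pf.
have h2 := cRintegral_dist (cmu sI) cP' cf (ltW e2) Pf.
have dC0 : 0 <= d%:R * C by rewrite mulr_ge0.
have h3 := weak_time_lip_smooth dC0 cP lipP s0 st tT.
rewrite (le_trans (dist_trans3 h1 h2 h3)) // -addrA -splitr lerD2r.
by rewrite (_ : d%:R * C * V * (t - s) = C * (d%:R * V * (t - s))) //; ring.
Qed.

Lemma velocity_time_lip s t x : 0 <= s -> s <= t -> t <= T -> eball r x ->
  `|velocity mu t x - velocity mu s x| <= L * (d%:R * V * (t - s)).
Proof.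
move=> s0 st tT xr.
have tI : t \in `[0, T] by rewrite in_itv /= (le_trans s0 st).
have sI : s \in `[0, T] by rewrite in_itv /= s0 (le_trans st).
have c0 : 0 <= d%:R * V * (t - s) by rewrite !mulr_ge0 // subr_ge0.
apply: norm_row_le => [|i]; first exact: mulr_ge0.
rewrite !mxE; apply: (conv_dist (cmu tI) (cmu sI)) => //.
- exact: loclip_Fcoord.
- exact: weak_time_lip.
Qed.

(** The three second-order errors of a step: change of the velocity in time, change of the measure
    in time tested against the transport term, Taylor remainder. *)
Definition euler_const H : R :=
  d%:R * L * V + d%:R * (L + d%:R * V * H) * V + d%:R * H * V ^+ 2.

Lemma euler_const_ge0 H : 0 <= H -> 0 <= euler_const H.
Proof. by move=> H0; rewrite !addr_ge0 // !mulr_ge0 // addr_ge0 // !mulr_ge0. Qed.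

Lemma euler_step H phi t h (u : 'rV[R]_d -> 'rV[R]_d) eta :
  0 <= H -> test_class H phi -> 0 <= t -> 0 < h -> t + h <= T -> 0 <= eta ->
  continuous (fun x => phi (x + h *: u x)) ->
  (forall x, eball r x -> `|u x - velocity mu t x| <= eta) ->
  `|\int[mu (t + h)]_x phi x - \int[mu t]_x phi (x + h *: u x)| <=
    h * (eta + euler_const H * h).
Proof.
move=> H0 tphi t0 h0 thT eta0 cu uv; have [cphi lip pH] := tphi.
have t_th : t < t + h by rewrite ltrDl.
have tI : t \in `[0, T] by rewrite in_itv /= t0 (le_trans (ltW t_th)).
have [xi /andP[txi xith] E] := weak_MVT sol cphi t0 t_th thT.
rewrite addrAC subrr add0r in E.
have xi0 : 0 <= xi by rewrite (le_trans t0) // ltW.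
have xiT : xi <= T by rewrite (le_trans (ltW xith)).
have xiI : xi \in `[0, T] by rewrite in_itv /= xi0.
have xih : xi - t <= h by rewrite lerBlDl ltW.
have ct := cmu tI; have cxi := cmu xiI.
have lt' s : s \in `[0, T] -> loclip (transport a mu s phi).
  by move=> sI; apply: loclip_transport => //; exact: cmu.
have A1 : `|\int[mu xi]_x transport a mu xi phi x - \int[mu xi]_x transport a mu t phi x|
    <= d%:R * L * V * h.
  apply: (cRintegral_dist cxi); [exact/loclip_continuous/lt'|exact/loclip_continuous/lt'| |].
    by rewrite !mulr_ge0 // ltW.
  move=> x xr; rewrite !transportE // deriveB_dir // (le_trans (test_class_derive_le _ _ tphi)) //.
  rewrite (le_trans (velocity_time_lip t0 (ltW txi) xiT xr)) //.
  have -> : d%:R * L * V * h = L * (d%:R * V * h) by ring.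
  by rewrite ler_wpM2l // ler_wpM2l // mulr_ge0.
have A2 : `|\int[mu xi]_x transport a mu t phi x - \int[mu t]_x transport a mu t phi x|
    <= d%:R * (L + d%:R * V * H) * V * h.
  have K0 : 0 <= L + d%:R * V * H by rewrite addr_ge0 // !mulr_ge0.
  have := weak_time_lip t0 (ltW txi) xiT (lt' _ tI) K0 _.
  move=> tl; apply: (le_trans (tl _)); last first.
    rewrite (_ : d%:R * (L + d%:R * V * H) * V * h = (L + d%:R * V * H) * (d%:R * V * h)); last by ring.
    by rewrite ler_wpM2l // ler_wpM2l // mulr_ge0.
  move=> x y xr yr; rewrite !transportE //.
  have -> : 'D_(velocity mu t x) phi x - 'D_(velocity mu t y) phi y =
    ('D_(velocity mu t x) phi x - 'D_(velocity mu t y) phi x) +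
    ('D_(velocity mu t y) phi x - 'D_(velocity mu t y) phi y) by rewrite addrA subrK.
  have B1 : `|'D_(velocity mu t x) phi x - 'D_(velocity mu t y) phi x| <= L * `|x - y|.
    rewrite (deriveB_dir x (velocity mu t x) (velocity mu t y) cphi).
    by rewrite (le_trans (test_class_derive_le _ _ tphi)) // velocity_lip.
  have B2 : `|'D_(velocity mu t y) phi x - 'D_(velocity mu t y) phi y| <= d%:R * V * H * `|x - y|.
    rewrite (le_trans (test_class_derive_dist _ _ _ H0 tphi)) // -[leRHS]mulrA.
    rewrite ler_wpM2r ?mulr_ge0 // (le_trans (sum_coord_le _)) //.
    by rewrite ler_wpM2l // velocity_bound.
  by apply: le_trans (ler_normD _ _) _; rewrite mulrDl; exact: lerD.
have A3 : `|\int[mu t]_x (phi (x + h *: u x) - phi x) - \int[mu t]_x (h * transport a mu t phi x)|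
    <= h * eta + d%:R * H * V ^+ 2 * h ^+ 2.
  have cB : continuous (fun x => phi (x + h *: u x) - phi x).
    by move=> x; apply: continuousB; [exact: cu|exact: Cinf_continuous].
  have cZ : continuous (fun x => h * transport a mu t phi x).
    by apply/loclip_continuous/loclipM; [exact: loclip_cst|exact: lt'].
  apply: (cRintegral_dist ct cB cZ).
    by rewrite addr_ge0 // ?mulr_ge0 // ?sqr_ge0 // ltW.
  move=> x xr; rewrite transportE //.
  have -> : h * 'D_(velocity mu t x) phi x = 'D_(h *: velocity mu t x) phi x.
    rewrite !deriveEpartial; try exact: Cinf_diff.
    by rewrite mulr_sumr; apply: eq_bigr => i _; rewrite !mxE mulrA.
  have B1 : `|phi (x + h *: u x) - phi (x + h *: velocity mu t x)| <= h * eta.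
    rewrite (le_trans (lip _ _)) // opprD addrACA subrr add0r -scalerBr normrZ gtr0_norm //.
    by rewrite ler_wpM2l ?(ltW h0) // uv.
  have B2 : `|phi (x + h *: velocity mu t x) - phi x - 'D_(h *: velocity mu t x) phi x| <=
      d%:R * H * V ^+ 2 * h ^+ 2.
    rewrite (le_trans (test_class_taylor _ _ H0 tphi)) // -[leRHS]mulrA.
    rewrite ler_wpM2l ?mulr_ge0 // normrZ gtr0_norm // exprMn mulrC.
    by rewrite ler_wpM2r ?sqr_ge0 // lerXn2r ?nnegrE // velocity_bound.
  have -> : phi (x + h *: u x) - phi x - 'D_(h *: velocity mu t x) phi x =
    (phi (x + h *: u x) - phi (x + h *: velocity mu t x)) +
    (phi (x + h *: velocity mu t x) - phi x - 'D_(h *: velocity mu t x) phi x).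
    by rewrite !addrA subrK.
  by rewrite (le_trans (ler_normD _ _)) // lerD.
have E3 : \int[mu t]_x (phi (x + h *: u x) - phi x) =
    \int[mu t]_x phi (x + h *: u x) - \int[mu t]_x phi x.
  by apply: (cRintegralB ct) => //; exact: Cinf_continuous.
have E4 : \int[mu t]_x (h * transport a mu t phi x) = h * \int[mu t]_x transport a mu t phi x.
  by apply: (cRintegralZ ct); apply: loclip_continuous; exact: lt'.
rewrite E3 E4 in A3.
set J := \int[mu t]_x transport a mu t phi x in A2 A3.
set I1 := \int[mu xi]_x transport a mu xi phi x in E A1.
set I2 := \int[mu xi]_x transport a mu t phi x in A1 A2.
set Pth := \int[mu (t + h)]_x phi x in E *.
set Pt := \int[mu t]_x phi x in E A3.
set U := \int[mu t]_x phi _ in A3 *.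
have {}A12 : `|h * I1 - h * J| <= h * ((d%:R * L * V + d%:R * (L + d%:R * V * H) * V) * h).
  rewrite -mulrBr normrM gtr0_norm // ler_wpM2l ?(ltW h0) // mulrDl.
  have -> : I1 - J = (I1 - I2) + (I2 - J) by rewrite addrA subrK.
  by apply: le_trans (ler_normD _ _) _; exact: lerD.
have -> : h * (eta + euler_const H * h) =
  h * ((d%:R * L * V + d%:R * (L + d%:R * V * H) * V) * h) + (h * eta + d%:R * H * V ^+ 2 * h ^+ 2).
  by rewrite /euler_const; ring.
move: E A12 A3; set X := h * (_ * h); set Y := h * eta + _.
move: (h * I1) (h * J) => hI hJ E; clear -E.
rewrite !ler_norml => /andP[? ?] /andP[? ?]; apply/andP; split; lra.
Qed.

End OneSolution.

(* Gronwall's lemma for explicit Euler steps of length [h = t / n]; smooth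
   test functions with [H]-Lipschitz gradient are stable under one step. *)
Lemma test_class_stability : exists2 k, 0 <= k &
  forall mu nu, weak_solution T a r mu -> weak_solution T a r nu ->
  forall delta, 0 < delta -> exists2 H0, 0 <= H0 &
    forall H, H0 <= H -> forall A0, 0 <= A0 -> (forall phi, test_class H phi ->
        `|\int[mu 0]_x phi x - \int[nu 0]_x phi x| <= A0) ->
      forall t, t \in `[0, T] -> forall phi, test_class H phi ->
        `|\int[mu t]_x phi x - \int[nu t]_x phi x| <= expR (k * t) * (A0 + t * (4 * delta)).
Proof.
(* [k0] is the growth rate in [test_class_flow] for fields of Lipschitz constant [d L]. Division by
   [l] brings the smooth approximation of an [L]-Lipschitz function into the test class; this bounds
   the difference of the two velocities by the difference of the measures. *)
pose l := d%:R * L + 1; pose k0 := 1 + d%:R * L + 2 * d%:R * (d%:R * L).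
have l0 : 0 < l by rewrite ltr_wpDl // mulr_ge0.
have dL0 : 0 <= d%:R * L by rewrite mulr_ge0.
have k00 : 0 <= k0 by rewrite !addr_ge0 // !mulr_ge0.
exists (k0 + l); first by rewrite addr_ge0 // ltW.
move=> mu nu smu snu delta delta0.
have [H1 H10 approx1] := smooth_approx (@eball_compact R d r) L0 delta0.
exists H1 => // H HH A0 A00 hA0; have H0 := le_trans H10 HH.
have approx f : lip_on r L f -> exists P, [/\ Cinf P,
    forall x y, `|P x - P y| <= d%:R * L * `|x - y|,
    forall i x y, `|partial i P x - partial i P y| <= H * `|x - y| &
    forall x, eball r x -> `|P x - f x| <= delta].
  move=> /approx1 [P [cP lipP pP Pf]]; exists P; split=> // i x y.
  by rewrite (le_trans (pP _ _ _)) // ler_wpM2r.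
have [cmu _ _] := smu; have [cnu _ _] := snu.
(* Both measures are pushed along the same field [U], at distance [delta] from the velocity of [mu]
   and [l A + 3 delta] from that of [nu]; the two errors give [4 * delta] and the rate [l], and
   pulling [phi] back gives [k0]. *)
have step t h A : 0 <= t -> 0 < h -> t + h <= T -> h * (d%:R * L) <= 1 -> 0 <= A ->
    (forall phi, test_class H phi -> `|\int[mu t]_x phi x - \int[nu t]_x phi x| <= A) ->
    forall phi, test_class H phi ->
      `|\int[mu (t + h)]_x phi x - \int[nu (t + h)]_x phi x| <=
        (1 + h * (k0 + l)) * A + h * (4 * delta + 2 * euler_const H * h).
  move=> t0 h0 thT hL A1 hA phi tphi; have [cphi _ _] := tphi.
  have tI : t \in `[0, T] by rewrite in_itv /= t0 (le_trans _ thT) // lerDl ltW.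
  have vlip (i : 'I_d) : lip_on r L (conv (Fcoord a i) (mu t)).
    by apply: (conv_lip (cmu _ tI)) => //; exact: loclip_Fcoord.
  have /choice [u hu] (i : 'I_d) := approx _ (vlip i).
  pose U x : 'rV[R]_d := \row_i u i x.
  have Ui i : (fun x => U x 0 i) = u i by apply/funext => x; rewrite mxE.
  have cU : continuous (fun x => phi (x + h *: U x)).
    apply: Cinf_continuous => n; apply: (@Ck_comp _ _ n phi (fun x => x + h *: U x)) => // i.
    have -> : (fun x => (x + h *: U x) 0 i) = (fun x => x 0 i + h * u i x).
      by apply/funext => x; rewrite !mxE.
    by apply: CkD; [exact: Ck_coord|apply: CinfZ; case: (hu i)].
  have Uv x : eball r x -> `|U x - velocity mu t x| <= delta.
    move=> xr; apply: norm_row_le => [|i]; first exact: ltW.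
    by rewrite !mxE; have [_ _ _] := hu i; exact.
  have dual f : loclip f -> lip_on r L f ->
      `|\int[mu t]_x f x - \int[nu t]_x f x| <= l * A + 2 * delta.
    move=> lf fL; have [P [cP lipP pP Pf]] := approx f fL.
    have cf := loclip_continuous lf; have cP' := Cinf_continuous cP.
    have h1 := cRintegral_dist (cmu _ tI) cP' cf (ltW delta0) Pf.
    have h2 := cRintegral_dist (cnu _ tI) cP' cf (ltW delta0) Pf.
    have tP : test_class H (fun x => l^-1 * P x).
      apply: test_class_scale => // [x y|i x y].
        by rewrite (le_trans (lipP _ _)) // ler_wpM2r // lerDl.
      rewrite (le_trans (pP _ _ _)) // ler_peMl ?mulr_ge0 //.
      by rewrite lerDr.
    have := hA _ tP; rewrite (cRintegralZ (cmu _ tI)) // (cRintegralZ (cnu _ tI)) //.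
    rewrite -mulrBr normrM gtr0_norm ?invr_gt0 // ler_pdivrMl //.
    move=> h3; rewrite (le_trans (dist_trans3 h1 h2 h3)) //.
    by rewrite -addrA -mulr2n mulr_natl.
  have velE x : eball r x -> `|U x - velocity nu t x| <= l * A + 3 * delta.
    move=> xr; have lA0 : 0 <= l * A by rewrite mulr_ge0 // ltW.
    have h1 := Uv x xr.
    have h2 : `|velocity mu t x - velocity nu t x| <= l * A + 2 * delta.
      apply: norm_row_le => [|i]; first by rewrite addr_ge0 // mulr_ge0 // ltW.
      rewrite !mxE; apply: dual; first by apply: loclip_shift; exact: loclip_Fcoord.
      exact: lip_on_shift.
    have -> : U x - velocity nu t x =
      (U x - velocity mu t x) + (velocity mu t x - velocity nu t x) by rewrite addrA subrK.
    rewrite (le_trans (ler_normD _ _)) // (le_trans (lerD h1 h2)) //.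
    have arith (p q : R) : p + (q + 2 * p) <= q + 3 * p by lra.
    exact: arith.
  have E1 := euler_step smu H0 tphi t0 h0 thT (ltW delta0) cU Uv.
  have eta0 : 0 <= l * A + 3 * delta by rewrite addr_ge0 // mulr_ge0 // ltW.
  have E2 := euler_step snu H0 tphi t0 h0 thT eta0 cU velE.
  have tflow := @test_class_flow _ _ H h (d%:R * L) phi U H0 (ltW h0) dL0 hL tphi _ _ _.
  have hk : 0 < 1 + h * k0 by rewrite ltr_pwDl // mulr_ge0 // ltW.
  have E3 : `|\int[mu t]_x phi (x + h *: U x) - \int[nu t]_x phi (x + h *: U x)| <=
      (1 + h * k0) * A.
    have : test_class H (fun x => (1 + h * k0)^-1 * phi (x + h *: U x)).
      apply: tflow => [i|i x y|i j x y]; have [c1 c2 c3 _] := hu i.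
      - by rewrite Ui.
      - by rewrite !mxE.
      - by rewrite Ui.
    move=> /hA; rewrite (cRintegralZ (cmu _ tI)) // (cRintegralZ (cnu _ tI)) //.
    by rewrite -mulrBr normrM gtr0_norm ?invr_gt0 // ler_pdivrMl.
  have -> : (1 + h * (k0 + l)) * A + h * (4 * delta + 2 * euler_const H * h) =
    (1 + h * k0) * A + h * (delta + euler_const H * h) +
    h * (l * A + 3 * delta + euler_const H * h) by ring.
  rewrite distrC in E1; rewrite distrC in E2.
  exact: dist_trans3 E1 E2 E3.
move=> t tI; have /andP[t0 tT] : 0 <= t <= T by move: tI; rewrite in_itv.
move=> phi tphi; move: t0; rewrite le_eqVlt => /predU1P[t0|t0].
  by rewrite -t0 mulr0 expR0 mul0r addr0 mul1r; exact: hA0.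
set k := k0 + l; have kk : 0 <= k by rewrite addr_ge0 // ltW.
have iter n j h : (0 < n)%N -> (j <= n)%N -> h = t / n%:R -> h * (d%:R * L) <= 1 ->
    forall phi, test_class H phi ->
    `|\int[mu (h *+ j)]_x phi x - \int[nu (h *+ j)]_x phi x| <=
      expR (k * (h *+ j)) * (A0 + (h *+ j) * (4 * delta + 2 * euler_const H * h)).
  move=> n0 + hE hL; have h0 : 0 < h by rewrite hE divr_gt0 // ltr0n.
  set E := 4 * delta + _; have E0 : 0 <= E.
    rewrite addr_ge0 // ?mulr_ge0 // ?(ltW delta0) ?(ltW h0) //.
    by rewrite euler_const_ge0.
  elim: j => [_|j IH jn] psi tpsi.
    by rewrite mulr0n mulr0 expR0 mul0r addr0 mul1r; exact: hA0.
  have hj0 : 0 <= h *+ j by rewrite mulrn_wge0 // ltW.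
  have B0 : 0 <= A0 + (h *+ j) * E by rewrite addr_ge0 // mulr_ge0.
  have thT : h *+ j + h <= T.
    rewrite -mulrSr (le_trans _ tT) // hE -[_ *+ j.+1]mulr_natr mulrAC.
    by rewrite ler_pdivrMr ?ltr0n // ler_wpM2l ?(ltW t0) // ler_nat.
  have X0 : 0 <= expR (k * (h *+ j)) * (A0 + (h *+ j) * E) by rewrite mulr_ge0 ?expR_ge0.
  have := step (h *+ j) h _ hj0 h0 thT hL X0 (IH (ltnW jn)) psi tpsi.
  rewrite -/k -/E mulrSr => st; apply: le_trans st _.
  rewrite [k * (_ + _)]mulrDr expRD; set X := expR (k * _); set Y := expR (k * h).
  have X1 : 1 <= X by rewrite -expR0 ler_expR mulr_ge0.
  have Y1 : 1 + h * k <= Y by rewrite mulrC expR_ge1Dx.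
  have Y2 : 1 <= Y by rewrite (le_trans _ Y1) // lerDl mulr_ge0 // ltW.
  have hE0 : 0 <= h * E by rewrite mulr_ge0 // ltW.
  have XY1 : 1 <= X * Y by rewrite -[1]mulr1 ler_pM.
  have -> : X * Y * (A0 + (h *+ j + h) * E) =
    Y * (X * (A0 + h *+ j * E)) + (X * Y) * (h * E) by ring.
  by rewrite lerD // ?ler_wpM2r // ler_peMl.
apply: le_eps => e e0.
(* With [n] steps the second-order errors add up to c / n. The second entry of the maximum makes the
   step short enough for [test_class_flow]. *)
pose c := expR (k * t) * t * (2 * euler_const H) * t.
have c0 : 0 <= c by rewrite !mulr_ge0 ?expR_ge0 ?euler_const_ge0 // ltW.
pose n := maxn (Num.truncn (c / e)).+1 (Num.truncn (t * (d%:R * L))).+1.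
have n0 : (0 < n)%N by rewrite /n leq_max.
have nR : 0 < n%:R :> R by rewrite ltr0n.
have n1 : c / n%:R <= e.
  rewrite ler_pdivrMr // mulrC -ler_pdivrMr // (le_trans (ltW (truncnS_gt _))) //.
  by rewrite ler_nat leq_maxl.
have n2 : t / n%:R * (d%:R * L) <= 1.
  rewrite mulrAC ler_pdivrMr // mul1r (le_trans (ltW (truncnS_gt _))) //.
  by rewrite ler_nat leq_maxr.
have := iter n n (t / n%:R) n0 (leqnn n) erefl n2 phi tphi.
have -> : t / n%:R *+ n = t by rewrite -mulr_natr mulfVK // gt_eqF.
move/le_trans; apply.
have -> : expR (k * t) * (A0 + t * (4 * delta + 2 * euler_const H * (t / n%:R))) =
  expR (k * t) * (A0 + t * (4 * delta)) + c / n%:R by rewrite /c; ring.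
by rewrite lerD2l.
Qed.

Lemma weak_stability : exists2 C, 0 <= C &
  forall mu nu, weak_solution T a r mu -> weak_solution T a r nu ->
  forall A0, 0 <= A0 -> dual_le r A0 (mu 0) (nu 0) ->
    forall t, t \in `[0, T] -> dual_le r (C * A0) (mu t) (nu t).
Proof.
have [k k0 stab] := test_class_stability.
have [T0|T0] := ltP T 0.
  exists 0 => // mu nu _ _ A0 _ _ t; rewrite in_itv /= => /andP[t0 tT].
  by have := le_lt_trans (le_trans t0 tT) T0; rewrite ltxx.
have I0 : 0 \in `[0, T] by rewrite in_itv /= lexx.
pose l : R := d%:R + 1; have l0 : 0 < l by rewrite ltr_wpDl.
exists (l * expR (k * T)); first by rewrite mulr_ge0 ?expR_ge0 // ltW.
move=> mu nu smu snu A0 A00 hA0 t tI f lf M M0 fM.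
have [cmu _ _] := smu; have [cnu _ _] := snu.
have /andP[t0 tT] : 0 <= t <= T by move: tI; rewrite in_itv.
have cf := loclip_continuous lf; apply: le_eps => e e0.
(* For Lipschitz constant 0 the function is constant on the ball and both integrals equal [f 0];
   otherwise [f] is divided by the constant. *)
move: M0; rewrite le_eqVlt => /predU1P[M0|M0].
  have r0 := concentrated_ge0 (cmu _ tI).
  have fE : {in eball r, f =1 (fun=> f 0)}.
    move=> x; rewrite inE => xr; apply/eqP; rewrite -subr_eq0 -normr_le0.
    by rewrite (le_trans (fM _ _ xr _)) -?M0 ?mul0r // /eball /= enorm0.
  have cc : continuous (fun _ : 'rV[R]_d => f 0) by apply: Cinf_continuous; exact: Cinf_cst.
  rewrite (eq_cRintegral (cmu _ tI) cf cc) => [|x xr]; last by rewrite fE ?inE.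
  rewrite (eq_cRintegral (cnu _ tI) cf cc) => [|x xr]; last by rewrite fE ?inE.
  by rewrite !cRintegral_cst subrr normr0 -M0 mul0r add0r ltW.
(* [X] collects the coefficients of [delta] in the final bound, from the steps and from the two
   approximations of [f], so that [X * delta <= e]. *)
pose X := M * (l * expR (k * T) * T * 4 + 2).
have X0 : 0 <= X by rewrite mulr_ge0 ?addr_ge0 // ?mulr_ge0 ?expR_ge0 // ltW.
pose delta := e / (X + 1).
have X1 : 0 < X + 1 by rewrite ltr_wpDl.
have delta0 : 0 < delta by rewrite divr_gt0.
have [H1 H10 hH1] := stab _ _ smu snu _ delta0.
have [H2 H20 approx] := smooth_approx (@eball_compact R d r) ler01 delta0.
(* [test_class_stability] holds for every [H] above its threshold, which leaves room for the
   approximation of [f] in the same class. *)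
pose H := Num.max H1 H2; have H0 : 0 <= H by rewrite le_max H10.
have gM : lip_on r 1 (fun x => M^-1 * f x).
  move=> x y xr yr; rewrite -mulrBr normrM gtr0_norm ?invr_gt0 // ler_pdivrMl // mul1r.
  exact: fM.
have [P [cP lipP pP Pf]] := approx _ gM.
have cg : continuous (fun x => M^-1 * f x).
  by apply/loclip_continuous/loclipM => //; exact: loclip_cst.
have tP : test_class H (fun x => l^-1 * P x).
  apply: test_class_scale => // [x y|i x y].
    by rewrite (le_trans (lipP _ _)) // ler_wpM2r // mulr1 lerDl.
  rewrite (le_trans (pP _ _ _)) // (@le_trans _ _ (H * `|x - y|)) //.
    by rewrite ler_wpM2r // le_max lexx orbT.
  by rewrite ler_peMl ?mulr_ge0 // lerDr.
have H1H : H1 <= H by rewrite le_max lexx.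
have init phi : test_class H phi -> `|\int[mu 0]_x phi x - \int[nu 0]_x phi x| <= A0.
  move=> [cphi lip _]; rewrite -[A0]mul1r; apply: hA0 => //; first exact: Cinf_loclip.
  by move=> x y _ _; rewrite mul1r.
have cP' := Cinf_continuous cP.
have h1 := cRintegral_dist (cmu _ tI) cP' cg (ltW delta0) Pf.
have h2 := cRintegral_dist (cnu _ tI) cP' cg (ltW delta0) Pf.
have := hH1 H H1H A0 A00 init t tI _ tP.
rewrite (cRintegralZ (cmu _ tI)) // (cRintegralZ (cnu _ tI)) //.
rewrite -mulrBr normrM gtr0_norm ?invr_gt0 // ler_pdivrMl // => h3.
have := dist_trans3 h1 h2 h3.
rewrite (cRintegralZ (cmu _ tI)) // (cRintegralZ (cnu _ tI)) //.
rewrite -mulrBr normrM gtr0_norm ?invr_gt0 // ler_pdivrMl // => h4.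
apply: (le_trans h4).
have ekt : expR (k * t) <= expR (k * T) by rewrite ler_expR ler_wpM2l.
have h5 : expR (k * t) * (A0 + t * (4 * delta)) <= expR (k * T) * (A0 + T * (4 * delta)).
  have d40 : 0 <= 4 * delta by rewrite mulr_ge0 // ltW.
  apply: ler_pM => //; first by rewrite addr_ge0 // mulr_ge0.
  by rewrite lerD2l ler_wpM2r.
apply: (@le_trans _ _ (M * (l * (expR (k * T) * (A0 + T * (4 * delta))) + delta + delta))).
  by rewrite ler_wpM2l ?(ltW M0) // !lerD2r ler_wpM2l // ltW.
have -> : M * (l * (expR (k * T) * (A0 + T * (4 * delta))) + delta + delta) =
  M * (l * expR (k * T) * A0) + X * delta by rewrite /X; ring.
rewrite lerD2l /delta mulrCA ler_piMr ?(ltW e0) // ler_pdivrMr // mul1r lerDl //.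
Qed.

End Stability.

(** * The error functional *)

Section ErrorFunctional.
Context {R : realType} {d : nat}.
Variables (a : R -> R) (r : R).
Hypothesis ka : kernel a.
Implicit Types (b : R -> R) (m n : probability (Rd R d) R) (x : 'rV[R]_d).

Definition Gcoord b (i : 'I_d) z := Fcoord b i z - Fcoord a i z.

Definition sqerr b m x := \sum_i conv (Gcoord b i) m x * conv (Gcoord b i) m x.

Definition err b m := \int[m]_x sqerr b m x.

Lemma loclip_Gcoord b i : kernel b -> loclip (Gcoord b i).
Proof. by move=> kb; apply: loclipB; exact: loclip_Fcoord. Qed.

Lemma loclip_sqerr b m : concentrated r m -> kernel b -> loclip (sqerr b m).
Proof.
move=> cm kb; apply: loclip_sum => i.
by apply: loclipM; apply: (loclip_conv cm); exact: loclip_Gcoord.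
Qed.

Lemma sqerrE b m x :
  enorm (convolve (fun z => Fker b z - Fker a z) m x) ^+ 2 = sqerr b m x.
Proof.
rewrite enorm_sqr; apply: eq_bigr => i _; rewrite expr2 /convolve mxE.
by congr (_ * _); apply: eq_Rintegral => y _; rewrite /Gcoord /Fcoord !mxE.
Qed.

Lemma sqerr_ge0 b m x : 0 <= sqerr b m x.
Proof. by apply: sumr_ge0 => i _; rewrite -expr2 sqr_ge0. Qed.

Lemma err_ge0 b m : 0 <= err b m.
Proof. by apply: Rintegral_ge0 => x _; exact: sqerr_ge0. Qed.

Lemma errE b m : concentrated r m -> kernel b ->
  (\int[m]_x ((enorm (convolve (fun z => Fker b z - Fker a z) m x)) ^+ 2)%:E)%E =
  (err b m)%:E.
Proof.
move=> cm kb; under eq_integral do rewrite sqerrE.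
rewrite /err /Rintegral fineK //; apply: integrable_fin_num => //.
by apply: (concentrated_integrable cm); apply: loclip_continuous; exact: loclip_sqerr.
Qed.

(** The measure occurs in the convolution and as the outer measure. They are exchanged one at a
    time; each exchange of a square costs 2 V L per coordinate. *)
Lemma err_dist b m n V L c : concentrated r m -> concentrated r n -> kernel b ->
  0 <= V -> 0 <= L -> 0 <= c ->
  (forall i z, eball (2 * r) z -> `|Gcoord b i z| <= V) ->
  (forall i, lip_on (2 * r) L (Gcoord b i)) -> dual_le r c m n ->
  `|err b m - err b n| <= d%:R * (4 * V * L) * c.
Proof.
move=> cm cn kb V0 L0 c0 GV GL mn.
have lG i : loclip (Gcoord b i) by exact: loclip_Gcoord.
have cs q : concentrated r q -> continuous (sqerr b q).
  by move=> cq; apply: loclip_continuous; exact: loclip_sqerr.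
have sum_cst (k : R) : \sum_(i < d) k = d%:R * k by rewrite sumr_const card_ord mulr_natl.
have h1 : `|\int[m]_x sqerr b m x - \int[n]_x sqerr b m x| <= d%:R * (2 * V * L) * c.
  apply: mn; [exact: loclip_sqerr|by rewrite !mulr_ge0|].
  move=> x y xr yr; rewrite -sumrB (le_trans (ler_norm_sum _ _ _)) //.
  rewrite -sum_cst mulr_suml; apply: ler_sum => i _.
  have -> : 2 * V * L = V * L + V * L by ring.
  have cl : lip_on r L (conv (Gcoord b i) m) by exact: (conv_lip cm).
  have cb z : eball r z -> `|conv (Gcoord b i) m z| <= V.
    by apply: (conv_bound cm) => // w; exact: GV.
  exact: (lip_onM cl cl cb cb).
have h2 : `|\int[n]_x sqerr b m x - \int[n]_x sqerr b n x| <= d%:R * (2 * V * L) * c.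
  apply: (cRintegral_dist cn); [exact: cs|exact: cs|by rewrite !mulr_ge0|].
  move=> x xr; rewrite -sumrB (le_trans (ler_norm_sum _ _ _)) //.
  rewrite -sum_cst mulr_suml; apply: ler_sum => i _.
  rewrite -!expr2 subr_sqr normrM [leRHS](_ : _ = (L * c) * (V + V)); last by ring.
  apply: ler_pM => //; first exact: (conv_dist cm cn).
  have bd q : concentrated r q -> `|conv (Gcoord b i) q x| <= V.
    by move=> cq; apply: (conv_bound cq) => // z; exact: GV.
  by rewrite (le_trans (ler_normD _ _)) // lerD // bd.
have -> : err b m - err b n = (err b m - \int[n]_x sqerr b m x) +
  (\int[n]_x sqerr b m x - err b n) by rewrite addrA subrK.
have -> : d%:R * (4 * V * L) * c = d%:R * (2 * V * L) * c + d%:R * (2 * V * L) * c by ring.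
by rewrite (le_trans (ler_normD _ _)) // lerD.
Qed.

Lemma Gcoord_close b b' eta (i : 'I_d) z : 0 <= eta ->
  (forall s, 0 <= s <= 2 * r -> `|b s - b' s| <= eta) -> eball (2 * r) z ->
  `|Fcoord b i z - Fcoord b' i z| <= eta * (2 * r).
Proof.
move=> eta0 bb zr; rewrite !FcoordE -opprD normrN -mulrBl normrM.
by rewrite ler_pM ?bb ?enorm_ge0 // (le_trans (le_coord_enorm _ _)).
Qed.

Lemma err_le_close b m eta : concentrated r m -> kernel b -> 0 <= eta ->
  (forall s, 0 <= s <= 2 * r -> `|b s - a s| <= eta) ->
  err b m <= d%:R * (eta * (2 * r)) ^+ 2.
Proof.
move=> cm kb eta0 ba; have r0 := concentrated_ge0 cm.
have e0 : 0 <= eta * (2 * r) by rewrite !mulr_ge0.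
rewrite (le_trans (ler_norm _)) //; apply: (Rintegral_norm_le cm).
- by rewrite mulr_ge0 // sqr_ge0.
- by apply: loclip_continuous; exact: loclip_sqerr.
move=> x xr; rewrite (le_trans (ler_norm_sum _ _ _)) //.
have -> : d%:R * (eta * (2 * r)) ^+ 2 = \sum_(i < d) (eta * (2 * r)) ^+ 2.
  by rewrite sumr_const card_ord mulr_natl.
apply: ler_sum => i _; rewrite normrM expr2.
have cb : `|conv (Gcoord b i) m x| <= eta * (2 * r).
  by apply: (conv_bound cm) => //; [exact: loclip_Gcoord|move=> z; exact: Gcoord_close].
exact: ler_pM.
Qed.

Lemma err_le_perturb b b' m eta : concentrated r m -> kernel b -> kernel b' -> 0 <= eta ->
  (forall s, 0 <= s <= 2 * r -> `|b s - b' s| <= eta) ->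
  err b m <= 2 * err b' m + 2 * (d%:R * (eta * (2 * r)) ^+ 2).
Proof.
move=> cm kb kb' eta0 bb; have r0 := concentrated_ge0 cm.
have e0 : 0 <= eta * (2 * r) by rewrite !mulr_ge0.
have cs q : kernel q -> continuous (sqerr q m).
  by move=> kq; apply: loclip_continuous; exact: loclip_sqerr.
set c := 2 * (d%:R * _); pose g x := 2 * sqerr b' m x + c.
have cg : continuous g.
  apply/loclip_continuous/loclipD; last exact: loclip_cst.
  by apply: loclipM; [exact: loclip_cst|exact: loclip_sqerr].
have cd : continuous (fun x => 2 * sqerr b' m x).
  by apply/loclip_continuous/loclipM; [exact: loclip_cst|exact: loclip_sqerr].
have cc : continuous (fun _ : 'rV[R]_d => c) by apply: Cinf_continuous; exact: Cinf_cst.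
have -> : 2 * err b' m + c = \int[m]_x g x.
  by rewrite /g (cRintegralD cm) // cRintegral_cst (cRintegralZ cm) //; exact: cs.
rewrite -subr_ge0 /err -(cRintegralB cm) //; last exact: cs.
(* The integrand is known to be nonnegative on the ball only, so it is replaced by its absolute
   value, which agrees with it there. *)
have -> : \int[m]_x (g x - sqerr b m x) = \int[m]_x `|g x - sqerr b m x|.
  apply: (eq_cRintegral cm).
  - by move=> x; apply: continuousB; [exact: cg|exact: cs].
  - apply: loclip_continuous => q.
    have lg : loclip g.
      by apply: loclipD; [apply: loclipM; [exact: loclip_cst|exact: loclip_sqerr]|exact: loclip_cst].
    have [L L0 gL] := loclipB lg (loclip_sqerr cm kb) q.
    by exists L => // x y xq yq; rewrite (le_trans (ler_dist_dist _ _)) // gL.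
  move=> x xr; rewrite ger0_norm // subr_ge0 /g /c.
  have -> : 2 * (d%:R * (eta * (2 * r)) ^+ 2) = \sum_(i < d) (2 * (eta * (2 * r)) ^+ 2).
    by rewrite sumr_const card_ord -mulr_natl; ring.
  rewrite mulr_sumr -big_split /=; apply: ler_sum => i _.
  have h : `|conv (Gcoord b i) m x - conv (Gcoord b' i) m x| <= eta * (2 * r).
    apply: (cRintegral_dist cm) => //.
    - by apply/loclip_continuous/loclip_shift; exact: loclip_Gcoord.
    - by apply/loclip_continuous/loclip_shift; exact: loclip_Gcoord.
    move=> y yr; rewrite /Gcoord opprB addrA subrK.
    by apply: Gcoord_close => //; exact: eballB.
  have h2 : (conv (Gcoord b i) m x - conv (Gcoord b' i) m x) ^+ 2 <= (eta * (2 * r)) ^+ 2.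
    by rewrite -real_normK ?num_real // lerXn2r ?nnegrE.
  (* The inequality p^2 <= 2 q^2 + 2 (p - q)^2 is the nonnegativity of (p - 2q)^2. *)
  have := sqr_ge0 (conv (Gcoord b i) m x - 2 * conv (Gcoord b' i) m x).
  move: h2; move: (conv _ m x) (conv _ m x) (eta * (2 * r)) => p q e.
  clear; rewrite !expr2 => h2 h3; nra.
by apply: Rintegral_ge0.
Qed.

End ErrorFunctional.

(** * Averages over time *)

Section TimeIntegral.
Context {R : realType} {d : nat}.
Variables (T : R) (a : R -> R) (r : R).
Hypotheses (T0 : 0 < T) (ka : kernel a).
Implicit Types (b : R -> R) (mu nu : R -> probability (Rd R d) R).

Lemma weak_dual_le_time mu : weak_solution T a r mu -> exists2 C, 0 <= C &
  forall s t, s \in `[0, T] -> t \in `[0, T] -> dual_le r (C * `|s - t|) (mu s) (mu t).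
Proof.
move=> smu; have [cmu _ _] := smu.
have I0 : 0 \in `[0, T] by rewrite in_itv /= lexx ltW.
have r0 := concentrated_ge0 (cmu _ I0).
have r20 : 0 <= 2 * r by rewrite mulr_ge0.
have [B [L [B0 L0 kB]]] := ka r20.
have V0 : 0 <= B * (2 * r) by rewrite mulr_ge0.
exists (d%:R * (B * (2 * r))); first by rewrite mulr_ge0.
have key := @weak_time_lip R d T a r (B * (2 * r)) ka V0
  (fun i => Fcoord_bound i B0 kB) mu smu.
move=> s t; rewrite !in_itv /= => /andP[s0 sT] /andP[t0 tT].
have [st|ts] := leP s t.
  have -> : `|s - t| = t - s by rewrite distrC ger0_norm ?subr_ge0.
  by move=> f lf M M0 fM; rewrite distrC; apply: key.
by rewrite gtr0_norm ?subr_gt0 //; apply: key => //; exact: ltW.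
Qed.

Lemma lipschitz_within (F : R -> R) (C : R) :
  (forall s t, s \in `[0, T] -> t \in `[0, T] -> `|F s - F t| <= C * `|s - t|) ->
  {within `[0, T], continuous F}.
Proof.
move=> FC; apply/subspace_continuousP => t tT; apply/cvgrPdist_le => e e0.
have C1 : 0 < `|C| + 1 by rewrite ltr_wpDl.
have near_t : \forall s \near nbhs t, `|t - s| <= e / (`|C| + 1).
  by apply: cvgr_dist_le; [exact: cvg_id|rewrite divr_gt0].
near=> s; have sT : s \in `[0, T] by near: s; exact: withinT.
have : `|t - s| <= e / (`|C| + 1) by near: s; exact: cvg_within near_t.
rewrite ler_pdivlMr // mulrC; apply: le_trans; rewrite (le_trans (FC _ _ _ _)) //.
by rewrite ler_wpM2r // (le_trans (ler_norm C)) // lerDl.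
Unshelve. all: by end_near. Qed.

Lemma measurable_within (F : R -> R) : {within `[0, T], continuous F} ->
  measurable_fun `[0, T] (EFin \o F).
Proof.
move=> cF; apply/measurable_EFinP.
by apply: subspace_continuous_measurable_fun => //; exact: measurable_itv.
Qed.

Lemma Gcoord_consts b B L : 0 <= r -> 0 <= B -> 0 <= L -> kernel_on (2 * r) B L b ->
  forall Ba La, 0 <= Ba -> 0 <= La -> kernel_on (2 * r) Ba La a -> forall i : 'I_d,
  (forall z, eball (2 * r) z -> `|Gcoord a b i z| <= (B + Ba) * (2 * r)) /\
  lip_on (2 * r) ((B + L * d%:R * (2 * r)) + (Ba + La * d%:R * (2 * r))) (Gcoord a b i).
Proof.
move=> r0 B0 L0 kB Ba La Ba0 La0 kBa i; split=> [z zr|x y xr yr].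
  rewrite (le_trans (ler_normB _ _)) // mulrDl lerD //.
    exact: (Fcoord_bound _ B0 kB).
  exact: (Fcoord_bound _ Ba0 kBa).
have -> : Gcoord a b i x - Gcoord a b i y =
  (Fcoord b i x - Fcoord b i y) - (Fcoord a i x - Fcoord a i y) by rewrite /Gcoord; ring.
rewrite (le_trans (ler_normB _ _)) // [leRHS]mulrDl lerD //.
  exact: (Fcoord_lip _ B0 L0 kB).
exact: (Fcoord_lip _ Ba0 La0 kBa).
Qed.

Lemma err_dual_le : 0 <= r -> forall B L, 0 <= B -> 0 <= L -> exists2 C, 0 <= C &
  forall b (m n : probability (Rd R d) R) c, kernel b ->
    kernel_on (2 * r) B L b -> concentrated r m -> concentrated r n ->
    0 <= c -> dual_le r c m n -> `|err a b m - err a b n| <= C * c.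
Proof.
move=> r0 B L B0 L0; have r20 : 0 <= 2 * r by rewrite mulr_ge0.
have [Ba [La [Ba0 La0 kBa]]] := ka r20.
set V := (B + Ba) * (2 * r); have V0 : 0 <= V by rewrite mulr_ge0 // addr_ge0.
set M := (B + L * d%:R * (2 * r)) + (Ba + La * d%:R * (2 * r)).
have M0 : 0 <= M by rewrite !addr_ge0 // !mulr_ge0.
exists (d%:R * (4 * V * M)).
  by apply: mulr_ge0 => //; apply: mulr_ge0 => //; exact: mulr_ge0.
move=> b m n c kb kB cm cn c0 mn.
apply: (err_dist ka cm cn kb V0 M0 c0) => // i.
  by have [] := Gcoord_consts r0 B0 L0 kB Ba0 La0 kBa i.
by have [] := Gcoord_consts r0 B0 L0 kB Ba0 La0 kBa i.
Qed.

(** The error at time [t] is Lipschitz in [t], because it is Lipschitz in the measure and the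
    solution is Lipschitz in time for the dual distance. *)
Lemma measurable_err b mu : weak_solution T a r mu -> kernel b ->
  measurable_fun `[0, T] (fun t => (err a b (mu t))%:E).
Proof.
move=> smu kb; have [cmu _ _] := smu.
have I0 : 0 \in `[0, T] by rewrite in_itv /= lexx ltW.
have r0 := concentrated_ge0 (cmu _ I0).
have r20 : 0 <= 2 * r by rewrite mulr_ge0.
have [B [L [B0 L0 kB]]] := kb _ r20.
have [C C0 errC] := err_dual_le r0 B0 L0.
have [D D0 muD] := weak_dual_le_time smu.
apply: measurable_within; apply: (@lipschitz_within _ (C * D)) => s t sT tT.
by rewrite -mulrA; apply: errC => //; [exact: cmu|exact: cmu|exact: mulr_ge0|exact: muD].
Qed.

Lemma errorE b mu : weak_solution T a r mu -> kernel b -> error T a mu b =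
  ((T^-1)%:E * \int[@lebesgue_measure R]_(t in `[0%R, T]) (err a b (mu t))%:E)%E.
Proof.
move=> [cmu _ _] kb; rewrite /error; congr (_ * _)%E.
apply: eq_integral => t; rewrite inE => tT; apply: (errE (r := r)) => //; exact: cmu.
Qed.

Lemma error_ge0 b mu : (0 <= error T a mu b)%E.
Proof.
apply: mule_ge0; first by rewrite lee_fin invr_ge0 ltW.
by apply: integral_ge0 => t _; apply: integral_ge0 => x _; rewrite lee_fin sqr_ge0.
Qed.

(** A single integration in time for three comparisons: [k] is 1 when the measure changes, 0 for a
    kernel close to [a], and 2 when one kernel is perturbed into another. *)
Lemma error_le b b' mu nu (k c : R) : weak_solution T a r mu -> weak_solution T a r nu ->
  kernel b -> kernel b' -> 0 <= k -> 0 <= c ->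
  (forall t, t \in `[0, T] -> err a b (mu t) <= k * err a b' (nu t) + c) ->
  (error T a mu b <= k%:E * error T a nu b' + c%:E)%E.
Proof.
move=> smu snu kb kb' k0 c0 h; rewrite !errorE //.
have mb := measurable_err smu kb; have mb' := measurable_err snu kb'.
have Ti : (0 <= (T^-1)%:E)%E by rewrite lee_fin invr_ge0 ltW.
have e0 q (rho : R -> probability (Rd R d) R) t : (0 <= (err a q (rho t))%:E)%E.
  by rewrite lee_fin err_ge0.
have ek q (rho : R -> probability (Rd R d) R) t : (0 <= k%:E * (err a q (rho t))%:E)%E.
  by rewrite mule_ge0 // lee_fin.
have mT : measurable `[0, T] by exact: measurable_itv.
have mk : measurable_fun `[0, T] (fun t => (k%:E * (err a b' (nu t))%:E)%E).
  exact: measurable_funeM.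
have cE : c%:E = ((T^-1)%:E * \int[@lebesgue_measure R]_(t in `[0%R, T]) cst c%:E t)%E.
  rewrite integral_cst //=.
  rewrite lebesgue_measure_itv /= lte_fin T0 -EFinB subr0.
  by rewrite -!EFinM mulrCA mulVf ?mulr1 // gt_eqF.
have intE : (\int[@lebesgue_measure R]_(t in `[0%R, T]) (k%:E * (err a b' (nu t))%:E + cst c%:E t) =
    k%:E * \int[@lebesgue_measure R]_(t in `[0%R, T]) (err a b' (nu t))%:E +
    \int[@lebesgue_measure R]_(t in `[0%R, T]) cst c%:E t)%E.
  by rewrite ge0_integralD // ge0_integralZl.
have i0 (F : R -> \bar R) : (forall t, 0 <= F t)%E ->
    (0 <= \int[@lebesgue_measure R]_(t in `[0%R, T]) F t)%E.
  by move=> F0; exact: integral_ge0.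
rewrite [X in (_ + X)%E]cE [X in (X + _)%E]muleCA -muleDr //; last first.
  by rewrite ge0_adde_def // inE; [rewrite mule_ge0 // i0|rewrite i0].
rewrite -intE.
apply: lee_wpmul2l => //; apply: ge0_le_integral => //.
  exact: emeasurable_funD.
Qed.

End TimeIntegral.

(** * Lipschitz functions and the class X_{M,K} *)

Section Rademacher.
Context {R : realType}.
Implicit Types (f g : R -> R) (L B q x y : R).
Notation lambda := (@lebesgue_measure R).

Definition lip_fun L f := forall x y, `|f x - f y| <= L * `|x - y|.

Lemma lip_fun_continuous L f : lip_fun L f -> continuous f.
Proof.
move=> fL x; apply/cvgrPdist_le => e e0.
have C1 : 0 < `|L| + 1 by rewrite ltr_wpDl.
near=> y; rewrite (le_trans (fL _ _)) //.
have : `|x - y| <= e / (`|L| + 1).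
  by near: y; apply: cvgr_dist_le; [exact: cvg_id|rewrite divr_gt0].
rewrite ler_pdivlMr // mulrC; apply: le_trans.
by rewrite ler_wpM2r // (le_trans (ler_norm L)) // lerDl.
Unshelve. all: by end_near. Qed.

Lemma lip_funN L f : lip_fun L f -> lip_fun L (\- f).
Proof. by move=> fL x y; rewrite /= -opprD normrN. Qed.

Definition tilt L f x := L * x + f x.

Lemma tilt_nondecreasing L f : lip_fun L f -> {homo tilt L f : x y / x <= y}.
Proof.
move=> fL x y xy; have := fL x y; rewrite ler_norml => /andP[_].
by rewrite distrC ger0_norm ?subr_ge0 // /tilt => h; lra.
Qed.

Lemma tilt_right_continuous L f : lip_fun L f -> right_continuous (tilt L f).
Proof.
move=> fL; apply: right_continuousW => x.
apply: continuousD; last exact: (lip_fun_continuous fL).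
by apply: continuousM; [exact: cvg_cst|exact: cvg_id].
Qed.

Lemma stieltjes_itv (F : cumulative R R) x y : x <= y ->
  lebesgue_stieltjes_measure F `]x, y] = (F y - F x)%:E.
Proof.
move=> xy; rewrite /lebesgue_stieltjes_measure /measure_extension measurable_mu_extE /=; last exact: is_ocitv.
by rewrite wlength_itv_bnd.
Qed.

Lemma derive1_near_tilt (F f : R -> R^o) (c L z : R) : derivable F z 1 ->
  (\forall u \near z, c + F u - L * u = f u) ->
  derivable f z 1 /\ derive1 f z = derive1 F z - L.
Proof.
move=> dF Ff; have FE : is_derive z 1 F (derive1 F z) by rewrite derive1E; apply: DeriveDef.
have c' : is_derive z 1 (cst c + F : R -> R^o) (0 + derive1 F z) by exact: is_deriveD.
have L' : is_derive z 1 (fun u : R => L * u : R^o) L.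
  by apply: is_derive_eq; rewrite -[LHS]/(L * 1) mulr1.
have h : is_derive z 1 ((cst c + F : R -> R^o) - (fun u : R => L * u)) (0 + derive1 F z - L).
  exact: is_deriveB.
rewrite add0r in h; split.
  by apply: near_eq_derivable Ff _; exact: (@ex_derive _ _ _ _ _ _ _ h).
by rewrite derive1E -(near_eq_derive _ Ff); exact: (@derive_val _ _ _ _ _ _ _ h).
Qed.

(* The Stieltjes measures of [L x + f x] and [L x - f x] add up to [2 L] times
   the Lebesgue measure, so both are absolutely continuous. *)
Lemma tilt_stieltjes L f : 0 < L -> lip_fun L f ->
  exists2 m : {measure set (measurableTypeR R) -> \bar R},
    (forall x y, x <= y -> m `]x, y]%classic = (tilt L f y - tilt L f x)%:E) & m `<< lambda.
Proof.
move=> L0 fL; have gL := lip_funN fL.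
pose F : cumulative R R := HB.pack (tilt L f)
  (isCumulative.Build R _ R _ (tilt_nondecreasing fL) (tilt_right_continuous fL)).
pose G : cumulative R R := HB.pack (tilt L (\- f))
  (isCumulative.Build R _ R _ (tilt_nondecreasing gL) (tilt_right_continuous gL)).
pose mF := lebesgue_stieltjes_measure F; pose mG := lebesgue_stieltjes_measure G.
exists (lebesgue_stieltjes_measure F); first by move=> x y; exact: stieltjes_itv.
have c0 : 0 <= (2 * L)^-1 by rewrite invr_ge0 mulr_ge0 // ltW.
pose s := mscale (NngNum c0) (measure_add mF mG).
have s0 A : s A = ((2 * L)^-1%:E * (mF A + mG A))%E by rewrite -measure_addE.
have sE A : measurable A -> lambda A = s A.
  apply: lebesgue_measure_unique => X [[x y] _ <-] /=.
  have [xy|yx] := leP x y; last first.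
    by rewrite set_itv_ge ?measure0 // bnd_simp -leNgt ltW.
  rewrite [LHS](@stieltjes_itv (idfun : cumulative R R)) //.
  rewrite [RHS]s0 /mF /mG !stieltjes_itv // -!EFinD -EFinM.
  by congr EFin; rewrite /= /tilt /=; field; rewrite gt_eqF.
apply/null_content_dominatesP => A mA A0.
have : s A = 0%E by rewrite -sE.
rewrite s0 => /eqP; rewrite mule_eq0 eqe gt_eqF; last first.
  by rewrite invr_gt0 mulr_gt0.
rewrite /= padde_eq0 //.
by move=> /andP[/eqP].
Qed.

(** The measure of [tilt L f] has a density [g]. Lebesgue differentiation shows that almost
    everywhere [f] is derivable with derivative [g - L]; hence [g <= L + B], and integration over
    the interval returns the bound on the increment of [f]. *)
Lemma derivative_ae_le L B q f : 0 < L -> 0 <= B -> lip_fun L f ->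
  {ae lambda, forall x, 0 < x < q -> derivable (f : R -> R^o) x 1 ->
    derive1 (f : R -> R^o) x <= B} ->
  forall x y, 0 <= x -> x <= y -> y <= q -> f y - f x <= B * (y - x).
Proof.
move=> L0 B0 fL fB x y x0 xy yq.
have [m mE mabs] := tilt_stieltjes L0 fL.
have q0 : 0 <= q by rewrite (le_trans x0) // (le_trans xy).
(* Restricted to a bounded interval the measure is finite, so its density is integrable on the whole
   line. *)
pose D : set (measurableTypeR R) := `]0, q]%classic.
have mD : measurable D by exact: measurable_itv.
have moo : (m D < +oo)%E by rewrite mE // ltry.
pose n := mfrestr mD moo.
have nE u : 0 <= u -> u <= q -> n `]-oo, u]%classic = (tilt L f u - tilt L f 0)%:E.
  move=> u0 uq; rewrite -mE // /n /mfrestr /mrestr; congr (m _).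
  apply/seteqP; split=> z; rewrite /D /= !in_itv /=; first by move=> [-> /andP[->]].
  by move=> /andP[-> zu]; rewrite zu (le_trans zu uq).
have nabs : n `<< lambda.
  apply/null_content_dominatesP => A mA A0; rewrite /n /mfrestr /mrestr.
  apply/eqP; rewrite -measure_le0; move/null_content_dominatesP : mabs => /(_ A mA A0) <-.
  by apply: le_measure; rewrite ?inE //; exact: measurableI.
pose h := Radon_Nikodym_SigmaFinite.f n lambda; pose g x := fine (h x).
have gE : EFin \o g = h.
  by apply/funext => z; rewrite /= fineK // Radon_Nikodym_SigmaFinite.f_fin_num.
have gi : lambda.-integrable [set: R] (EFin \o g).
  by rewrite gE; exact: Radon_Nikodym_SigmaFinite.f_integrable.
have hE A : measurable A -> n A = (\int[lambda]_(x in A) h x)%E.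
  by move=> mA; exact: Radon_Nikodym_SigmaFinite.f_integral.
have gd : {ae lambda, forall z, 0 < z < q -> g z <= L + B}.
  have gy u : lambda.-integrable `]-oo, u] (EFin \o g).
    by apply: integrableS gi => //; exact: measurable_itv.
  have gl := open_integrable_locally openT gi.
  apply: (@filterS2 _ _ (ae_filter_ringOfSetsType lambda)) fB (FTC1Ny gy gl).
  move=> /= z fB gF /andP[z0 zq].
  move: gF; set F := (fun u => _) => -[dF dFE].
  (* Inside (0, q) the primitive [F] of the density is [tilt L f] minus its value at 0, so [f]
     differs from [F] by an affine function. *)
  have near_f : \forall u \near z, tilt L f 0 + F u - L * u = f u.
    near=> u; have u0 : 0 < u by near: u; exact: lt_nbhsr.
    have uq : u < q by near: u; exact: lt_nbhsl.
    rewrite /F /Rintegral; under eq_integral do rewrite -[(g _)%:E]/((EFin \o g) _) gE.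
    by rewrite -hE ?nE ?(ltW u0) ?(ltW uq) //= /tilt; ring.
  have [df dfE] := derive1_near_tilt dF near_f; rewrite dFE in dfE.
  by have := fB _ df; rewrite z0 zq dfE => /(_ isT); lra.
have tE : (tilt L f y - tilt L f x)%:E = (\int[lambda]_(z in `]x, y]) h z)%E.
  rewrite -mE // -hE; last exact: measurable_itv.
  rewrite /n /mfrestr /mrestr; congr (m _); apply/seteqP; split=> z; rewrite /D /= !in_itv /=; last by case.
  move=> /andP[xz zy]; rewrite xz zy; split => //.
  by rewrite (le_lt_trans x0) // (le_trans zy).
have LB0 : 0 <= L + B by rewrite addr_ge0 // ltW.
have mg : measurable_fun [set: R] g by apply/measurable_EFinP; exact: measurable_int gi.
(* The interval is opened at [y] because the bound on [g] is known only below [q], and [y = q] is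
   allowed. *)
have : ((tilt L f y - tilt L f x)%:E <= \int[lambda]_(z in `]x, y[) cst (L + B)%:E z)%E.
  rewrite tE -gE -integral_itv_bndo_bndc; last first.
    exact: measurable_funTS (measurable_int _ gi).
  apply: ae_ge0_le_integral.
  - exact: measurable_itv.
  - by move=> z _; rewrite gE; exact: Radon_Nikodym_SigmaFinite.f_ge0.
  - by apply/measurable_EFinP; exact: measurable_funTS.
  - by [].
  - exact: measurable_cst.
  apply: (@filterS _ _ (ae_filter_ringOfSetsType lambda)) gd => z zB; rewrite /= in_itv /= => /andP[xz zy]; rewrite lee_fin zB //.
  by rewrite (le_lt_trans x0) // (lt_le_trans zy).
rewrite integral_cst /=; last exact: measurable_itv.
rewrite lebesgue_measure_itv /= lte_fin; move: xy; rewrite le_eqVlt => /predU1P[->|xy].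
  by rewrite !subrr mulr0.
by rewrite xy -EFinB -EFinM lee_fin /tilt => ?; lra.
Unshelve. all: by end_near. Qed.
End Rademacher.

(** * Pointwise description of X_{M,K} *)

Section KernelClass.
Context {R : realType}.
Implicit Types (f b : R -> R) (A B C M q s t x u v : R).
Notation lambda := (@lebesgue_measure R).

Lemma lebesgue_measure_setT_gt0 : (0 < lambda setT)%E.
Proof. by rewrite -set_itvNyy lebesgue_measure_itv /= ltry. Qed.

Lemma Linfty_leP (K : set R) f A : 0 <= A ->
  (Linfty K f <= A%:E)%E <-> {ae lambda, forall x, K x -> `|f x| <= A}.
Proof.
move=> A0; rewrite /Linfty unlock lebesgue_measure_setT_gt0.
split=> [/ess_supP|h].
  apply: (@filterS _ _ (ae_filter_ringOfSetsType lambda)) => x /= + Kx.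
  by rewrite patchE mem_set //= lee_fin.
apply/ess_supP; apply: (@filterS _ _ (ae_filter_ringOfSetsType lambda)) h => x /= h.
rewrite patchE; case: ifPn => [/set_mem /h|_]; first by rewrite lee_fin.
by rewrite /= normr0 lee_fin.
Qed.

Lemma ae_itv_exists (P : R -> Prop) u v : u < v -> {ae lambda, forall x, P x} ->
  exists2 x, u < x < v & P x.
Proof.
move=> uv [N [mN N0 PN]]; apply: contrapT => h.
have : (lambda `]u, v[%classic <= lambda N)%E.
  apply: le_measure; rewrite ?inE //.
  move=> x /=; rewrite in_itv /= => xuv; apply: PN => /= Px; apply: h; by exists x.
rewrite [X in (_ <= X)%E]N0 lebesgue_measure_itv /= lte_fin uv -EFinB lee_fin.
by rewrite subr_le0 leNgt uv.
Qed.

Definition lip_itv q C b := forall s t, 0 <= s <= q -> 0 <= t <= q -> `|b s - b t| <= C * `|s - t|.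

Definition bnd_itv q A b := forall s, 0 <= s <= q -> `|b s| <= A.

(** A small interval around [s], cut down to (0, q), has positive measure and so contains a good
    point; Lipschitz continuity carries the bound from there to [s], the end points included. *)
Lemma ae_bnd_itv q A C b : 0 < q -> 0 <= C -> lip_itv q C b ->
  {ae lambda, forall x, 0 < x < q -> `|b x| <= A} -> bnd_itv q A b.
Proof.
move=> q0 C0 bC bA s /andP[s0 sq]; apply: le_eps => e e0.
have C1 : 0 < C + 1 by rewrite ltr_wpDl.
pose dl := e / (C + 1); have dl0 : 0 < dl by rewrite divr_gt0.
pose u := Num.max 0 (s - dl); pose v := Num.min q (s + dl).
have uv : u < v.
  rewrite /u /v lt_min !gt_max q0 /= (lt_le_trans _ sq) ?gtrBl //=.
  by rewrite ltr_wpDl //= ltrBlDr -addrA ltrDl addr_gt0.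
have [x /andP[]] := ae_itv_exists uv bA.
rewrite gt_max lt_min => /andP[x0 sx] /andP[xq xs]; rewrite x0 xq => /(_ isT) bx.
have bsx : `|b s - b x| <= e.
  rewrite (le_trans (bC _ _ _ _)) ?s0 ?sq ?(ltW x0) ?(ltW xq) //.
  have : `|s - x| <= dl by rewrite ler_norml; apply/andP; split; lra.
  rewrite /dl ler_pdivlMr // => h; rewrite (le_trans _ h) // mulrC ler_wpM2l //.
  by rewrite lerDl.
by rewrite -(subrK (b x) (b s)) (le_trans (ler_normD _ _)) // addrC lerD.
Qed.

Lemma extend_eq q b s : 0 <= s <= q -> extend q b s = b s.
Proof. by move=> /andP[s0 sq]; rewrite /extend (max_idPl s0) (min_idPl sq). Qed.

Lemma clamp_itv q s : 0 <= q -> 0 <= Num.min (Num.max s 0) q <= q.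
Proof. by move=> q0; rewrite le_min le_max lexx orbT q0 ge_min lexx orbT. Qed.

Lemma max_dist c s t : `|Num.max s c - Num.max t c| <= `|s - t|.
Proof.
have := ler_norm (s - t); have := ler_norm (t - s); rewrite distrC ler_norml.
by case: (leP s c) => ?; case: (leP t c) => ? ? ?; apply/andP; split; lra.
Qed.

Lemma min_dist c s t : `|Num.min s c - Num.min t c| <= `|s - t|.
Proof.
have := ler_norm (s - t); have := ler_norm (t - s); rewrite distrC ler_norml.
by case: (leP s c) => ?; case: (leP t c) => ? ? ?; apply/andP; split; lra.
Qed.

Lemma extend_lip q C b : 0 <= q -> 0 <= C -> lip_itv q C b -> lip_fun C (extend q b).
Proof.
move=> q0 C0 bC s t; rewrite /extend (le_trans (bC _ _ _ _)) ?clamp_itv //.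
by rewrite ler_wpM2l // (le_trans (min_dist _ _ _)) // max_dist.
Qed.

Lemma derive1_extend q b x : 0 < x < q ->
  (derivable (extend q b : R -> R^o) x 1 -> derivable (b : R -> R^o) x 1) /\
  derive1 (extend q b : R -> R^o) x = derive1 (b : R -> R^o) x.
Proof.
move=> /andP[x0 xq].
have h : \forall u \near x, (extend q b : R -> R^o) u = b u.
  near=> u; rewrite extend_eq //; apply/andP; split; apply: ltW; near: u.
    exact: lt_nbhsr.
  exact: lt_nbhsl.
by split; [exact: near_eq_derivable h|rewrite !derive1E (near_eq_derive _ h)].
Unshelve. all: by end_near. Qed.

(** Some Lipschitz constant [C] is given, which makes [derivative_ae_le] applicable; used for [b]
    and for its opposite, it sharpens [C] to the essential bound [B] of the derivative. *)
Lemma ae_lip_itv q B C b : 0 < q -> 0 <= B -> 0 <= C -> lip_itv q C b ->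
  {ae lambda, forall x, 0 < x < q -> `|derive1 (b : R -> R^o) x| <= B} -> lip_itv q B b.
Proof.
move=> q0 B0 C0 bC bB.
have C1 : 0 < C + 1 by rewrite ltr_wpDl.
have eL : lip_fun (C + 1) (extend q b).
  apply: extend_lip; [exact: ltW|exact: ltW|] => s t s0 t0.
  by rewrite (le_trans (bC _ _ s0 t0)) // ler_wpM2r // lerDl.
have key s t : 0 <= s -> s <= t -> t <= q -> `|extend q b t - extend q b s| <= B * (t - s).
  move=> s0 st tq; rewrite ler_norml; apply/andP; split.
    have := @derivative_ae_le _ (C + 1) B q _ C1 B0 (lip_funN eL) _ s t s0 st tq.
    rewrite /= opprK lerNl opprD opprK; apply.
    apply: (@filterS _ _ (ae_filter_ringOfSetsType lambda)) bB => x h xq dx.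
    rewrite derive1E deriveN; last first.
      have := derivableN dx; rewrite (_ : - (\- extend q b) = extend q b) //.
      by apply/funext => y; rewrite /= opprK.
    rewrite -derive1E (derive1_extend _ xq).2 (le_trans _ (h xq)) //.
    by rewrite -normrN ler_norm.
  apply: (@derivative_ae_le _ (C + 1) B q _ C1 B0 eL) => //.
  apply: (@filterS _ _ (ae_filter_ringOfSetsType lambda)) bB => x h xq _.
  by rewrite (derive1_extend _ xq).2 (le_trans _ (h xq)) // ler_norm.
move=> s t sq tq; have [s0 s1] := andP sq; have [t0 t1] := andP tq.
rewrite -(extend_eq b sq) -(extend_eq b tq).
have [st|ts] := leP s t.
  by rewrite distrC [`|s - t|]distrC (ger0_norm (x := t - s)) ?subr_ge0 // key.
by rewrite (gtr0_norm (x := s - t)) ?subr_gt0 // key // ltW.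
Unshelve. all: by end_near. Qed.

Lemma derive1_le C b x q : 0 <= C -> lip_itv q C b -> 0 < x < q ->
  `|derive1 (b : R -> R^o) x| <= C.
Proof.
move=> C0 bC /andP[x0 xq]; rewrite /derive1.
(* Where [b] is not derivable, [derive1 b x] is the junk value 0. *)
set F := (X in lim X); have [cF|/dvgP ->] := pselect (cvg F); last by rewrite normr0.
have : closed [set y : R^o | `|y| <= C].
  rewrite (_ : [set y | _] = closed_ball_ Num.norm (0 : R^o) C); first exact: closed_closed_ball_.
  by apply/seteqP; split=> y; rewrite /closed_ball_ /= sub0r normrN.
move=> /(@closed_cvg _ _ (0^') _ (fun h : R => h^-1 *: (b (h + x) - b x : R^o))).
apply; last exact: cF.
near=> h; have h0 : h != 0 by near: h; exact: nbhs_dnbhs_neq.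
have hn : `|h| < Num.min x (q - x).
  by near: h; apply: dnbhs0_lt; rewrite lt_min x0 subr_gt0.
rewrite /= normrZ normfV ler_pdivrMl ?normr_gt0 // mulrC.
have := bC (h + x) x; rewrite addrK; apply; last by rewrite !ltW.
move: hn; rewrite lt_min ltr_norml => /andP[/andP[? _]]; rewrite ltr_norml => /andP[_ ?].
by apply/andP; split; lra.
Unshelve. all: by end_near. Qed.

Lemma lip_itv_lipschitz q C b : lip_itv q C b -> [lipschitz (b s : R^o) | s in (`[0, q] : set R^o)].
Proof.
move=> bC; exists C; split; first exact: num_real.
move=> D CD [s t] /= [sK tK]; rewrite (le_trans (bC s t sK tK)) // ler_wpM2r //.
exact: ltW.
Qed.

Lemma lipschitz_lip_itv q b : [lipschitz (b s : R^o) | s in (`[0, q] : set R^o)] ->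
  exists2 C, 0 <= C & lip_itv q C b.
Proof.
move=> [C0 [_ bC]]; exists (`|C0| + 1); first by rewrite addr_ge0.
move=> s t sq tq; apply: (bC (`|C0| + 1) _ (s, t)); last by split.
by rewrite (le_lt_trans (ler_norm _)) // ltrDl.
Qed.

(** Replaces the two essential suprema by pointwise bounds [A] and [B], in which form limits and
    compactness can be handled. *)
Lemma XMKP q M b : 0 < q -> XMK M `[0, q] b <->
  exists A B, [/\ 0 <= A, 0 <= B, A + B <= M, bnd_itv q A b & lip_itv q B b].
Proof.
move=> q0; have K_itv s : `[0, q]%classic s = (0 <= s <= q) by [].
split=> [[/lipschitz_lip_itv[C C0 bC]]|[A [B [A0 B0 ABM bA bB]]]].
  rewrite /W1infty_norm => nM.
  have Lge f : (0 <= Linfty `[0%R, q] f)%E by exact: Lnorm_ge0.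
  have Lfin f : (Linfty `[0%R, q] f <= M%:E)%E -> Linfty `[0%R, q] f = (fine (Linfty `[0%R, q] f))%:E.
    by move=> h; rewrite fineK // ge0_fin_numE // (le_lt_trans h) // ltry.
  have E1 := Lfin _ (le_trans (leeDl _ (Lge _)) nM).
  have E2 := Lfin _ (le_trans (leeDr _ (Lge _)) nM).
  set A := fine _ in E1; set B := fine _ in E2.
  have A0 : 0 <= A by apply: fine_ge0.
  have B0 : 0 <= B by apply: fine_ge0.
  exists A, B; split => //.
  - by move: nM; rewrite E1 E2 -EFinD lee_fin.
  - apply: (ae_bnd_itv q0 C0 bC).
    have /(Linfty_leP `[0, q]%classic b A0) : (Linfty `[0%R, q] b <= A%:E)%E by rewrite E1.
    apply: (@filterS _ _ (ae_filter_ringOfSetsType lambda)) => x h /andP[x0 xq]; apply: h.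
    by rewrite K_itv !ltW.
  - apply: (ae_lip_itv q0 B0 C0 bC).
    have /(Linfty_leP `[0, q]%classic _ B0) : (Linfty `[0%R, q] (derive1 (b : R -> R^o)) <= B%:E)%E by rewrite E2.
    apply: (@filterS _ _ (ae_filter_ringOfSetsType lambda)) => x h /andP[x0 xq]; apply: h.
    by rewrite K_itv !ltW.
split; first exact: lip_itv_lipschitz bB.
rewrite /W1infty_norm (@le_trans _ _ (A%:E + B%:E)%E) // leeD //.
  by apply/Linfty_leP => //; apply: aeW => x; exact: bA.
apply/Linfty_leP => //.
(* At the ends of the interval [derive1] also sees values outside it, where nothing is known; these
   two points are null. *)
have null : lambda.-negligible [set 0; q].
  by apply: negligibleU; apply/negligibleP => //; exact: lebesgue_measure_set1.
apply: (negligibleS _ null) => x /= h; apply: contrapT => /not_orP[x0 xq]; apply: h; rewrite in_itv /= => /andP[x0' xq'].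
apply: (derive1_le B0 bB); rewrite !lt_neqAle x0' xq' !andbT eq_sym.
by apply/andP; split; apply/eqP.
Qed.

End KernelClass.

Lemma filter_seq_forall (T : Type) (S : eqType) (F : set_system T) (P : S -> T -> Prop)
  {FF : Filter F} (net : seq S) : (forall i, F (P i)) -> F [set h | forall i, i \in net -> P i h].
Proof.
move=> FP; elim: net => [|s net IH]; first exact: filterE.
by apply: filterS2 IH (FP s) => h h1 h2 t; rewrite inE => /predU1P[->//|]; exact: h1.
Qed.

(** * Uniform convergence and Arzela-Ascoli *)

Section UniformConvergence.
Context {R : realType}.
Implicit Types (a f b : R -> R) (A B C M q s t e : R).

Lemma unif_cvgP (q : R) (b_ : nat -> R -> R) b : unif_cvg `[0, q] b_ b <->
  forall e, 0 < e -> exists N0, forall N, (N0 <= N)%N -> forall s, 0 <= s <= q -> `|b s - b_ N s| <= e.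
Proof.
split=> [h e e0|h].
  have := h [set g | forall y, `[0, q]%classic y -> ball_ Num.norm (b y) e (g y)].
  rewrite /=; case.
    apply/uniform_nbhs; exists [set xy : R^o * R^o | ball_ Num.norm xy.1 e xy.2]; split => //.
    exact: (@entourage_ball _ _ (PosNum e0)).
  move=> N0 _ hN; exists N0 => N N0N s sq; apply: ltW; exact: (hN N N0N s).
move=> P /uniform_nbhs[E [entE EP]].
have [e /= e0 eE] : exists2 e, 0 < e & [set xy : R^o * R^o | ball xy.1 e xy.2] `<=` E.
  by move: entE; rewrite -entourage_ballE => -[e ?]; exists e.
have e2 : 0 < e / 2 by rewrite divr_gt0.
have [N0 hN] := h _ e2; exists N0 => // N N0N; apply: EP => s sq; apply: eE => /=.
rewrite /ball /= (le_lt_trans (hN N N0N s sq)) //.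
by rewrite ltr_pdivrMr // ltr_pMr // ltr1n.
Qed.

(** [f] is a cluster point in a product of compact intervals, by Tychonoff. Its neighbourhoods
    constrain finitely many points, and clustering gives arbitrarily late indices. *)
Lemma pointwise_cluster (A : R) (f_ : nat -> R -> R) : (forall n s, `|f_ n s| <= A) ->
  exists f, forall (net : seq R) e N, 0 < e ->
    exists2 n, (N <= n)%N & forall s, s \in net -> `|f_ n s - f s| < e.
Proof.
move=> fA; have cA : compact (`[- A, A]%classic : set R) by exact: segment_compact.
have := @tychonoff _ _ _ (fun _ : R => cA).
move=> /(_ (f_ @ \oo)) [].
  by exists 0%N => // n _ s /=; rewrite in_itv /= -ler_norml.
move=> f [_ clf]; exists f => net e N e0.
have fN : (f_ @ \oo) [set h | exists2 n, (N <= n)%N & h = f_ n].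
  by exists N => // n Nn; exists n.
have fB : nbhs (f : prod_topology (fun _ : R => R)) [set h | forall s, s \in net -> `|h s - f s| < e].
  apply: (@filter_seq_forall _ _ _ (fun (s : R) (h : R -> R) => `|h s - f s| < e) (nbhs_filter f)) => s.
  have ball_s : nbhs (f s : R) [set y : R | `|y - f s| < e].
    by apply: filterS (nbhsx_ballx (f s : R) e e0) => y; rewrite /ball /= distrC.
  exact: (@proj_continuous R (fun _ : R => R : topologicalType) s f _ ball_s).
by have [_ [[n Nn ->] h]] := clf _ _ fN fB; exists n.
Qed.

(** The common Lipschitz constant upgrades closeness on a finite grid to uniform closeness, so no
    diagonal sequence is needed: each index of the subsequence is chosen beyond the preceding one,
    with error 1/(k+1). *)
Lemma ascoli q A B (f_ : nat -> R -> R) : 0 < q -> 0 <= A -> 0 <= B ->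
  (forall n, kernel_on q A B (f_ n)) ->
  exists (sigma : nat -> nat) f,
    [/\ {homo sigma : m n / (m < n)%N}, unif_cvg `[0, q] (f_ \o sigma) f & kernel_on q A B f].
Proof.
move=> q0 A0 B0 fK; have q00 := ltW q0.
(* Extension by constants keeps the bound [A] on the whole line, as the product of intervals over
   all reals requires. *)
have [|f hf] := @pointwise_cluster A (fun n => extend q (f_ n)).
  by move=> n s; have [h _] := fK n; apply: h; exact: clamp_itv.
have fKe : kernel_on q A B f.
  split=> [s sq|s t sq tq]; apply: le_eps => e e0.
    have [n _ /(_ s (mem_head _ _))] := hf [:: s] e 0%N e0.
    rewrite extend_eq // distrC => hn; rewrite -(subrK (f_ n s) (f s)).
    rewrite (le_trans (ler_normD _ _)) // addrC lerD ?(ltW hn) //.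
    by have [h _] := fK n; exact: h.
  have e2 : 0 < e / 2 by rewrite divr_gt0.
  have [n _ hn] := hf [:: s; t] _ 0%N e2.
  have := hn s; have := hn t; rewrite !inE !eqxx orbT => /(_ isT) h1 /(_ isT) h2.
  rewrite !extend_eq // in h1 h2.
  have [_ h] := fK n; have := dist_trans3 (ltW h2) (ltW h1) (h s t sq tq).
  by rewrite -addrA -splitr.
have close e N : 0 < e -> exists2 n, (N <= n)%N & forall s, 0 <= s <= q -> `|f s - f_ n s| <= e.
  (* On a grid of mesh at most [dl] each of the two functions moves by at most [e / 3] to the next
     grid point on the left; the last third is the distance on the grid. *)
  move=> e0; pose dl := e / (3 * (B + 1)).
  have B1 : 0 < 3 * (B + 1) by rewrite mulr_gt0 // ltr_wpDl.
  have dl0 : 0 < dl by rewrite divr_gt0.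
  pose m := (Num.truncn (q / dl)).+1.
  have m0 : (0 : R) < m%:R by rewrite ltr0n.
  have qm : q / m%:R <= dl.
    by rewrite ler_pdivrMr // mulrC -ler_pdivrMr // ltW // truncnS_gt.
  have e3 : 0 < e / 3 by rewrite divr_gt0.
  have [n Nn hn] := hf [seq q / m%:R * i%:R | i <- iota 0 m.+1] _ N e3.
  exists n => // s /andP[s0 sq].
  pose i := Num.truncn (s / (q / m%:R)); pose t := q / m%:R * i%:R.
  have qm0 : 0 < q / m%:R by rewrite divr_gt0.
  have /andP[ti si] : i%:R <= s / (q / m%:R) < i.+1%:R.
    by apply: Num.Theory.truncn_itv; rewrite divr_ge0 // ltW.
  have im : (i < m.+1)%N.
    rewrite ltnS -(ler_nat R) (le_trans ti) // ler_pdivrMr //.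
    by rewrite mulrC divfK // gt_eqF.
  have ts : t <= s by rewrite /t mulrC -ler_pdivlMr.
  have st : s - t <= dl.
    rewrite (le_trans _ qm) // /t lerBlDr; move: si; rewrite ltr_pdivrMr // => /ltW.
    by rewrite mulrC -natr1 mulrDr mulr1 addrC.
  have t0 : 0 <= t by rewrite mulr_ge0 // ltW.
  have tq : 0 <= t <= q by rewrite t0 (le_trans ts).
  have := hn t; rewrite extend_eq // => hnt.
  have {}hnt : `|f_ n t - f t| < e / 3.
    by apply: hnt; apply/mapP; exists i => //; rewrite mem_iota.
  have Bd : B * `|s - t| <= e / 3.
    rewrite ger0_norm ?subr_ge0 // (le_trans (ler_wpM2l B0 st)) //.
    have : dl * (3 * (B + 1)) = e by rewrite divfK // gt_eqF.
    by move: (dl) dl0 => D D0 h; rewrite -h; lra.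
  have [_ fl] := fKe; have [_ fnl] := fK n.
  have h1 : `|f s - f t| <= e / 3 by rewrite (le_trans (fl _ _ _ tq)) ?s0.
  have h2 : `|f_ n s - f_ n t| <= e / 3 by rewrite (le_trans (fnl _ _ _ tq)) ?s0.
  move: h1 h2 hnt; rewrite !ler_norml ltr_norml.
  by move=> /andP[? ?] /andP[? ?] /andP[? ?]; apply/andP; split; lra.
have /choice [next hnext] (kN : nat * nat) : exists n, (kN.2 <= n)%N /\
    forall s, 0 <= s <= q -> `|f s - f_ n s| <= (kN.1.+1%:R)^-1.
  have k0 : (0 : R) < (kN.1.+1%:R)^-1 by rewrite invr_gt0.
  by have [n ? ?] := close _ kN.2 k0; exists n.
pose sigma := fix sig k := if k is k'.+1 then next (k, (sig k').+1) else next (0%N, 0%N).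
exists sigma, f; split => //.
- apply: homo_ltn => [? ? ?|k]; first exact: ltn_trans.
  by have [] := hnext (k.+1, (sigma k).+1).
- apply/unif_cvgP => e e0; exists (Num.truncn e^-1) => N Ne s sq.
  have : `|f s - f_ (sigma N) s| <= N.+1%:R^-1.
    by case: N {Ne} => [|N]; [have [_] := hnext (0%N, 0%N)|have [_] := hnext (N.+1, (sigma N).+1)]; exact.
  move/le_trans; apply; rewrite -[leRHS]invrK lef_pV2 ?posrE ?invr_gt0 //.
  by rewrite (le_trans (ltW (truncnS_gt _))) // ler_nat.
Qed.

End UniformConvergence.

Section KernelExtension.
Context {R : realType}.
Implicit Types (a f b : R -> R) (A B C M q s t e r : R).

Lemma kernel_on_extend q A B b r : 0 <= q -> 0 <= B -> kernel_on q A B b ->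
  kernel_on r A B (extend q b).
Proof.
move=> q0 B0 [bA bB]; split=> [s _|s t _ _]; first by apply: bA; exact: clamp_itv.
exact: (extend_lip q0 B0 bB).
Qed.

Lemma kernel_extend q A B b : 0 <= q -> 0 <= A -> 0 <= B -> kernel_on q A B b ->
  kernel (extend q b).
Proof. by move=> q0 A0 B0 bK r _; exists A, B; split => //; exact: kernel_on_extend. Qed.

Lemma admissible_extend q A B b : 0 <= q -> 0 <= B -> kernel_on q A B b -> admissible (extend q b).
Proof.
move=> q0 B0 [bA bB]; split.
  exists A; split; first exact: num_real.
  by move=> x Ax s _ /=; rewrite (le_trans _ (ltW Ax)) //; apply: bA; exact: clamp_itv.
move=> S _ _; exists B; split; first exact: num_real.
move=> x Bx [s t] _ /=; rewrite (le_trans (extend_lip q0 B0 bB s t)) // ler_wpM2r //.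
exact: ltW.
Qed.

Lemma XMK_kernel_on q M b : 0 < q -> XMK M `[0, q] b -> 0 <= M /\ kernel_on q M M b.
Proof.
move=> q0 /(XMKP _ _ q0)[A [B [A0 B0 ABM bA bB]]].
have AM : A <= M by rewrite (le_trans _ ABM) // lerDl.
have BM : B <= M by rewrite (le_trans _ ABM) // lerDr.
split; first exact: le_trans AM.
split=> [s sq|s t sq tq]; first by rewrite (le_trans (bA _ sq)).
by rewrite (le_trans (bB _ _ sq tq)) // ler_wpM2r.
Qed.

Lemma admissible_XMK q M a : 0 <= q -> admissible a -> (W1infty_norm `[0%R, q] a <= M%:E)%E ->
  XMK M `[0, q] a.
Proof.
move=> q0 aa aM; have [B [L [_ L0 [_ aL]]]] := admissible_kernel aa q0.
by split => //; exact: lip_itv_lipschitz aL.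
Qed.

(** How [M] splits into the two norms may vary along the sequence. The limit takes the witnesses sup
    |b| and M - sup |b|: since sup |b| <= A + e, the Lipschitz constant B <= M - A is at most M -
    sup |b| + e. *)
Lemma XMK_closed q M (b_ : nat -> R -> R) b : 0 < q -> (forall n, XMK M `[0, q] (b_ n)) ->
  unif_cvg `[0, q] b_ b -> XMK M `[0, q] b.
Proof.
move=> q0 bX /unif_cvgP cb; apply/(XMKP _ _ q0).
have close e : 0 < e -> exists A B, [/\ 0 <= A, 0 <= B, A + B <= M, bnd_itv q (A + e) b &
    forall s t, 0 <= s <= q -> 0 <= t <= q -> `|b s - b t| <= B * `|s - t| + e].
  move=> e0; have e2 : 0 < e / 2 by rewrite divr_gt0.
  have [N /(_ N (leqnn N)) hN] := cb _ e2.
  have [A [B [A0 B0 ABM bA bB]]] := (XMKP M (b_ N) q0).1 (bX N).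
  exists A, B; split => // [s sq|s t sq tq].
    rewrite -(subrK (b_ N s) (b s)) (le_trans (ler_normD _ _)) // addrC lerD ?bA //.
    by rewrite (le_trans (hN s sq)) // ler_piMr ?(ltW e0) // invf_le1 // ler1n.
  have := hN s sq; have := hN t tq; rewrite distrC => h1; rewrite distrC => h2.
  by have := dist_trans3 h2 h1 (bB s t sq tq); rewrite -addrA -splitr.
pose S := [set `|b s| | s in [set s | 0 <= s <= q]].
have S0 : S !=set0 by exists `|b 0|, 0 => //=; rewrite lexx ltW.
have hubS C : bnd_itv q C b -> sup S <= C.
  by move=> bC; apply: ge_sup => // _ [s sq <-]; exact: bC.
have [A1 [B1 [_ _ _ bA1 _]]] := close 1 ltr01.
have supS : has_sup S by split => //; exists (A1 + 1) => _ [s sq <-]; exact: bA1.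
have bS : bnd_itv q (sup S) b by move=> s sq; apply: ub_le_sup; [case: supS|exists s].
exists (sup S), (M - sup S); split => //.
- by apply: le_trans (bS 0 _); rewrite // lexx ltW.
- rewrite subr_ge0; apply: le_eps => e e0; have [A [B [A0 B0 ABM bA _]]] := close e e0.
  by rewrite (le_trans (hubS _ bA)) // lerD2r (le_trans _ ABM) // lerDl.
- by rewrite addrC subrK.
move=> s t sq tq; apply: le_eps => e e0.
have C1 : 0 < `|s - t| + 1 by rewrite ltr_wpDl.
have [A [B [A0 B0 ABM bA bB]]] := close (e / (`|s - t| + 1)) (divr_gt0 e0 C1).
have := hubS _ bA; have := bB s t sq tq; set dl := e / _.
have : dl * (`|s - t| + 1) = e by rewrite divfK // gt_eqF.
move: (`|s - t|) (normr_ge0 (s - t)) C1 => D D0 _ h1 h2 h3.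
have : (B - (M - sup S + dl)) * D <= 0.
  by rewrite mulr_le0_ge0 // subr_le0; lra.
rewrite -h1; move: h2; clear; rewrite mulrBl !mulrDr !mulrDl mulr1; lra.
Qed.

Lemma Linfty_dist q A B a b c : 0 < q -> 0 <= c -> kernel_on q A B a -> kernel_on q A B b ->
  (Linfty `[0%R, q] (fun s => a s - b s)%R <= c%:E)%E ->
  forall s, 0 <= s <= q -> `|a s - b s| <= c.
Proof.
move=> q0 c0 [_ aL] [_ bL] /(Linfty_leP _ _ c0) h.
apply: (@ae_bnd_itv _ q c (`|B| + `|B|) (fun s => a s - b s) q0 _ _ _).
- by rewrite addr_ge0.
- move=> s t sq tq; rewrite [X in `|X|](_ : _ = (a s - a t) - (b s - b t)); last by ring.
  rewrite (le_trans (ler_normB _ _)) // mulrDl lerD //.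
    by rewrite (le_trans (aL _ _ sq tq)) // ler_wpM2r // ler_norm.
  by rewrite (le_trans (bL _ _ sq tq)) // ler_wpM2r // ler_norm.
- apply: (@filterS _ _ (ae_filter_ringOfSetsType (@lebesgue_measure R))) h => x h /andP[x0 xq]; apply: h.
  by rewrite /= in_itv /= !ltW.
Qed.

End KernelExtension.

(** * The measure rho *)

Section MeasureConstructions.
Context {R : realType}.

(** [rhobar] and [rho] are plain set functions; to integrate against them they are identified with
    measures, the first as a mixture over time and the second as a density. *)
Lemma mixture_measure (d1 d2 : measure_display) (S : measurableType d1) (T : measurableType d2)
    (l : {measure set S -> \bar R}) (D : set S) (k : S -> {measure set T -> \bar R}) :
  measurable D -> (forall A, measurable A -> measurable_fun D (k ^~ A)) ->
  exists m : {measure set T -> \bar R}, forall A, m A = (\int[l]_(s in D) k s A)%E.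
Proof.
move=> mD mk; pose m A := (\int[l]_(s in D) k s A)%E.
have m0 : m set0 = 0%E by rewrite /m; under eq_integral do rewrite measure0; exact: integral0.
have m_ge0 A : (0 <= m A)%E by apply: integral_ge0 => s _; exact: measure_ge0.
have madd : semi_sigma_additive m.
  move=> F mF tF mUF.
  rewrite [X in _ --> X](_ : _ = \sum_(n <oo) m (F n))%E.
    by apply/cvg_closeP; split; [exact: is_cvg_nneseries|rewrite closeE].
  rewrite -integral_nneseries //; last by move=> n; exact: mk.
  by apply: eq_integral => s _; apply/esym/cvg_lim => //; exact: measure_semi_sigma_additive.
pose M : {measure set T -> \bar R} := HB.pack m (isMeasure.Build _ _ _ m m0 m_ge0 madd).
by exists M.
Qed.

Lemma density_measure (d : measure_display) (T : measurableType d) (l : {measure set T -> \bar R})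
    (f : T -> \bar R) : measurable_fun setT f -> (forall x, 0 <= f x)%E ->
  exists m : {measure set T -> \bar R}, forall A, m A = (\int[l]_(s in A) f s)%E.
Proof.
move=> mf f0; pose m A := (\int[l]_(s in A) f s)%E.
have m0 : m set0 = 0%E by exact: integral_set0.
have m_ge0 A : (0 <= m A)%E by exact: integral_ge0.
have madd : semi_sigma_additive m.
  move=> F mF tF mUF.
  rewrite [X in _ --> X](_ : _ = \sum_(n <oo) m (F n))%E.
    by apply/cvg_closeP; split; [exact: is_cvg_nneseries|rewrite closeE].
  by rewrite /m ge0_integral_bigcup //; exact: measurable_funTS.
pose M : {measure set T -> \bar R} := HB.pack m (isMeasure.Build _ _ _ m m0 m_ge0 madd).
by exists M.
Qed.

End MeasureConstructions.

(** * The law of the pair distance and its measurability in time *)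

Section PairDistance.
Context {R : realType} {d : nat}.
Variables (T r : R) (mu : R -> probability (Rd R d) R) (a : R -> R).
Hypotheses (T0 : 0 < T) (ka : kernel a) (smu : weak_solution T a r mu).
Implicit Types (m n : probability (Rd R d) R) (x s t : R) (A : set R).

Let cmu t : t \in `[0, T] -> concentrated r (mu t).
Proof. by have [h _ _] := smu; exact: h. Qed.

(** Lipschitz functions increasing to the indicator of []x, +oo[]. Integrals of Lipschitz functions
    of the pair distance are continuous in time, and the ramps carry measurability over to rays. *)
Definition ramp (k : nat) x s : R := Num.min 1 (k%:R * Num.max (s - x) 0).

Lemma ramp_ge0 k x s : 0 <= ramp k x s.
Proof. by rewrite le_min ler01 mulr_ge0 // le_max lexx orbT. Qed.

Lemma ramp_le k l x s : (k <= l)%N -> ramp k x s <= ramp l x s.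
Proof.
move=> kl; rewrite /ramp le_min ge_min lexx /= ge_min; apply/orP; right.
by rewrite ler_wpM2r ?ler_nat // le_max lexx orbT.
Qed.

Lemma ramp_lip k x s t : `|ramp k x s - ramp k x t| <= k%:R * `|s - t|.
Proof.
rewrite /ramp ![Num.min 1 _]minC (le_trans (min_dist _ _ _)) // -mulrBr normrM ger0_norm //.
rewrite ler_wpM2l // (le_trans (max_dist _ _ _)) //.
by rewrite opprD addrACA subrr addr0.
Qed.

Lemma ramp_cvg x s : (ramp k x s)%:E @[k --> \oo] --> ((\1_(`]x, +oo[%classic : set R) s)%:E : \bar R).
Proof.
apply: cvg_EFin; first exact: nearW.
apply/cvgrPdist_le => e e0; rewrite /= indicE.
have [xs|sx] := ltP x s; last first.
  rewrite memNset; last by rewrite /= in_itv /= andbT; apply/negP; rewrite -leNgt.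
  near=> k; rewrite /ramp (max_idPr _) ?subr_le0 // mulr0 (min_idPr _) ?ler01 // subrr normr0.
  exact: ltW.
rewrite mem_set; last by rewrite /= in_itv /= xs.
near=> k; rewrite /ramp (max_idPl _) ?subr_ge0 ?(ltW xs) // (min_idPl _).
  by rewrite subrr normr0 ltW.
rewrite -ler_pdivrMr ?subr_gt0 // (le_trans (ltW (truncnS_gt _))) // ler_nat.
by near: k; exact: nbhs_infty_ge.
Unshelve. all: by end_near. Qed.

Lemma loclip_ramp k x : loclip (fun z : 'rV[R]_d => ramp k x (enorm z)).
Proof.
move=> q; exists (k%:R * d%:R) => [|y z _ _]; first exact: mulr_ge0.
by rewrite (le_trans (ramp_lip _ _ _ _)) // -mulrA ler_wpM2l // enorm_dist.
Qed.

Definition pair_ramp k x m := \int[m]_y conv (fun z : 'rV[R]_d => ramp k x (enorm z)) m y.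

Lemma pair_ramp_dist k x m n c : concentrated r m -> concentrated r n -> 0 <= c ->
  dual_le r c m n -> `|pair_ramp k x m - pair_ramp k x n| <= 2 * (k%:R * d%:R) * c.
Proof.
move=> cm cn c0 mn; set phi := fun z : 'rV[R]_d => ramp k x (enorm z).
have L0 : 0 <= (k%:R * d%:R : R) by rewrite mulr_ge0.
have lphi : loclip phi by exact: loclip_ramp.
have phiL q : lip_on q (k%:R * d%:R) phi.
  by move=> y z _ _; rewrite (le_trans (ramp_lip _ _ _ _)) // -mulrA ler_wpM2l // enorm_dist.
have lc p : concentrated r p -> loclip (conv phi p) by move=> cp; exact: (loclip_conv cp).
rewrite -(subrK (\int[n]_y conv phi m y) (pair_ramp k x m)) -addrA.
rewrite (le_trans (ler_normD _ _)) // -mulrA mulrDl mul1r lerD //.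
  by apply: mn => //; [exact: lc|exact: (conv_lip cm)].
apply: (cRintegral_dist cn) => //.
- by apply: loclip_continuous; exact: lc.
- by apply: loclip_continuous; exact: lc.
- exact: mulr_ge0.
by move=> y yr; apply: (conv_dist cm cn).
Qed.

Lemma measurable_pair_ramp k x : measurable_fun `[0, T] (fun t => (pair_ramp k x (mu t))%:E).
Proof.
have [D D0 muD] := weak_dual_le_time T0 ka smu.
apply: measurable_within; apply: (@lipschitz_within _ _ _ (2 * (k%:R * d%:R) * D)) => s t sT tT.
rewrite -[leRHS]mulrA; apply: pair_ramp_dist; [exact: cmu|exact: cmu| |exact: muD].
by rewrite mulr_ge0.
Qed.

Lemma measurable_ramp_dist k x : measurable_fun setT
  (fun z : Rd R d * Rd R d => (ramp k x (enorm ((z.1 : 'rV[R]_d) - z.2)))%:E).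
Proof.
apply/measurable_EFinP; apply: (measurableT_comp _ measurable_dist).
apply: continuous_measurable_fun; apply: (@lip_fun_continuous _ k%:R) => s t.
exact: ramp_lip.
Qed.

Lemma pair_rampE k x m : concentrated r m ->
  (\int[m \x m]_z (ramp k x (enorm ((z.1 : 'rV[R]_d) - z.2)))%:E = (pair_ramp k x m)%:E)%E.
Proof.
move=> cm; rewrite fubini_tonelli1 /=; last 2 first.
- exact: measurable_ramp_dist.
- by move=> z; rewrite lee_fin ramp_ge0.
rewrite /fubini_F /=; have lphi := loclip_ramp k x.
under eq_integral => y _.
  rewrite (_ : (\int[m]_z _)%E = (conv (fun z : 'rV[R]_d => ramp k x (enorm z)) m y)%:E); last first.
    rewrite /conv /Rintegral fineK //; apply: integrable_fin_num => //.
    apply: (concentrated_integrable cm); apply: loclip_continuous.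
    exact: (loclip_shift y lphi).
  over.
rewrite /pair_ramp /Rintegral fineK //; apply: integrable_fin_num => //.
apply: (concentrated_integrable cm); apply: loclip_continuous.
exact: (loclip_conv cm).
Qed.

Lemma measurable_varrho_ray x : measurable_fun `[0, T] (fun t => varrho (mu t) `]x, +oo[%classic).
Proof.
apply: (emeasurable_fun_cvg (fun k t => (pair_ramp k x (mu t))%:E)) => [k|t tT].
  exact: measurable_pair_ramp.
rewrite /varrho /pushforward; set B := _ @^-1` _.
have mB : measurable B.
  by rewrite -[B]setTI; apply: measurable_dist => //; exact: measurable_itv.
have BE : (mu t \x mu t)%E B = (\int[mu t \x mu t]_z
    limn (fun k => (ramp k x (enorm ((z.1 : 'rV[R]_d) - z.2)))%:E))%E.
  rewrite -[in LHS](setIT B) -integral_indic //; apply: eq_integral => z _.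
  by apply/esym/cvg_lim => //; exact: ramp_cvg.
rewrite BE (_ : (fun k => _) = fun k => (\int[mu t \x mu t]_z
    (ramp k x (enorm ((z.1 : 'rV[R]_d) - z.2)))%:E)%E); last first.
  by apply/funext => k; rewrite (pair_rampE k x (cmu tT)).
apply: cvg_monotone_convergence => //.
- by move=> k; exact: measurable_ramp_dist.
- by move=> k z _; rewrite lee_fin ramp_ge0.
- by move=> z _ k l kl; rewrite lee_fin ramp_le.
Qed.

Lemma measurable_preimage_dist A : measurable A ->
  measurable ((fun z : Rd R d * Rd R d => enorm ((z.1 : 'rV[R]_d) - z.2)) @^-1` A).
Proof. by move=> mA; rewrite -[X in measurable X]setTI; exact: measurable_dist. Qed.

Lemma varrho_measure m : exists2 k : {measure set R -> \bar R}, varrho m = k & k setT = 1%E.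
Proof.
unshelve eexists (pushforward (m \x m)%E
  (fun z : Rd R d * Rd R d => enorm ((z.1 : 'rV[R]_d) - z.2)) : {measure set R -> \bar R}) => //.
  exact: measurable_dist.
rewrite /= /pushforward preimage_setT -setXTT product_measure1E //.
by rewrite -[X in (X * _)%E]/(m setT) -[X in (_ * X)%E]/(m setT) !probability_setT mule1.
Qed.

(** Dynkin's pi-lambda theorem: the rays are stable under intersection and generate the Borel sets;
    complements are admissible because [varrho (mu t)] has total mass 1 for every [t]. *)
Lemma measurable_varrho A : measurable A -> measurable_fun `[0, T] (fun t => varrho (mu t) A).
Proof.
have /choice [k kE] t : exists k : {measure set R -> \bar R}, varrho (mu t) = k /\ k setT = 1%E.
  by have [k ? ?] := varrho_measure (mu t); exists k.
have RE : @measurable _ R = <<s @RGenOInfty.G R >>.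
  by rewrite -[LHS]/((ocitv (R:=R)).-sigma.-measurable) RGenOInfty.measurableE.
rewrite RE; apply: (@dynkin_induction _ R (@RGenOInfty.G R)
  (fun A => measurable_fun `[0, T] (fun t => varrho (mu t) A)) RE).
- move=> _ _ [x ->] [y ->]; exists (Num.max x y); apply/seteqP; split=> z /=.
    by rewrite !in_itv /= !andbT gt_max => -[-> ->].
  by rewrite !in_itv /= !andbT gt_max => /andP.
- apply: (eq_measurable_fun (cst 1%E)) => [t _|]; last exact: measurable_cst.
  by have [-> ->] := kE t.
- by move=> _ [x ->]; exact: measurable_varrho_ray.
- move=> S mS hS; apply: (eq_measurable_fun (fun t => 1 - varrho (mu t) S)%E).
    move=> t _; have [-> kT] := kE t; rewrite -setTD -{1}kT measureD ?setTI //.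
    by rewrite -[X in (X < _)%E]/(k t setT) kT ltry.
  by apply: emeasurable_funB => //; exact: measurable_cst.
move=> F mF tF hF.
apply: (eq_measurable_fun (fun t => \sum_(0 <= i <oo | i \in predT) varrho (mu t) (F i))%E).
  move=> t _; apply/cvg_lim => //; have [-> _] := kE t.
  by apply: measure_semi_sigma_additive => //; exact: bigcup_measurable.
apply: ge0_emeasurable_sum => // i t _ _; have [-> _] := kE t; exact: measure_ge0.
Qed.

Lemma rhobar_measure : exists m : {measure set R -> \bar R},
  [/\ rhobar T mu = m, m setT = 1%E & m (~` `[0, 2 * r]%classic) = 0%E].
Proof.
have /choice [k kE] t : exists k : {measure set R -> \bar R}, varrho (mu t) = k /\ k setT = 1%E.
  by have [k ? ?] := varrho_measure (mu t); exists k.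
have mk A : measurable A -> measurable_fun `[0, T] (k ^~ A).
  move=> mA; apply: eq_measurable_fun (measurable_varrho mA) => t _.
  by have [-> _] := kE t.
have mT : measurable (`[0, T]%classic : set R) by exact: measurable_itv.
have [m mE] := @mixture_measure R _ _ _ R lebesgue_measure _ k mT mk.
have T0' : 0 <= T^-1 by rewrite invr_ge0 ltW.
have E A : rhobar T mu A = mscale (NngNum T0') m A.
  rewrite /rhobar /mscale /= mE; congr (_ * _)%E; apply: eq_integral => t _.
  by have [-> _] := kE t.
exists (mscale (NngNum T0') m); split; first exact/funext.
  rewrite -[LHS]/((mscale (NngNum T0') m : set R -> \bar R) setT) -E /rhobar; under eq_integral => t _ do rewrite (proj1 (kE t)) (proj2 (kE t)).
  rewrite integral_cst //= lebesgue_measure_itv /= lte_fin T0 -EFinB subr0 mul1e -EFinM.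
  by rewrite mulVf // gt_eqF.
rewrite -[LHS]/((mscale (NngNum T0') m : set R -> \bar R) _) -E /rhobar; apply/eqP; rewrite mule_eq0; apply/orP; right; apply/eqP.
apply: integral0_eq => t tT; have ct := cmu tT.
rewrite /varrho /pushforward; set B := _ @^-1` _.
have mB : measurable B by apply: measurable_preimage_dist; apply: measurableC; exact: measurable_itv.
apply/eqP; rewrite -measure_le0.
have mE' := @measurable_eball R d r.
(* A pair at distance more than [2 * r] has at least one point off the ball, by [eballB]. *)
apply: (@le_trans _ _ ((mu t \x mu t)%E ((~` eball r) `*` setT) +
   (mu t \x mu t)%E (setT `*` (~` eball r)))%E).
  apply: le_trans (measureU2 _ _ _); last 2 first.
  - by apply: measurableX => //; exact: measurableC.
  - by apply: measurableX => //; exact: measurableC.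
  apply: le_measure; rewrite ?inE //.
    by apply: measurableU; apply: measurableX => //; exact: measurableC.
  move=> [y z]; rewrite /B /= in_itv /= enorm_ge0 /= => yz.
  have [yr|yr] := pselect (eball r (y : 'rV[R]_d)); last by left.
  right; split => // zr; apply: yz; exact: (eballB yr zr).
have c0 : (mu t) (~` eball r) = 0%E := ct.
rewrite !product_measure1E //; try exact: measurableC.
by rewrite -[X in (X * _ + _)%E]/(mu t (~` eball r)) -[X in (_ + _ * X)%E]/(mu t (~` eball r)) c0 mul0e mule0 adde0.
Qed.

Lemma rho_measure : 0 <= r -> exists m : {measure set R -> \bar R},
  [/\ rho T mu = m, (m setT < +oo)%E & m (~` `[0, 2 * r]%classic) = 0%E].
Proof.
move=> r0; have [m [mE mT m0]] := rhobar_measure.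
have msq : measurable_fun setT (fun s : R => (s ^+ 2)%:E).
  by apply/measurable_EFinP; exact: exprn_measurable.
have sq0 (s : R) : (0 <= (s ^+ 2)%:E)%E by rewrite lee_fin sqr_ge0.
have [p pE] := density_measure m msq sq0.
exists p; split.
- by apply/funext => A; rewrite /rho mE pE.
- rewrite pE (@le_lt_trans _ _ (\int[m]_(s in setT) (cst ((2 * r) ^+ 2)%:E s))%E) //.
    apply: ae_ge0_le_integral => //; first by move=> s _; rewrite lee_fin sqr_ge0.
    exists (~` `[0, 2 * r]%classic); split => //; first by apply: measurableC; exact: measurable_itv.
    move=> s /= h sr; apply: h => _; move: sr; rewrite in_itv /= => /andP[s0 sr].
    by rewrite lee_fin lerXn2r ?nnegrE // mulr_ge0.
  by rewrite integral_cst // mT mule1 ltry.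
rewrite pE; apply: null_set_integral => //; first by apply: measurableC; exact: measurable_itv.
exact: measurable_funTS.
Qed.

End PairDistance.

(** * Almost sure convergence of empirical measures *)

Section Cells.
Context {R : realType} {d : nat}.
Implicit Types (m n : probability (Rd R d) R) (x y : 'rV[R]_d) (r L : R).

(** Taking the first net point within [delta] makes the cells disjoint; points that the net misses
    get the index [size ys]. *)
Definition cell_index (delta : R) (ys : seq 'rV[R]_d) (x : 'rV[R]_d) : nat :=
  find (fun y => `|x - y| <= delta) ys.

Definition cell (delta : R) (ys : seq 'rV[R]_d) (j : nat) : set (Rd R d) :=
  [set x : 'rV[R]_d | cell_index delta ys x = j].

Lemma measurable_norm_ball y delta : measurable ([set x : 'rV[R]_d | `|x - y| <= delta] : set (Rd R d)).
Proof.
apply: closed_measurable_Rd.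
rewrite -[X in closed X]/((fun x : 'rV[R]_d => `|x - y|) @^-1` [set s | s <= delta]).
apply: closed_comp; last exact: closed_le.
move=> x _; apply: continuous_comp; last exact: norm_continuous.
by apply: continuousB; [exact: cvg_id|exact: cst_continuous].
Qed.

Lemma measurable_cell delta ys j : measurable (cell delta ys j).
Proof.
elim: ys j => [|y ys IH] [|j].
- by rewrite (_ : cell _ _ _ = setT) //; apply/seteqP; split.
- by rewrite (_ : cell _ _ _ = set0) //; apply/seteqP; split.
- rewrite (_ : cell _ _ _ = [set x : 'rV[R]_d | `|x - y| <= delta]).
    exact: measurable_norm_ball.
  by apply/seteqP; split=> x; rewrite /cell /cell_index /=; case: ifP.
rewrite (_ : cell _ _ _ = ~` [set x : 'rV[R]_d | `|x - y| <= delta] `&` cell delta ys j).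
  by apply: measurableI => //; apply: measurableC; exact: measurable_norm_ball.
apply/seteqP; split=> x; rewrite /cell /cell_index /=; case: ifP => // h.
- by move=> [<-].
- by case.
- by case=> _ ->.
Qed.

Definition cell_fun delta (ys : seq 'rV[R]_d) (c : nat -> R) (x : Rd R d) : R :=
  \sum_(j < size ys) c j * \1_(cell delta ys j) x.

Lemma cell_funE delta (ys : seq 'rV[R]_d) c x : (cell_index delta ys x < size ys)%N ->
  cell_fun delta ys c x = c (cell_index delta ys x).
Proof.
move=> h; rewrite /cell_fun (bigD1 (Ordinal h)) //= indicE mem_set // mulr1.
rewrite big1 ?addr0 // => i /eqP ih; rewrite indicE memNset ?mulr0 // => E.
by apply: ih; apply/val_inj; rewrite /= -E.
Qed.

Lemma cell_fun_integral delta ys c m :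
  m.-integrable setT (EFin \o cell_fun delta ys c) /\
  \int[m]_x cell_fun delta ys c x = \sum_(j < size ys) c j * fine (m (cell delta ys j)).
Proof.
have mi (j : nat) : m.-integrable setT (EFin \o (\1_(cell delta ys j) : Rd R d -> R)).
  exact: integrable_indic (measurable_cell _ _ _).
rewrite /cell_fun; elim: (size ys) => [|k [IH1 IH2]].
  split; last by under eq_Rintegral do rewrite big_ord0; rewrite big_ord0 Rintegral_cst // mul0r.
  rewrite (_ : _ \o _ = cst 0%E); first exact: integrable0.
  by apply/funext => x /=; rewrite big_ord0.
have h : m.-integrable setT (EFin \o (fun x : Rd R d => c k * \1_(cell delta ys k) x)).
  by rewrite (_ : _ \o _ = (fun x => (c k)%:E * (EFin \o \1_(cell delta ys k)) x)%E) //; exact: integrableZl.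
split.
  rewrite (_ : _ \o _ = ((EFin \o (fun x : Rd R d => (\sum_(j < k) c j * \1_(cell delta ys j) x)%R)) \+
     (EFin \o (fun x : Rd R d => (c k * \1_(cell delta ys k) x)%R)))%E); first exact: integrableD.
  by apply/funext => x /=; rewrite big_ord_recr.
rewrite big_ord_recr /= -IH2.
have -> : \int[m]_x (\sum_(j < k.+1) c j * \1_(cell delta ys j) x) =
    \int[m]_x (\sum_(j < k) c j * \1_(cell delta ys j) x + c k * \1_(cell delta ys k) x).
  by apply: eq_Rintegral => x _; rewrite big_ord_recr.
rewrite RintegralD //; congr (_ + _); rewrite RintegralZl //; congr (_ * _).
by rewrite /Rintegral integral_indic ?setIT //; exact: measurable_cell.
Qed.

Lemma cells_dual_le r delta eta ys m n : concentrated r m -> concentrated r n -> 0 <= delta ->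
  (forall x, eball r x -> exists2 y, y \in ys & `|x - y| <= delta) ->
  (forall y, y \in ys -> eball r y) ->
  (forall j, (j < size ys)%N ->
    `|fine (m (cell delta ys j)) - fine (n (cell delta ys j))| <= eta) ->
  dual_le r (2 * delta + (size ys)%:R * (r * eta)) m n.
Proof.
move=> cm cn delta0 cov ysr hmn f lf L L0 fL; have r0 := concentrated_ge0 cm.
(* Subtracting [f 0] leaves the difference of the two integrals unchanged and bounds every
   coefficient by [L * r]. *)
pose c j := f (nth 0 ys j) - f 0; pose g := cell_fun delta ys c.
pose h x := f x - f 0.
have cf := loclip_continuous lf.
have c0 : continuous (fun _ : 'rV[R]_d => f 0) by apply: Cinf_continuous; exact: Cinf_cst.
have ch : continuous h by move=> x; apply: continuousB; [exact: cf|exact: c0].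
have Br0 : eball r (0 : 'rV[R]_d) by rewrite /eball /= enorm0.
have hE p : concentrated r p -> \int[p]_x h x = \int[p]_x f x - f 0.
  by move=> cp; rewrite (cRintegralB cp) // cRintegral_cst.
have hg x : eball r x -> `|h x - g x| <= L * delta.
  move=> xr; have [y yys xy] := cov x xr.
  have hasy : has (fun y => `|x - y| <= delta) ys by apply/hasP; exists y.
  have fs : (cell_index delta ys x < size ys)%N by rewrite /cell_index -has_find.
  rewrite /g cell_funE // /h /c opprB addrA subrK (le_trans (fL _ _ xr _)) //.
    by apply: ysr; rewrite mem_nth.
  by rewrite ler_wpM2l // (nth_find 0 hasy).
have near p : concentrated r p -> `|\int[p]_x h x - \int[p]_x g x| <= L * delta.
  move=> cp; have [gi _] := cell_fun_integral delta ys c p.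
  have hi := concentrated_integrable cp ch.
  rewrite -RintegralB //; have Ld0 : 0 <= L * delta by exact: mulr_ge0.
  have hgi : p.-integrable setT (EFin \o (fun x : Rd R d => h x - g x)).
    exact: (@integrableB _ _ _ p setT measurableT _ _ hi gi).
  rewrite (le_trans (le_normr_Rintegral measurableT hgi)) // /Rintegral.
  have mhg : measurable_fun setT (fun x : Rd R d => h x - g x).
    by apply/measurable_EFinP; exact: measurable_int hgi.
  rewrite -[leRHS]/(fine (L * delta)%:E) fine_le //.
    rewrite ge0_fin_numE ?integral_ge0 //.
    by rewrite (le_lt_trans (integral_norm_le cp Ld0 mhg hg)) ?ltry.
  exact: (integral_norm_le cp Ld0 mhg hg).
have gmn : `|\int[m]_x g x - \int[n]_x g x| <= L * ((size ys)%:R * (r * eta)).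
  have [_ ->] := cell_fun_integral delta ys c m; have [_ ->] := cell_fun_integral delta ys c n.
  rewrite -sumrB (le_trans (ler_norm_sum _ _ _)) //.
  have -> : L * ((size ys)%:R * (r * eta)) = \sum_(j < size ys) L * (r * eta).
    by rewrite sumr_const card_ord -[_ *+ _]mulr_natl; ring.
  apply: ler_sum => j _; rewrite -mulrBr normrM mulrA ler_pM ?hmn //.
  have yr : eball r (nth 0 ys j) by apply: ysr; rewrite mem_nth.
  rewrite (le_trans (fL _ _ yr Br0)) // subr0 ler_wpM2l //.
  by rewrite (le_trans (le_norm_enorm _)).
have near' p : concentrated r p -> `|\int[p]_x g x - \int[p]_x h x| <= L * delta.
  by move=> cp; rewrite distrC near.
have := dist_trans3 (near' m cm) (near' n cn) gmn; rewrite !hE // opprB addrA subrK.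
move/le_trans; apply.
by rewrite [leRHS](_ : _ = L * ((size ys)%:R * (r * eta)) + L * delta + L * delta); [|ring].
Qed.

End Cells.

(** * Frequencies of events and empirical measures *)

Section Empirical.
Context {R : realType} {dO : measure_display} {Omega : measurableType dO}.
Variable P : probability Omega R.

Lemma measurable_frequency N (A : 'I_N -> set Omega) (p : R) : (forall i, measurable (A i)) ->
  measurable_fun setT (fun w => ((N%:R^-1 * \sum_i \1_(A i) w - p) ^+ 2)%:E).
Proof.
move=> mA; apply/measurable_EFinP; apply: measurable_funX; apply: measurable_funB => //.
apply: measurable_funM => //; apply: measurable_sum => i; exact: measurable_indic.
Qed.

(** For pairwise independent events of probability p the variance of the frequency is p (1 - p) /
    N. *)
Lemma frequency_variance N (A : 'I_N -> set Omega) (p : R) : (0 < N)%N ->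
  (forall i, measurable (A i)) -> (forall i, P (A i) = p%:E) ->
  (forall i j, i != j -> P (A i `&` A j) = (p ^+ 2)%:E) ->
  (\int[P]_w ((N%:R^-1 * \sum_i \1_(A i) w - p) ^+ 2)%:E <= (N%:R^-1)%:E)%E.
Proof.
move=> N0 mA PA PAA.
have NR : (N%:R : R) != 0 by rewrite pnatr_eq0 -lt0n.
have NV : 0 <= (N%:R : R)^-1 by rewrite invr_ge0.
have p0 : 0 <= p by rewrite -lee_fin -(PA (Ordinal N0)).
have p1 : p <= 1 by rewrite -lee_fin -(PA (Ordinal N0)) probability_le1.
pose S w : R := \sum_i \1_(A i) w.
have S0 w : 0 <= S w by apply: sumr_ge0.
have mS : measurable_fun setT S by apply: measurable_sum => i; exact: measurable_indic.
have mI i : measurable_fun setT (fun w => (\1_(A i) w : R)%:E).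
  by apply/measurable_EFinP; exact: measurable_indic.
have mII i j : measurable_fun setT (fun w => (\1_(A i `&` A j) w : R)%:E).
  by apply/measurable_EFinP; apply: measurable_indic; exact: measurableI.
have PI i : (\int[P]_w (\1_(A i) w)%:E = p%:E)%E.
  by rewrite integral_indic // setIT; exact: PA.
have PII i j : i != j -> (\int[P]_w (\1_(A i `&` A j) w)%:E = (p ^+ 2)%:E)%E.
  by move=> ij; rewrite integral_indic //; [rewrite setIT; exact: PAA|exact: measurableI].
have mF (F : Omega -> R) : measurable_fun setT F -> measurable_fun setT (EFin \o F).
  by move=> h; apply/measurable_EFinP.
set I := (\int[P]_w _)%E.
have I0 : (0 <= I)%E by apply: integral_ge0 => w _; rewrite lee_fin sqr_ge0.
have IS : (\int[P]_w (S w)%:E = (N%:R * p)%:E)%E.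
  rewrite /S; under eq_integral do rewrite -sumEFin.
  rewrite ge0_integral_sum //.
  under eq_bigr => i _ do rewrite PI.
  by rewrite sumEFin sumr_const card_ord -[p *+ N]mulr_natl.
have ISS : (\int[P]_w (S w ^+ 2)%:E = (N%:R * p + N%:R * (N%:R - 1) * p ^+ 2)%:E)%E.
  have -> : (\int[P]_w (S w ^+ 2)%:E = \int[P]_w (\sum_i \sum_j (\1_(A i `&` A j) w)%:E))%E.
    apply: eq_integral => w _; rewrite expr2 {1}/S mulr_suml -sumEFin; apply: eq_bigr => i _.
    rewrite mulr_sumr -sumEFin; apply: eq_bigr => j _.
    by rewrite indicI.
  rewrite ge0_integral_sum //; last 2 first.
  - by move=> i; apply: emeasurable_sum => j; exact: mII.
  - by move=> i w _; apply: sume_ge0 => j _; rewrite lee_fin.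
  under eq_bigr => i _.
    rewrite ge0_integral_sum //.
    rewrite (_ : (\sum_j _)%E = (p + (N%:R - 1) * p ^+ 2)%:E); first over.
    rewrite (bigD1 i) //= setIid PI EFinD; congr (_ + _)%E.
    under eq_bigr => j ji do rewrite PII 1?eq_sym //.
    rewrite sumEFin sumr_const -[_ *+ _]mulr_natl; congr (_ * _)%:E.
    rewrite cardC1 card_ord -subn1 natrB //.
  rewrite sumEFin sumr_const card_ord -[_ *+ _]mulr_natl; congr EFin; ring.
pose F1 w := (N%:R^-1 * S w - p) ^+ 2; pose F2 w := 2 * p * N%:R^-1 * S w.
pose F3 w := N%:R^-1 ^+ 2 * S w ^+ 2.
have S_ge0 w : (0 <= (S w)%:E)%E by rewrite lee_fin.
have S2_ge0 w : (0 <= (S w ^+ 2)%:E)%E by rewrite lee_fin sqr_ge0.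
have F1_ge0 w : (0 <= (F1 w)%:E)%E by rewrite lee_fin sqr_ge0.
have F2_ge0 w : (0 <= (F2 w)%:E)%E by rewrite lee_fin !mulr_ge0.
have F3_ge0 w : (0 <= (F3 w)%:E)%E by rewrite lee_fin mulr_ge0 ?sqr_ge0.
have p2_ge0 : (0 <= (p ^+ 2)%:E)%E by rewrite lee_fin sqr_ge0.
have mS2 : measurable_fun setT (fun w => S w ^+ 2) by exact: measurable_funX.
have mF1 : measurable_fun setT (fun w => (F1 w)%:E) by exact: measurable_frequency.
have mF2 : measurable_fun setT (fun w => (F2 w)%:E).
  by apply: mF; apply: measurable_funM => //; exact: measurable_cst.
have mF3 : measurable_fun setT (fun w => (F3 w)%:E).
  by apply: mF; apply: measurable_funM => //; exact: measurable_cst.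
(* The expanded square, with the negative cross term moved to the left so that every integrand is
   nonnegative. *)
have key : (I + (2 * p * N%:R^-1)%:E * \int[P]_w (S w)%:E =
    (N%:R^-1 ^+ 2)%:E * \int[P]_w (S w ^+ 2)%:E + \int[P]_w (cst (p ^+ 2)%:E w))%E.
  rewrite -!ge0_integralZl_EFin ?sqr_ge0 ?mulr_ge0 //; try exact: mF.
  rewrite -[I]/(\int[P]_w (F1 w)%:E)%E.
  rewrite -[X in (_ + X)%E]/(\int[P]_w (F2 w)%:E)%E -[X in _ = (X + _)%E]/(\int[P]_w (F3 w)%:E)%E.
  rewrite -!ge0_integralD //.
  by apply: eq_integral => w _; rewrite -!EFinD; congr EFin; rewrite /F1 /F2 /F3; ring.
have IC : (\int[P]_w (cst (p ^+ 2)%:E w) = (p ^+ 2)%:E)%E.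
  by rewrite integral_cst // [X in (_ * X)%E]probability_setT mule1.
move: key; rewrite IS ISS IC -!EFinM -EFinD => key.
have : (I <= ((N%:R^-1) ^+ 2 * (N%:R * p + N%:R * (N%:R - 1) * p ^+ 2) + p ^+ 2 - 2 * p * N%:R^-1 * (N%:R * p))%:E)%E.
  by rewrite EFinB leeBrDr // key.
move/le_trans; apply; rewrite lee_fin.
rewrite [leLHS](_ : _ = N%:R^-1 * (p * (1 - p))); last by field.
by rewrite ler_piMr // mulr_ile1 // ?subr_ge0 // gerBl.
Qed.

(* Along the sample sizes [2 ^ k] the variances are summable, so the
   frequencies converge almost surely without a fourth moment bound. *)
Lemma frequency_cvg (A : forall N, 'I_N -> set Omega) (p : R) :
  (forall N i, (0 < N)%N -> measurable (A N i)) ->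
  (forall N i, (0 < N)%N -> P (A N i) = p%:E) ->
  (forall N i j, (0 < N)%N -> i != j -> P (A N i `&` A N j) = (p ^+ 2)%:E) ->
  \forall w \ae P, forall e, 0 < e -> exists k0, forall k, (k0 <= k)%N ->
    `|(2 ^ k)%:R^-1 * \sum_i \1_(A (2 ^ k)%N i) w - p| <= e.
Proof.
move=> mA PA PAA.
have N0 k : (0 < 2 ^ k)%N by rewrite expn_gt0.
pose Z k w := ((2 ^ k)%:R^-1 * \sum_i \1_(A (2 ^ k)%N i) w - p) ^+ 2.
have Z0 k w : 0 <= Z k w by exact: sqr_ge0.
have Z0E k w : setT w -> (0 <= (Z k w)%:E)%E by rewrite lee_fin.
have mZ k : measurable_fun setT (fun w => (Z k w)%:E).
  by apply: measurable_frequency => i; exact: mA.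
have IZ k : (\int[P]_w (Z k w)%:E <= ((1 / 2) ^+ k)%:E)%E.
  have -> : (1 / 2) ^+ k = (2 ^ k)%:R^-1 :> R by rewrite div1r exprVn natrX.
  by apply: frequency_variance => // [i|i|i j ij]; [exact: mA|exact: PA|exact: PAA].
(* The second moments sum to at most 2, so the series of squared deviations is almost surely finite
   and its terms tend to 0. *)
have sumZ : (\int[P]_w \sum_(0 <= k <oo) (Z k w)%:E < +oo)%E.
  rewrite integral_nneseries //.
  apply: (@le_lt_trans _ _ (\sum_(0 <= k <oo) ((1 / 2) ^+ k)%:E)%E).
    by apply: lee_nneseries => [k _ _|k _]; [apply: integral_ge0 => w _; rewrite lee_fin|exact: IZ].
  apply: (@le_lt_trans _ _ 2%:E); last exact: ltry.
  apply: lime_le; first by apply: is_cvg_nneseries => k _ _; rewrite lee_fin exprn_ge0.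
  apply: nearW => n; rewrite sumEFin lee_fin.
  suff -> : \sum_(0 <= k < n) (1 / 2 : R) ^+ k = 2 - 2 * (1 / 2) ^+ n.
    by rewrite gerBl mulr_ge0 // exprn_ge0.
  elim: n => [|n IH]; first by rewrite big_nil expr0 mulr1 subrr.
  by rewrite big_nat_recr //= IH exprS; field.
have mS : measurable_fun setT (fun w => \sum_(0 <= k <oo) (Z k w)%:E)%E.
  apply: (@ge0_emeasurable_sum _ _ _ _ (fun k w => (Z k w)%:E) predT) => [k w wT _|k _].
    exact: Z0E.
  exact: mZ.
have S0 w : (0 <= \sum_(0 <= k <oo) (Z k w)%:E)%E by apply: nneseries_ge0 => k _ _; exact: Z0E.
have iS : P.-integrable setT (fun w => \sum_(0 <= k <oo) (Z k w)%:E)%E.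
  apply/integrableP; split => //; under eq_integral do rewrite gee0_abs //.
  exact: sumZ.
have := integrable_ae measurableT iS.
apply: (@filterS _ _ (ae_filter_ringOfSetsType P)) => w /(_ I) finS e e0.
pose s := fine (\sum_(0 <= k <oo) (Z k w)%:E)%E.
have sE : (\sum_(0 <= k <oo) (Z k w)%:E = s%:E)%E by rewrite fineK.
have part n : \sum_(0 <= k < n) Z k w <= s.
  rewrite -lee_fin -sE -sumEFin; apply: nneseries_lim_ge => k _ _; exact: Z0E.
have cvgS : cvgn (series (fun k => Z k w)).
  apply: nondecreasing_is_cvgn.
    by apply/nondecreasing_seqP => n; rewrite /series /= big_nat_recr //= lerDl.
  by exists s => _ [n _ <-]; exact: part.
have /cvgrPdist_le /(_ _ (exprn_gt0 2 e0)) [k0 _ hk] := cvg_series_cvg_0 cvgS.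
exists k0 => k k0k; have := hk k k0k; rewrite /= sub0r normrN ger0_norm //.
move=> h; rewrite -(@ler_pXn2r _ 2) ?nnegrE ?(ltW e0) ?normr_ge0 //.
by rewrite real_normK ?num_real.
Qed.

Context {d : nat}.
Implicit Types (m n law : probability (Rd R d) R) (r : R).

Lemma empirical_cell N (x : 'I_N -> Omega -> 'rV[R]_d) (w : Omega) (Q : set (Rd R d)) :
  empirical (fun i => x i w) Q = (N%:R^-1 * \sum_i \1_(x i @^-1` Q) w)%:E.
Proof.
by rewrite /empirical EFinM -sumEFin; congr (_ * _)%E; apply: eq_bigr => i _; rewrite diracE indicE.
Qed.

Lemma iid_cvg law (x : forall N, 'I_N -> Omega -> 'rV[R]_d) (Q : set (Rd R d)) :
  measurable Q -> (forall N, (0 < N)%N -> iid P law (x N)) ->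
  \forall w \ae P, forall e, 0 < e -> exists k0, forall k, (k0 <= k)%N ->
    `|fine (empirical (fun i => x (2 ^ k)%N i w) Q) - fine (law Q)| <= e.
Proof.
move=> mQ xiid; pose p := fine (law Q).
have pE : law Q = p%:E by rewrite fineK // fin_num_measure.
have mx N i : (0 < N)%N -> measurable (x N i @^-1` Q).
  by move=> /xiid[mx _ _]; rewrite -[X in measurable X]setTI; exact: mx.
have Px N i : (0 < N)%N -> P (x N i @^-1` Q) = p%:E.
  by move=> /xiid[_ hx _]; rewrite hx.
have := @frequency_cvg (fun N i => x N i @^-1` Q) p mx Px.
have Pxx N i j : (0 < N)%N -> i != j -> P (x N i @^-1` Q `&` x N j @^-1` Q) = (p ^+ 2)%:E.
  move=> N0 ij; have [_ _ hx] := xiid _ N0.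
  (* Independence is used for pairs only. *)
  have := hx [set i; j]%SET (fun=> Q) (fun=> mQ).
  rewrite big_setU1 ?inE //= big_set1 !Px // -EFinM -expr2 => <-; congr (P _).
  apply/seteqP; split=> w /=.
    by move=> [wi wj] l /=; rewrite !inE => /orP[]/eqP ->.
  by move=> h; split; apply: h; rewrite /= !inE eqxx ?orbT.
move=> /(_ Pxx); apply: (@filterS _ _ (ae_filter_ringOfSetsType P)) => w h e e0.
have [k0 hk0] := h e e0; exists k0 => k k0k.
by rewrite empirical_cell /=; exact: hk0.
Qed.

(** The nets of mesh 1/(l + 1) and their cells form a countable family, so one null set serves all
    [e]. The measures [m] and [n] come after [k0]: only their values on Borel sets and the ball
    matter. *)
Lemma empirical_dual_cvg law r (x : forall N, 'I_N -> Omega -> 'rV[R]_d) : 0 <= r ->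
  (forall N, (0 < N)%N -> iid P law (x N)) ->
  \forall w \ae P, forall e, 0 < e -> exists k0, forall k m n, (k0 <= k)%N ->
    concentrated r m -> concentrated r n ->
    (forall A, measurable A -> m A = empirical (fun i => x (2 ^ k)%N i w) A) ->
    (forall A, measurable A -> n A = law A) -> dual_le r e m n.
Proof.
move=> r0 xiid; pose dl l : R := l.+1%:R^-1.
have dl0 l : 0 < dl l by rewrite invr_gt0.
have /choice [ys hys] l : exists ys : seq 'rV[R]_d, (forall y, y \in ys -> eball r y) /\
    forall z, eball r z -> exists2 y, y \in ys & `|z - y| <= dl l.
  by have [ys ? ?] := compact_net (@eball_compact R d r) (dl0 l); exists ys.
have : \forall w \ae P, forall l j e, 0 < e -> exists k0, forall k, (k0 <= k)%N ->
    `|fine (empirical (fun i => x (2 ^ k)%N i w) (cell (dl l) (ys l) j)) -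
      fine (law (cell (dl l) (ys l) j))| <= e.
  apply/ae_foralln => l; apply/ae_foralln => j; apply: iid_cvg => //.
  exact: measurable_cell.
apply: (@filterS _ _ (ae_filter_ringOfSetsType P)) => w hw e e0.
pose l := Num.truncn (4 / e).
have dle : 2 * dl l <= e / 2.
  rewrite /dl ler_pdivlMr // mulrAC ler_pdivrMr ?ltr0n // -ler_pdivrMl //.
  by rewrite (le_trans _ (ltW (truncnS_gt _))) // mulrC; apply: ler_wpM2r; [rewrite invr_ge0 ltW|lra].
(* Makes the cell errors in [cells_dual_le] add up to at most [e / 2]; the 1 in the denominator
   covers an empty net or radius 0. *)
pose eta := e / 2 / ((size (ys l))%:R * r + 1).
have D0 : 0 < (size (ys l))%:R * r + 1 by rewrite ltr_wpDl // mulr_ge0.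
have eta0 : 0 < eta by rewrite !divr_gt0.
have /choice [k0 hk0] j := hw l j eta eta0.
exists (\max_(j < size (ys l)) k0 j)%N => k m n kk cm cn mE nE.
have [ysr cov] := hys l.
have := @cells_dual_le _ _ r (dl l) eta (ys l) m n cm cn (ltW (dl0 l)) cov ysr.
move=> H f lf L L0 fL; apply: le_trans (H _ f lf L L0 fL) _.
  move=> j jl; rewrite mE ?nE; try exact: measurable_cell.
  by apply: hk0; rewrite (leq_trans _ kk) // (leq_bigmax (Ordinal jl)).
rewrite ler_wpM2l // [leRHS](_ : e = e / 2 + e / 2); last by rewrite -splitr.
rewrite lerD // mulrA (@le_trans _ _ (((size (ys l))%:R * r + 1) * eta)) //.
  by rewrite ler_wpM2r ?(ltW eta0) // lerDl.
by rewrite /eta mulrC divfK // gt_eqF.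
Qed.

End Empirical.

(** * Consistency and rates *)

Section Consistency.
Context {R : realType} {d : nat}.
Variables (T : R) (a : R -> R) (r M : R).
Hypotheses (T0 : 0 < T) (aa : admissible a) (r0 : 0 < r).
Implicit Types (mu nu : R -> probability (Rd R d) R) (b : R -> R) (s t : R).

Let ka : kernel a := admissible_kernel aa.
Let q : R := 2 * r.
Let q0 : 0 < q. Proof. by rewrite mulr_gt0. Qed.

Lemma XMK_extend b : XMK M `[0, q] b ->
  [/\ 0 <= M, kernel_on q M M (extend q b), kernel (extend q b) & admissible (extend q b)].
Proof.
move=> /(XMK_kernel_on q0)[M0 bM]; split => //.
- exact: kernel_on_extend (ltW q0) M0 bM.
- by apply: kernel_extend (ltW q0) _ _ bM.
- exact: admissible_extend (ltW q0) M0 bM.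
Qed.

Lemma error_stability : 0 <= M -> exists2 C, 0 <= C & forall mu nu b A0,
  weak_solution T a r mu -> weak_solution T a r nu -> XMK M `[0, q] b -> 0 <= A0 ->
  dual_le r A0 (mu 0) (nu 0) ->
  (error T a nu (extend q b) <= error T a mu (extend q b) + (C * A0)%:E)%E.
Proof.
move=> M0; have [B [L [B0 L0 kB]]] := ka (ltW q0).
have V0 : 0 <= B * (2 * r) by rewrite mulr_ge0 // ltW.
have W0 : 0 <= B + L * d%:R * (2 * r) by rewrite addr_ge0 // !mulr_ge0 // ltW.
have [C C0 stab] := @weak_stability R d T a r _ _ ka V0 W0
  (fun i => Fcoord_bound i B0 kB) (fun i => Fcoord_lip i B0 L0 kB).
have [D D0 errD] := @err_dual_le R d a r ka (ltW r0) M M M0 M0.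
exists (D * C) => [|mu nu b A0 smu snu bX A00 h0]; first exact: mulr_ge0.
have [_ bM kb _] := XMK_extend bX; have [cmu _ _] := smu; have [cnu _ _] := snu.
rewrite -[X in (_ <= X + _)%E]mul1e.
apply: (error_le T0 ka snu smu kb kb) => // [|t tT]; first by rewrite !mulr_ge0.
have := errD _ _ _ _ kb bM (cmu t tT) (cnu t tT) (mulr_ge0 C0 A00) (stab _ _ smu snu _ A00 h0 t tT).
by rewrite mulrA ler_norml mul1r => /andP[h _]; lra.
Qed.

Lemma error_close mu b eta : weak_solution T a r mu -> XMK M `[0, q] b -> 0 <= eta ->
  (forall s, 0 <= s <= q -> `|a s - b s| <= eta) ->
  (error T a mu (extend q b) <= (d%:R * q ^+ 2 * eta ^+ 2)%:E)%E.
Proof.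
move=> smu bX eta0 ab; have [_ _ kb _] := XMK_extend bX; have [cmu _ _] := smu.
rewrite -[leRHS]add0e -[X in (X + _)%E](mul0e (error T a mu a)).
apply: (error_le T0 ka smu smu kb ka) => // [|t tT].
  by apply: mulr_ge0; rewrite ?sqr_ge0 // mulr_ge0 ?sqr_ge0.
rewrite mul0r add0r [leRHS](_ : _ = d%:R * (eta * (2 * r)) ^+ 2); last by rewrite -/q; ring.
apply: (err_le_close ka (cmu t tT) kb eta0) => s sq.
by rewrite extend_eq // distrC ab.
Qed.

Lemma error_perturb mu b b' eta : weak_solution T a r mu -> XMK M `[0, q] b -> XMK M `[0, q] b' ->
  0 <= eta -> (forall s, 0 <= s <= q -> `|b s - b' s| <= eta) ->
  (error T a mu (extend q b) <=
    2%:E * error T a mu (extend q b') + (2 * (d%:R * q ^+ 2 * eta ^+ 2))%:E)%E.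
Proof.
move=> smu bX b'X eta0 bb; have [_ _ kb _] := XMK_extend bX; have [_ _ kb' _] := XMK_extend b'X.
have [cmu _ _] := smu; apply: (error_le T0 ka smu smu kb kb') => // [|t tT].
  by apply: mulr_ge0 => //; apply: mulr_ge0; rewrite ?sqr_ge0 // mulr_ge0 ?sqr_ge0.
have -> : d%:R * q ^+ 2 * eta ^+ 2 = d%:R * (eta * (2 * r)) ^+ 2 by rewrite -/q; ring.
apply: (err_le_perturb ka (cmu t tT) kb kb' eta0) => s sq.
by rewrite !extend_eq // bb.
Qed.

Lemma in_L2_extend mu b : weak_solution T a r mu -> XMK M `[0, q] b ->
  in_L2 (rho T mu) (extend q b).
Proof.
move=> smu bX; have [M0 [bM _] _ _] := XMK_extend bX.
have [m [-> mT m0]] := rho_measure T0 ka smu (ltW r0).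
have [_ [_ bL]] := XMK_kernel_on q0 bX.
have mb : measurable_fun setT (extend q b).
  apply: continuous_measurable_fun; apply: (@lip_fun_continuous _ M).
  exact: extend_lip (ltW q0) M0 bL.
split; first exact: measurable_funTS.
rewrite /L2sq (@le_lt_trans _ _ (\int[m]_(s in Rplus) (cst (M ^+ 2)%:E s))%E) //.
  apply: ge0_le_integral => //; first exact: measurable_itv.
  - by move=> s _; rewrite lee_fin sqr_ge0.
  - by apply/measurable_EFinP/measurable_funTS; exact: measurable_funX.
  move=> s _; rewrite lee_fin -[leLHS]real_normK ?num_real // lerXn2r ?nnegrE //.
  have := bM (Num.min (Num.max s 0) q) (clamp_itv _ (ltW q0)).
  by rewrite extend_eq // clamp_itv // ltW.
rewrite integral_cst; last exact: measurable_itv.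
apply: lte_mul_pinfty; rewrite ?lee_fin ?sqr_ge0 //.
by apply: le_lt_trans mT; apply: le_measure; rewrite ?inE //; exact: measurable_itv.
Qed.

(** Nothing is known of [a] on the negative half-line, so on [Rplus] it is obtained as the pointwise
    limit of its continuous extensions from [0, n + 1]. *)
Lemma measurable_admissible : measurable_fun (Rplus : set R) a.
Proof.
apply: (@measurable_fun_cvg _ _ _ Rplus (fun n => extend n.+1%:R a)) => [n|s].
  apply: measurable_funTS; have [B [L [B0 L0 [_ aL]]]] := ka (ler0n R n.+1).
  apply: continuous_measurable_fun; apply: (@lip_fun_continuous _ L).
  exact: extend_lip.
rewrite /Rplus /= in_itv /= andbT => s0; apply/cvgrPdist_le => e e0.
near=> n; rewrite extend_eq ?subrr ?normr0 ?(ltW e0) // s0 /=.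
rewrite (le_trans (ltW (truncnS_gt s))) // ler_nat ltnS.
by near: n; exact: nbhs_infty_ge.
Unshelve. all: by end_near. Qed.

Lemma L2sq_ge0 mu b : weak_solution T a r mu -> (0 <= L2sq (rho T mu) b)%E.
Proof.
move=> smu; have [m [-> _ _]] := rho_measure T0 ka smu (ltW r0).
by apply: integral_ge0 => s _; rewrite lee_fin sqr_ge0.
Qed.

Lemma L2sq_sym mu b b' :
  L2sq (rho T mu) (fun s => b s - b' s) = L2sq (rho T mu) (fun s => b' s - b s).
Proof.
rewrite /L2sq; congr integral; apply/funext => s.
by congr EFin; rewrite -sqrrN opprB.
Qed.

Lemma L2sq_eq0 mu b : weak_solution T a r mu -> XMK M `[0, q] b ->
  L2sq (rho T mu) (fun s => extend q b s - a s) = 0%E -> ae_equal (rho T mu) (extend q b) a.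
Proof.
move=> smu bX; have [mb _] := in_L2_extend smu bX; move: mb.
have [m [-> _ _]] := rho_measure T0 ka smu (ltW r0).
move=> mb; rewrite /L2sq /ae_equal => h.
have mD : measurable (Rplus : set R) by exact: measurable_itv.
have mF : measurable_fun Rplus (fun s => ((extend q b s - a s) ^+ 2)%:E).
  apply/measurable_EFinP; apply: measurable_funX; apply: measurable_funB => //.
  exact: measurable_admissible.
have /(ae_eq_integral_abs m mD mF) :
    (\int[m]_(s in Rplus) `|((extend q b s - a s) ^+ 2)%:E| = 0)%E.
  by rewrite -[RHS]h; apply: eq_integral => s _; rewrite gee0_abs // lee_fin sqr_ge0.
apply: (@filterS _ _ (ae_filter_ringOfSetsType m)) => s hs sR; apply/eqP.
by rewrite -subr_eq0 -sqrf_eq0 -eqe hs.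
Qed.

Lemma coercive_le mu (cT : R) b : weak_solution T a r mu -> XMK M `[0, q] b -> 0 < cT ->
  (forall b, admissible b -> in_L2 (rho T mu) b ->
     (cT%:E * L2sq (rho T mu) (fun s => (b s - a s)%R) <= error T a mu b)%E) ->
  (L2sq (rho T mu) (fun s => (a s - extend q b s)%R) <= (cT^-1)%:E * error T a mu (extend q b))%E.
Proof.
move=> smu bX c0 coer; have [_ _ _ ab] := XMK_extend bX.
by rewrite lee_pdivlMl // L2sq_sym; apply: coer => //; exact: in_L2_extend.
Qed.

Lemma minimizer_error mu nu A0 C eta b ahat (V : set (R -> R)) :
  weak_solution T a r mu -> weak_solution T a r nu -> V `<=` XMK M `[0, q] ->
  argmin V (fun b => error T a nu (extend q b)) ahat -> V b -> 0 <= eta ->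
  (forall s, 0 <= s <= q -> `|a s - b s| <= eta) ->
  (error T a mu (extend q ahat) <= error T a nu (extend q ahat) + (C * A0)%:E)%E ->
  (error T a mu (extend q ahat) <= (d%:R * q ^+ 2 * eta ^+ 2 + C * A0)%:E)%E.
Proof.
move=> smu snu VX [Va amin] Vb eta0 ab /le_trans; apply.
rewrite EFinD leeD2r // (le_trans (amin _ Vb)) //.
exact: (error_close snu (VX _ Vb) eta0 ab).
Qed.

End Consistency.

(** * Powers of N and the passage from [W1] to the dual distance *)

Section Rates.
Context {R : realType}.
Implicit Types (alpha beta gamma C : R) (N : nat).

Lemma rate_le N alpha beta : (0 < N)%N -> alpha <= beta -> N%:R `^ (- beta) <= N%:R `^ (- alpha).
Proof. by move=> N0 ab; apply: ler_powR; [rewrite ler1n|rewrite lerN2]. Qed.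

Lemma rate_sqr_le N alpha beta : (0 < N)%N -> 0 < alpha -> beta <= alpha ->
  (N%:R `^ (- alpha)) ^+ 2 <= N%:R `^ (- beta).
Proof.
move=> N0 a0 ba; rewrite (le_trans _ (rate_le N0 ba)) // expr2 ler_piMl ?powR_ge0 //.
have := rate_le N0 (ltW a0); by rewrite oppr0 powRr0.
Qed.

Lemma rate_cvg C gamma : 0 < C -> 0 < gamma ->
  (C * N%:R `^ (- gamma))%:E @[N --> \oo] --> (0%E : \bar R).
Proof.
move=> C0 g0; apply: cvg_EFin; first exact: nearW.
apply/cvgrPdist_le => e e0; near=> N.
have N0 : (0 < N)%N by near: N; exact: nbhs_infty_gt.
rewrite /= sub0r normrN ger0_norm ?mulr_ge0 ?powR_ge0 ?(ltW C0) // powRN.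
rewrite ler_pdivrMr ?powR_gt0 ?ltr0n // mulrC -ler_pdivrMr //.
have Ce0 : 0 <= C / e by rewrite divr_ge0 // ltW.
rewrite -[leLHS]powRr1 // -[X in _ `^ X](mulVf (lt0r_neq0 g0)) powRrM.
apply: ge0_ler_powR; rewrite ?nnegrE ?powR_ge0 ?(ltW g0) //.
rewrite (le_trans (ltW (truncnS_gt _))) // ler_nat.
by near: N; exact: nbhs_infty_ge.
Unshelve. all: by end_near. Qed.

Lemma strictly_increasing_ge (sigma : nat -> nat) : {homo sigma : m n / (m < n)%N} ->
  forall k, (k <= sigma k)%N.
Proof. by move=> h; elim=> // k IH; rewrite (leq_ltn_trans IH) // h. Qed.

Lemma W1_dual_le d r c (m n : probability (Rd R d) R) : concentrated r m -> concentrated r n ->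
  (W1 m n <= c%:E)%E -> dual_le r c m n.
Proof.
move=> cm cn Wc f lf L L0 fL; apply: le_eps => e e0.
have c1 : 0 < `|c| + 1 by rewrite ltr_wpDl.
(* [W1_dist] asks for a positive constant; this enlargement of [L] costs at most [e] in the
   bound. *)
pose D := L + e / (`|c| + 1); have D0 : 0 < D by rewrite ltr_wpDl // divr_gt0.
have fD : lip_on r D f.
  move=> x y xr yr; rewrite (le_trans (fL x y xr yr)) // ler_wpM2r // lerDl.
  by rewrite ltW // divr_gt0.
have := W1_dist cm cn lf D0 fD; move=> /le_trans => /(_ (D * c)%:E).
rewrite EFinM lee_pmul2l ?lte_fin // => /(_ Wc); rewrite -EFinM lee_fin => /le_trans; apply.
rewrite mulrDl lerD2l (le_trans (ler_norm _)) // normrM (gtr0_norm (divr_gt0 e0 c1)).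
by rewrite -mulrA ler_piMr ?(ltW e0) // mulrC ler_pdivrMr // mul1r lerDl.
Qed.

End Rates.

Theorem theorem1p3 (R : realType) (d : nat) (T : R) (a : R -> R)
    (mu0 : probability (Rd R d) R) (mu : R -> probability (Rd R d) R)
    (Rad M : R)
    (d' : measure_display) (Omega : measurableType d') (P : probability Omega R)
    (x0 : forall N : nat, 'I_N -> Omega -> 'rV[R]_d)
    (muN : nat -> Omega -> R -> probability (Rd R d) R)
    (V : nat -> set (R -> R)) (ahat_ : nat -> Omega -> R -> R)
    (hT : 0 < T)
    (ha : admissible a)
    (hmu0 : compact (msupp mu0))
    (hmu : mf_solution T a mu0 mu)
    (hRad : support_radius T a mu0 Rad)
    (hM : (W1infty_norm (Kint Rad) a <= M%:E)%E)
    (hiid : forall N : nat, (0 < N)%N -> iid P mu0 (x0 N))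
    (hsupp : forall (N : nat) (i : 'I_N) (w : Omega), msupp mu0 (x0 N i w))
    (hmuN : forall (N : nat) (w : Omega), (0 < N)%N ->
       mf_solution T a (empirical (fun i => x0 N i w)) (muN N w))
    (hVsub : forall N : nat, (0 < N)%N -> V N `<=` XMK M (Kint Rad))
    (hVclosed : forall N : nat, (0 < N)%N -> closed_unif (Kint Rad) (V N))
    (hVapprox : unif_approx M (Kint Rad) V)
    (hahat : forall (N : nat) (w : Omega), (0 < N)%N ->
       argmin (V N) (fun b => error T a (muN N w) (extend (2 * Rad) b))
         (ahat_ N w)) :
  \forall w \ae P,
    (exists (sigma : nat -> nat) (ahat : R -> R),
      [/\ {homo sigma : m n / (m < n)%N} /\ forall k, (0 < sigma k)%N,
          unif_cvg (Kint Rad) (fun k => ahat_ (sigma k) w) ahat,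
          {within (Kint Rad), continuous (ahat : R -> R^o)} /\ XMK M (Kint Rad) ahat,
          error T a mu (extend (2 * Rad) ahat) = 0%E
        & coercive T a mu ->
          ae_equal (rho T mu) (extend (2 * Rad) ahat) a ])
    /\
    (coercive T a mu ->
      forall (alpha beta C1 C2 : R) (a_ : nat -> R -> R),
        0 < alpha -> 0 < beta -> 0 < C1 -> 0 < C2 ->
        (forall N : nat, (0 < N)%N -> V N (a_ N)) ->
        (forall N : nat, (0 < N)%N ->
          (Linfty (Kint Rad) (fun s => a s - a_ N s)%R
             <= (C1 * N%:R `^ (- alpha))%:E)%E) ->
        (forall N : nat, (0 < N)%N ->
          (W1 (empirical (fun i => x0 N i w)) mu0
             <= (C2 * N%:R `^ (- beta))%:E)%E) ->
        (exists2 C3 : R, 0 < C3 &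
          forall N : nat, (0 < N)%N ->
            (L2sq (rho T mu) (fun s => a s - extend (2 * Rad) (ahat_ N w) s)%R
               <= (C3 * N%:R `^ (- Num.min alpha beta))%:E)%E) /\
        L2sq (rho T mu) (fun s => a s - extend (2 * Rad) (ahat_ N w) s)
          @[N --> \oo] --> 0%E).
Proof.
have [Rad0 muRad muNRad] := hRad.
have q0 : 0 < 2 * Rad by rewrite mulr_gt0.
have ka := admissible_kernel ha.
have smu := mf_solution_weak ka hmu (muRad _ hmu).
have smuN N w : (0 < N)%N -> weak_solution T a Rad (muN N w).
  move=> N0; apply: (mf_solution_weak ka (hmuN N w N0)).
  by apply: (muNRad _ _ _ N0 _ (hmuN N w N0)) => i; exact: hsupp.
have aX : XMK M (Kint Rad) a by exact: admissible_XMK (ltW q0) ha hM.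
have [M0 aM] := XMK_kernel_on q0 aX.
have [C C0 stab] := @error_stability R d T a Rad M hT ha Rad0 M0.
have I0 : 0 \in `[0, T] by rewrite in_itv /= lexx ltW.
have cmu0 : concentrated Rad (mu 0) by have [h _ _] := smu; exact: h.
have cmuN0 N w : (0 < N)%N -> concentrated Rad (muN N w 0).
  by move=> N0; have [h _ _] := smuN N w N0; exact: h.
have mu0E A : measurable A -> mu 0 A = mu0 A by have [_ _ _ h _] := hmu; exact: h.
have muN0E N w A : (0 < N)%N -> measurable A -> muN N w 0 A = empirical (fun i => x0 N i w) A.
  by move=> N0; have [_ _ _ h _] := hmuN N w N0; exact: h.
have aX_ N w : (0 < N)%N -> XMK M (Kint Rad) (ahat_ N w).
  by move=> N0; apply: (hVsub N N0); have [] := hahat N w N0.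
have := empirical_dual_cvg (ltW Rad0) hiid.
apply: (@filterS _ _ (ae_filter_ringOfSetsType P)) => w hw; split; last first.
  (* The rates hold at every sample point where the Wasserstein hypothesis does; the almost sure
     event [hw] serves the subsequence only. *)
  move=> [cT cT0 coer] alpha beta C1 C2 a_ alpha0 beta0 C10 C20 a_V a_C1 W1_C2.
  pose gamma := Num.min alpha beta; have gamma0 : 0 < gamma by rewrite lt_min alpha0.
  have ga : gamma <= alpha by rewrite ge_min lexx.
  have gb : gamma <= beta by rewrite ge_min lexx orbT.
  (* The first term bounds the discrete error of [a_ N], the second the change from discrete to
     limit error; the 1 in [C3] keeps it positive. *)
  pose D := d%:R * (2 * Rad) ^+ 2 * C1 ^+ 2 + C * C2; pose C3 := cT^-1 * D + 1.
  have D0 : 0 <= D by rewrite addr_ge0 // ?mulr_ge0 ?sqr_ge0 // ltW.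
  have C30 : 0 < C3 by rewrite ltr_wpDl // mulr_ge0 // invr_ge0 ltW.
  have bound N : (0 < N)%N -> (L2sq (rho T mu) (fun s => a s - extend (2 * Rad) (ahat_ N w) s)%R
      <= (C3 * N%:R `^ (- gamma))%:E)%E.
    move=> N0; pose eta := C1 * N%:R `^ (- alpha); pose A0 := C2 * N%:R `^ (- beta).
    have eta0 : 0 <= eta by rewrite mulr_ge0 ?powR_ge0 // ltW.
    have A00 : 0 <= A0 by rewrite mulr_ge0 ?powR_ge0 // ltW.
    have [_ aNM] := XMK_kernel_on q0 (hVsub N N0 _ (a_V N N0)).
    have close := Linfty_dist q0 eta0 aM aNM (a_C1 N N0).
    have d0 : dual_le Rad A0 (muN N w 0) (mu 0).
      apply: W1_dual_le; [exact: cmuN0|exact: cmu0|].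
      rewrite (eq_W1 (fun A mA => muN0E N w A N0 mA) mu0E); exact: W1_C2.
    have st := stab _ _ _ _ (smuN N w N0) smu (aX_ N w N0) A00 d0.
    have := minimizer_error hT ha Rad0 smu (smuN N w N0) (hVsub N N0) (hahat N w N0) (a_V N N0) eta0 close st.
    move=> errN; apply: le_trans (coercive_le hT ha Rad0 smu (aX_ N w N0) cT0 coer) _.
    have cTV : (0 <= (cT^-1)%:E)%E by rewrite lee_fin invr_ge0 ltW.
    apply: le_trans (lee_wpmul2l cTV errN) _; rewrite -EFinM lee_fin.
    have D1 : d%:R * (2 * Rad) ^+ 2 * eta ^+ 2 + C * A0 <= D * N%:R `^ (- gamma).
      rewrite /D [leRHS]mulrDl lerD //.
        have k0 : 0 <= d%:R * (2 * Rad) ^+ 2 by rewrite mulr_ge0 ?sqr_ge0.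
        move: (d%:R * (2 * Rad) ^+ 2) k0 => k k0; rewrite /eta exprMn mulrA.
        by rewrite ler_wpM2l ?rate_sqr_le // mulr_ge0 ?sqr_ge0.
      by rewrite /A0 mulrA ler_wpM2l ?rate_le // mulr_ge0 // ltW.
    apply: (@le_trans _ _ (cT^-1 * (D * N%:R `^ (- gamma)))).
      by rewrite ler_wpM2l // invr_ge0 ltW.
    by rewrite mulrA ler_wpM2r ?powR_ge0 // /C3 lerDl.
  split; first by exists C3.
  apply: (@squeeze_cvge _ _ _ _ (cst 0%E) _ (fun N => (C3 * N%:R `^ (- gamma))%:E)).
  - near=> N; rewrite (L2sq_ge0 hT ha Rad0) //= bound //.
    by near: N; exact: nbhs_infty_gt.
  - exact: cvg_cst.
  - exact: rate_cvg.
have N0 k : (0 < 2 ^ k)%N by rewrite expn_gt0.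
(* The subsequence is extracted among the sample sizes [2 ^ k], where the initial data converge. *)
have [sig [f [sig_lt cf fM]]] := ascoli q0 M0 M0
  (fun k => (XMK_kernel_on q0 (aX_ _ w (N0 k))).2).
pose sigma k := (2 ^ sig k)%N.
have sig_ge := strictly_increasing_ge sig_lt.
have fX : XMK M (Kint Rad) f.
  by apply: (XMK_closed q0 _ cf) => k; exact: aX_.
(* [a] need not belong to [V N]; its approximations there serve as competitors of the minimizers. *)
have [b_ bV cb] := hVapprox a aX.
have err0 : error T a mu (extend (2 * Rad) f) = 0%E.
  apply/eqP; rewrite eq_le error_ge0 // andbT; apply/lee_addgt0Pr => e e0; rewrite add0e.
  (* Replacing [f] by the minimizer doubles the minimizer's bound (D + C) dl and adds 2 D dl;
     [dl <= 1] turns the squares into [dl]. *)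
  pose D := d%:R * (2 * Rad) ^+ 2; pose K := 2 * (D + C) + 2 * D.
  have D0 : 0 <= D by rewrite mulr_ge0 ?sqr_ge0.
  have K0 : 0 <= K by rewrite addr_ge0 // mulr_ge0 // addr_ge0.
  pose dl := Num.min 1 (e / (K + 1)).
  have K1 : 0 < K + 1 by rewrite ltr_wpDl.
  have dl0 : 0 < dl by rewrite lt_min ltr01 divr_gt0.
  have dl2 : dl ^+ 2 <= dl by rewrite expr2 ler_piMl ?(ltW dl0) // ge_min lexx.
  have dlK : K * dl <= e.
    have : dl <= e / (K + 1) by rewrite ge_min lexx orbT.
    rewrite ler_pdivlMr // => h; rewrite (le_trans _ h) // mulrC ler_wpM2l ?(ltW dl0) //.
    by rewrite lerDl.
  have [k1 hk1] := (unif_cvgP _ _ _).1 cf dl dl0.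
  have [k2 hk2] := (unif_cvgP _ _ _).1 cb dl dl0.
  have [k3 hk3] := hw dl dl0.
  pose k := maxn k1 (maxn k2 k3).
  have kk1 : (k1 <= k)%N by rewrite leq_maxl.
  (* [k1] concerns the index along the subsequence, [k3] the exponent of 2, and [k2] the sample
     size, which exceeds its exponent. *)
  have kk2 : (k2 <= sigma k)%N.
    rewrite (leq_trans _ (ltnW (ltn_expl _ _))) // (leq_trans _ (sig_ge _)) //.
    by rewrite leq_max leq_max leqnn orbT.
  have kk3 : (k3 <= sig k)%N by rewrite (leq_trans _ (sig_ge _)) // !leq_max leqnn !orbT.
  have s0 : (0 < sigma k)%N by exact: N0.
  have d0 : dual_le Rad dl (muN (sigma k) w 0) (mu 0).
    apply: (hk3 (sig k)) => //; [exact: cmuN0|by move=> A; exact: muN0E].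
  have st := stab _ _ _ _ (smuN _ w s0) smu (aX_ _ w s0) (ltW dl0) d0.
  have errN := minimizer_error hT ha Rad0 smu (smuN _ w s0) (hVsub _ s0) (hahat _ w s0) (bV _ s0)
    (ltW dl0) (hk2 _ kk2) st.
  have := error_perturb hT ha Rad0 smu fX (aX_ _ w s0) (ltW dl0) (hk1 _ kk1).
  move=> h; apply: le_trans h _.
  apply: (@le_trans _ _ (2%:E * (d%:R * (2 * Rad) ^+ 2 * dl ^+ 2 + C * dl)%:E +
     (2 * (d%:R * (2 * Rad) ^+ 2 * dl ^+ 2))%:E)%E).
    by rewrite leeD2r // lee_wpmul2l // lee_fin.
  rewrite -EFinM -EFinD lee_fin (le_trans _ dlK) // -/D /K.
  have h2 : D * dl ^+ 2 <= D * dl by rewrite ler_wpM2l.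
  by clear -h2; lra.
exists sigma, f; split => //.
- split=> [m n mn|k]; last exact: N0.
  by rewrite /sigma ltn_exp2l // sig_lt.
- split => //; apply: (@lipschitz_within _ _ _ M) => s t sT tT.
  have [_ fL] := fM; exact: (fL s t sT tT).
move=> [cT cT0 coer]; apply: (L2sq_eq0 hT ha Rad0 smu fX).
rewrite L2sq_sym; apply/eqP; rewrite eq_le (L2sq_ge0 hT ha Rad0 _ smu) andbT.
by rewrite (le_trans (coercive_le hT ha Rad0 smu fX cT0 coer)) // err0 mule0.
Unshelve. all: by end_near. Qed.
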